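(* Let $1\le\alpha\le2$. There is a constant $C$ (depending only on $\alpha$ and the fixed cutoff) such that for all radial $f,g\in L^2(\mathbb{R}^3)$, with $u^+(t)=S(t)f$ and $v^-(t)=S(-t)g$, and for any dyadic $\mu>0$ and $\lambda_1\ge\lambda_2>0$, $$\|P_\mu(u^+_{\lambda_1}v^-_{\lambda_2})\|_{L^2_{t,x}(\mathbb{R}^{1+3})}\le C\,\mu\,\lambda_2^{\frac{1-\alpha}{2}}\,\|f_{\lambda_1}\|_{L^2_x(\mathbb{R}^3)}\,\|g_{\lambda_2}\|_{L^2_x(\mathbb{R}^3)} .$$
   Context: $\widehat{S(t)\varphi}(\xi)=e^{-it|\xi|^\alpha}\widehat\varphi(\xi)$ for $t\in\mathbb{R}$. Dyadic numbers are elements of $2^{\mathbb{Z}}$. Let $\rho\in C_c^\infty(-2,2)$ be even with $\rho(s)=1$ for $|s|\le1$ (fixed), $\chi(\xi)=\rho(|\xi|)-\rho(2|\xi|)$, $\chi_\lambda(\xi)=\chi(\lambda^{-1}\xi)$, and $P_\lambda f=\mathcal F^{-1}(\chi_\lambda\mathcal Ff)$ (Fourier transform in the space variable). A subscript denotes frequency localization: $f_{\lambda}=P_{\lambda}f$, $u^+_{\lambda}=P_{\lambda}u^+$, and so on. *)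

(* Defs.v *)
From HB Require Import structures.
From mathcomp Require Import all_boot all_order all_algebra.
From mathcomp Require Import all_classical all_reals all_analysis.
From mathcomp Require Import complex.

Set Implicit Arguments.
Unset Strict Implicit.
Unset Printing Implicit Defensive.

Import Order.TTheory GRing.Theory Num.Theory.
Import numFieldNormedType.Exports.
Local Open Scope classical_set_scope.
Local Open Scope complex_scope.
Local Open Scope ring_scope.

Notation R3 R := (R * R * R)%type.

(* Canonical inference does not find this instance on iterated products. *)
Lemma sigma_finite_product d1 d2 (T1 : measurableType d1)
    (T2 : measurableType d2) (R : realType)
    (m1 : {sigma_finite_measure set T1 -> \bar R})
    (m2 : {sigma_finite_measure set T2 -> \bar R}) :
  sigma_finite setT (m1 \x m2)%E.
Proof.
have /sigma_finiteP[F [TF ndF Foo]] := sigma_finiteT m1.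
have /sigma_finiteP[G [TG ndG Goo]] := sigma_finiteT m2.
exists (fun n => F n `*` G n).
  rewrite -setXTT TF TG predeqE => -[x y]; split.
    move=> [/= [n _ Fnx] [k _ Gky]]; exists (maxn n k) => //; split.
    - by move: x Fnx; exact/subsetPset/ndF/leq_maxl.
    - by move: y Gky; exact/subsetPset/ndG/leq_maxr.
  by move=> [n _ []/= ? ?]; split; exists n.
move=> k; have [? ?] := Foo k; have [? ?] := Goo k.
split; first exact: measurableX.
by rewrite product_measure1E// lte_mul_pinfty// ge0_fin_numE.
Qed.

Definition leb2 (R : realType) := (@lebesgue_measure R \x @lebesgue_measure R)%E.
HB.instance Definition _ (R : realType) := Measure.on (@leb2 R).
HB.instance Definition _ (R : realType) :=
  Measure_isSigmaFinite.Build _ _ _ (@leb2 R)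
    (sigma_finite_product (@lebesgue_measure R) (@lebesgue_measure R)).

Definition leb3 (R : realType) := (@leb2 R \x @lebesgue_measure R)%E.
HB.instance Definition _ (R : realType) := Measure.on (@leb3 R).
HB.instance Definition _ (R : realType) :=
  Measure_isSigmaFinite.Build _ _ _ (@leb3 R)
    (sigma_finite_product (@leb2 R) (@lebesgue_measure R)).

Definition leb13 (R : realType) := (@lebesgue_measure R \x @leb3 R)%E.
HB.instance Definition _ (R : realType) := Measure.on (@leb13 R).
HB.instance Definition _ (R : realType) :=
  Measure_isSigmaFinite.Build _ _ _ (@leb13 R)
    (sigma_finite_product (@lebesgue_measure R) (@leb3 R)).

Definition dot3 (R : realType) (x y : R3 R) : R :=
  x.1.1 * y.1.1 + x.1.2 * y.1.2 + x.2 * y.2.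

(* The library norm `|x| on a product type is the sup norm. *)
Definition enorm3 (R : realType) (x : R3 R) : R := Num.sqrt (dot3 x x).

Definition scale3 (R : realType) (c : R) (x : R3 R) : R3 R :=
  (c * x.1.1, c * x.1.2, c * x.2).

(* cis t = e^{it} *)
Definition cis (R : realType) (t : R) : R[i] := cos t +i* sin t.

Section ComplexValued.
Context d (T : measurableType d) (R : realType).
Variable mu : {measure set T -> \bar R}.
Implicit Type f : T -> R[i].

Definition cmeasurable f : Prop :=
  measurable_fun setT (fun x => complex.Re (f x)) /\
  measurable_fun setT (fun x => complex.Im (f x)).

Definition cintegrable f : Prop :=
  mu.-integrable setT (fun x => (complex.Re (f x))%:E) /\
  mu.-integrable setT (fun x => (complex.Im (f x))%:E).

Definition cintegral f : R[i] :=
  (\int[mu]_x complex.Re (f x)) +i* (\int[mu]_x complex.Im (f x)).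

Definition L2norm f : \bar R := (Lnorm mu 2%:E (fun x => (Normc.normc (f x))%:E))%E.

Definition inL2 f : Prop := cmeasurable f /\ (L2norm f < +oo)%E.

End ComplexValued.

Section Fourier.
Variable R : realType.
Implicit Types (f : R3 R -> R[i]) (t : R).

Definition fourier_int f (xi : R3 R) : R[i] :=
  cintegral (@leb3 R) (fun x => cis (- dot3 x xi) * f x).

Definition inv_fourier_int f (x : R3 R) : R[i] :=
  (((2 * pi) ^- 3)%:C) * cintegral (@leb3 R) (fun xi => cis (dot3 x xi) * f xi).

Definition truncate (n : nat) f (x : R3 R) : R[i] :=
  if enorm3 x <= n%:R then f x else 0.

(* Extension to L^2 of an integral operator A defined on L^1: on L^1 it is A
   itself; on the rest of L^2 it is the L^2 limit of A applied to the
   truncations of f to balls (for the Fourier transform the limit exists and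
   is unique almost everywhere, by Plancherel's theorem).  Because A is used
   as such on L^1, a frequency-localized function is given pointwise by an
   absolutely convergent integral, hence does not depend on the choice of the
   representative of the limit: LP applied to a curve t |-> u t of L^2
   functions is a definite function of (t, x). *)
Definition L2_ext (A : (R3 R -> R[i]) -> R3 R -> R[i]) f : R3 R -> R[i] :=
  if `[< cintegrable (@leb3 R) f >] then A f
  else xget (fun _ => 0)
    [set F | inL2 (@leb3 R) F /\
       (fun n : nat => L2norm (@leb3 R) (fun xi => F xi - A (truncate n f) xi))
         @ \oo --> 0%E].

Definition fourier := L2_ext fourier_int.
Definition inv_fourier := L2_ext inv_fourier_int.

Definition propagator (alpha t : R) f : R3 R -> R[i] :=
  inv_fourier (fun xi => cis (- (t * enorm3 xi `^ alpha)) * fourier f xi).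

Definition is_cutoff (rho : R -> R) : Prop :=
  [/\ forall (n : nat) s, derivable (derive1n n rho) s 1,
      compact (closure [set s | rho s != 0]),
      closure [set s | rho s != 0] `<=` `]-2, 2[,
      forall s, rho (- s) = rho s
    & forall s, `|s| <= 1 -> rho s = 1].

Definition chi (rho : R -> R) (xi : R3 R) : R :=
  rho (enorm3 xi) - rho (2 * enorm3 xi).

Definition LP (rho : R -> R) (lambda : R) f : R3 R -> R[i] :=
  inv_fourier (fun xi => (chi rho (scale3 lambda^-1 xi))%:C * fourier f xi).

(* Radiality of the L^2 class: f may differ from a radial function on a null set. *)
Definition radial f : Prop :=
  exists phi : R -> R[i], {ae @leb3 R, forall x, f x = phi (enorm3 x)}.

Definition dyadic (lambda : R) : Prop := exists k : int, lambda = 2 ^ k.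

End Fourier.

(* Main.v *)
(** By Plancherel's theorem in x, the square of the left-hand side is controlled by
    the integral over xi of [|chi_mu(xi)|^2 |J(t, xi)|^2], where J(t, xi) is the integral
    of [exp(-it(|y|^alpha - |xi-y|^alpha)) H(y) K(xi-y)] over y, and H, K are the localized
    Fourier transforms of f, g. For fixed xi, the integral of [|J|^2] over t (damped by
    [exp(-e|t|)], whose Fourier transform is the Poisson kernel) is estimated by Schur's
    test. Since |H| and |K| are radial, both integrals of the test are computed in the
    coordinates q = |y|^2, p = |xi-y|^2, in which Lebesgue measure is
    [c |xi|^-1 dq dp] on the region of the triangle inequalities: in one of them, q runs over
    |y| ~ lambda1, where [q^(alpha/2)] has derivative at least of order
    [lambda1^(alpha-2)], so that the Poisson kernel contributes
    [O(lambda1^(2-alpha))]; in the other one, |xi-y| ~ lambda2 and the triangle inequality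
    confine p to an interval of length [O(|xi| lambda2)]. The result,
    [C lambda2^(1-alpha) |xi|^-1 ||H||^2 ||K||^2], is integrated over |xi| ~ mu.

    Plancherel's theorem follows from the same Schur test (upper bound), and from
    Parseval's identity against indicator functions of boxes, which determine
    a square-integrable function almost everywhere. *)
Require Import Defs.
From mathcomp Require Import all_boot all_order all_algebra.
From mathcomp Require Import all_classical all_reals all_analysis.
From mathcomp Require Import complex.
From mathcomp Require Import measurable_realfun.
From mathcomp Require Import ring lra.
Set Implicit Arguments.
Unset Strict Implicit.
Unset Printing Implicit Defensive.
Import Order.TTheory GRing.Theory Num.Theory.
Import numFieldNormedType.Exports.
Local Open Scope classical_set_scope.
Local Open Scope complex_scope.
Local Open Scope ring_scope.

(** The two waves enter with opposite signs, so the gradient in y of the phase |y|^alpha -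
    |xi-y|^alpha can vanish or become small, and a direct change of variables from y to the phase
    breaks down. In the coordinates q and p the phase is a function of q minus a function of p: with
    p frozen, its q-derivative does not degenerate. The damping turns the kernel of the test into an
    honest function in place of a point mass; the bounds are uniform in e, and Fatou's lemma lets e
    tend to 0. The masses of the radial profiles in q and p are at most constants times the squared
    norms of H and K divided by lambda1 and lambda2. The latter cancels the length of the
    p-interval, and lambda1^(2-alpha) / lambda1 is at most lambda2^(1-alpha) because alpha >= 1. As
    alpha <= 2, q^(alpha/2) is concave and its derivative on the annulus is least at the outer edge.
    The integral of |xi|^-1 is of order mu^2, whose root is mu. Transforms of square-integrable
    functions are known only almost everywhere; localization makes them absolutely convergent
    integrals, so that identities hold for all t and x. *)

Notation normc := Normc.normc.

(** * Complex-valued integrals *)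

Section ComplexArith.
Context {R : realType}.
Implicit Types z w : R[i].

(** Squared modulus: polynomial in the two coordinates, it keeps square roots out of measurability,
    limits and algebra. *)
Definition sqc z : R := complex.Re z ^+ 2 + complex.Im z ^+ 2.

Lemma sqc_ge0 z : 0 <= sqc z.
Proof. by rewrite addr_ge0// sqr_ge0. Qed.

Lemma normc_sqrt z : normc z = Num.sqrt (sqc z).
Proof. by case: z. Qed.

Lemma normc_ge0 z : 0 <= normc z.
Proof. by rewrite normc_sqrt sqrtr_ge0. Qed.

Lemma normc_sq z : normc z ^+ 2 = sqc z.
Proof. by rewrite normc_sqrt sqr_sqrtr// sqc_ge0. Qed.

Lemma sqcM z w : sqc (z * w) = sqc z * sqc w.
Proof. by rewrite -!normc_sq Normc.normcM exprMn. Qed.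

Lemma sqc_real (x : R) : sqc x%:C = x ^+ 2.
Proof. by rewrite /sqc/= expr0n/= addr0. Qed.

Lemma sqcN z : sqc (- z) = sqc z.
Proof. by case: z => a b; rewrite /sqc/= !sqrrN. Qed.

(** The parallelogram identity without the term [sqc (z - w)]. *)
Lemma sqcD_le z w : sqc (z + w) <= 2 * (sqc z + sqc w).
Proof.
case: z w => [a b] [c d]; rewrite /sqc/=.
have := sqr_ge0 (a - c); have := sqr_ge0 (b - d); nra.
Qed.

Lemma sqc_conj z : sqc (conjc z) = sqc z.
Proof. by case: z => a b; rewrite /sqc/= sqrrN. Qed.

Lemma mulc_conj z : z * conjc z = (sqc z)%:C.
Proof.
by case: z => a b; apply/eqP; rewrite eq_complex /sqc /=; apply/andP; split;
  apply/eqP; ring.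
Qed.

Lemma normc_conj z : normc (conjc z) = normc z.
Proof. by rewrite !normc_sqrt sqc_conj. Qed.

Lemma normc_real (x : R) : normc x%:C = `|x|.
Proof. by rewrite normc_sqrt sqc_real sqrtr_sqr. Qed.

Lemma normr_Re z : `|complex.Re z| <= normc z.
Proof.
case: z => a b; rewrite normc_sqrt /sqc/= -(sqrtr_sqr a) ler_wsqrtr//.
by rewrite lerDl sqr_ge0.
Qed.

Lemma normr_Im z : `|complex.Im z| <= normc z.
Proof.
case: z => a b; rewrite normc_sqrt /sqc/= -(sqrtr_sqr b) ler_wsqrtr//.
by rewrite lerDr sqr_ge0.
Qed.

Lemma normc_le_ReIm z : normc z <= `|complex.Re z| + `|complex.Im z|.
Proof.
case: z => a b /=.
rewrite -(@ger0_norm _ (`|a| + `|b|)) ?addr_ge0// -sqrtr_sqr ler_wsqrtr//.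
rewrite sqrrD -!normrX.
rewrite -[`|a| * _]normrM => //.
by rewrite (ger0_norm (sqr_ge0 a)) (ger0_norm (sqr_ge0 b)) lerD2r lerDl mulrn_wge0.
Qed.

Lemma eq_complexP z w : complex.Re z = complex.Re w -> complex.Im z = complex.Im w ->
  z = w.
Proof. by case: z w => [a b] [c d] /= -> ->. Qed.

Lemma cisD (a b : R) : cis (a + b) = cis a * cis b.
Proof. by apply: eq_complexP; rewrite /= ?cosD ?sinD// addrC. Qed.

Lemma cisN (a : R) : cis (- a) = conjc (cis a).
Proof. by apply: eq_complexP; rewrite /= ?cosN ?sinN. Qed.

Lemma cis0 : cis (0 : R) = 1.
Proof. by apply: eq_complexP; rewrite /= ?cos0 ?sin0. Qed.

Lemma sqc_cis (a : R) : sqc (cis a) = 1.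
Proof. by rewrite /sqc/= cos2Dsin2. Qed.

Lemma normc_cis (a : R) : normc (cis a) = 1.
Proof. by rewrite normc_sqrt sqc_cis sqrtr1. Qed.

Lemma sqc0 : sqc 0 = 0.
Proof. by rewrite /sqc/= expr0n addr0. Qed.

Lemma sqc_eq0 z : sqc z = 0 -> z = 0.
Proof.
move=> z0; apply: Normc.eq0_normc.
by rewrite normc_sqrt z0 sqrtr0.
Qed.

Lemma ReM z w : complex.Re (z * w) =
  complex.Re z * complex.Re w - complex.Im z * complex.Im w.
Proof. by case: z w => [? ?] [? ?]. Qed.

Lemma ImM z w : complex.Im (z * w) =
  complex.Re z * complex.Im w + complex.Im z * complex.Re w.
Proof. by case: z w => [? ?] [? ?]. Qed.

Lemma ReD z w : complex.Re (z + w) = complex.Re z + complex.Re w.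
Proof. by case: z w => [? ?] [? ?]. Qed.

Lemma ImD z w : complex.Im (z + w) = complex.Im z + complex.Im w.
Proof. by case: z w => [? ?] [? ?]. Qed.

Lemma ReN z : complex.Re (- z) = - complex.Re z.
Proof. by case: z. Qed.

Lemma ImN z : complex.Im (- z) = - complex.Im z.
Proof. by case: z. Qed.

Lemma Re_conj z : complex.Re (conjc z) = complex.Re z.
Proof. by case: z. Qed.

Lemma Im_conj z : complex.Im (conjc z) = - complex.Im z.
Proof. by case: z. Qed.

End ComplexArith.

Section CMeasurable.
Context d (T : measurableType d) {R : realType}.
Implicit Types f g : T -> R[i].

Lemma cmeasM f g : cmeasurable f -> cmeasurable g ->
  cmeasurable (fun x => f x * g x).
Proof.
move=> [f1 f2] [g1 g2]; split.
  under eq_fun do rewrite ReM.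
  by apply: measurable_funB; exact: measurable_funM.
under eq_fun do rewrite ImM.
by apply: measurable_funD; exact: measurable_funM.
Qed.

Lemma cmeasD f g : cmeasurable f -> cmeasurable g ->
  cmeasurable (fun x => f x + g x).
Proof.
move=> [f1 f2] [g1 g2]; split.
  by under eq_fun do rewrite ReD; exact: measurable_funD.
by under eq_fun do rewrite ImD; exact: measurable_funD.
Qed.

Lemma cmeasN f : cmeasurable f -> cmeasurable (fun x => - f x).
Proof.
move=> [f1 f2]; split.
  by under eq_fun do rewrite ReN; exact: measurableT_comp.
by under eq_fun do rewrite ImN; exact: measurableT_comp.
Qed.

Lemma cmeasB f g : cmeasurable f -> cmeasurable g ->
  cmeasurable (fun x => f x - g x).
Proof. by move=> mf mg; apply: cmeasD => //; exact: cmeasN. Qed.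

Lemma cmeas_conj f : cmeasurable f -> cmeasurable (fun x => conjc (f x)).
Proof.
move=> [f1 f2]; split; first by under eq_fun do rewrite Re_conj.
by under eq_fun do rewrite Im_conj; exact: measurableT_comp.
Qed.

Lemma cmeas_cst (z : R[i]) : cmeasurable (fun _ : T => z).
Proof. by split; exact: measurable_cst. Qed.

Lemma cmeas_real (h : T -> R) : measurable_fun setT h ->
  cmeasurable (fun x => (h x)%:C).
Proof. by move=> mh; split => //=; exact: measurable_cst. Qed.

Lemma cmeas_cis (h : T -> R) : measurable_fun setT h ->
  cmeasurable (fun x => cis (h x)).
Proof.
move=> mh; split => /=.
  apply: measurableT_comp => //; apply: continuous_measurable_fun.
  exact: continuous_cos.
apply: measurableT_comp => //; apply: continuous_measurable_fun.
exact: continuous_sin.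
Qed.

Lemma cmeas_if (b : T -> bool) f g : measurable_fun setT b ->
  cmeasurable f -> cmeasurable g ->
  cmeasurable (fun x => if b x then f x else g x).
Proof.
move=> mb [f1 f2] [g1 g2]; split.
  rewrite (_ : (fun x => _) = fun x => if b x then complex.Re (f x) else complex.Re (g x)).
    by apply: measurable_fun_ifT.
  by apply/funext => x; case: ifP.
rewrite (_ : (fun x => _) = fun x => if b x then complex.Im (f x) else complex.Im (g x)).
  by apply: measurable_fun_ifT.
by apply/funext => x; case: ifP.
Qed.

Lemma meas_sqc f : cmeasurable f -> measurable_fun setT (fun x => sqc (f x)).
Proof.
by move=> [f1 f2]; apply: measurable_funD; exact: measurable_funX.
Qed.

Lemma meas_normc f : cmeasurable f -> measurable_fun setT (fun x => normc (f x)).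
Proof.
move=> mf; under eq_fun do rewrite normc_sqrt.
apply: measurableT_comp; last exact: meas_sqc.
by apply: continuous_measurable_fun; exact: sqrt_continuous.
Qed.

Lemma cmeas_comp d' (T' : measurableType d') (h : T' -> T) f :
  measurable_fun setT h -> cmeasurable f -> cmeasurable (f \o h).
Proof.
by move=> mh [f1 f2]; split; [exact: (measurableT_comp f1)|exact: (measurableT_comp f2)].
Qed.

End CMeasurable.

Section CIntegral.
Context d (T : measurableType d) {R : realType}.
Variable mu : {measure set T -> \bar R}.
Implicit Types f g : T -> R[i].

Lemma integrable_scale (h : T -> R) (k : R) :
  mu.-integrable setT (fun x => (h x)%:E) ->
  mu.-integrable setT (fun x => (k * h x)%:E).
Proof. by move=> ih; exact: (integrableZl measurableT k ih). Qed.

Lemma cintegrable_meas f : cintegrable mu f -> cmeasurable f.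
Proof.
by move=> [/measurable_int/measurable_EFinP ? /measurable_int/measurable_EFinP ?].
Qed.

Lemma cintegrable_le f (h : T -> R) : cmeasurable f ->
  mu.-integrable setT (EFin \o h) -> (forall x, normc (f x) <= h x) ->
  cintegrable mu f.
Proof.
move=> [f1 f2] ih fh; split; apply: (le_integrable measurableT _ _ ih) => //=;
  try exact/measurable_EFinP.
- move=> x _; rewrite lee_fin (le_trans (normr_Re _))// (le_trans (fh x))//.
  exact: ler_norm.
- move=> x _; rewrite lee_fin (le_trans (normr_Im _))// (le_trans (fh x))//.
  exact: ler_norm.
Qed.

Lemma cintegrable_norm f : cintegrable mu f ->
  mu.-integrable setT (fun x => (normc (f x))%:E).
Proof.
move=> If; have [f1 f2] := If.
have := integrableD measurableT (integrable_norm f1) (integrable_norm f2).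
apply: le_integrable => //.
  by apply/measurable_EFinP; exact/meas_normc/cintegrable_meas.
move=> x _ /=; rewrite lee_fin ger0_norm ?normc_ge0//.
by rewrite ger0_norm ?addr_ge0// normc_le_ReIm.
Qed.

Lemma cintegrable_le2 f g : cmeasurable f -> cintegrable mu g ->
  (forall x, normc (f x) <= normc (g x)) -> cintegrable mu f.
Proof. by move=> mf /cintegrable_norm ig; exact: cintegrable_le. Qed.

Lemma cintegrableP f : cintegrable mu f <->
  cmeasurable f /\ (\int[mu]_x (normc (f x))%:E < +oo)%E.
Proof.
split=> [If|[mf If]].
  split; first exact: cintegrable_meas.
  have /integrableP[_] := cintegrable_norm If.
  by under eq_integral => x _ do rewrite gee0_abs ?lee_fin ?normc_ge0//.
apply: (@cintegrable_le _ (fun x => normc (f x))) => //.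
apply/integrableP; split; first by apply/measurable_EFinP; exact: meas_normc.
by under eq_integral => x _ do rewrite gee0_abs ?lee_fin ?normc_ge0//.
Qed.

Lemma cintegrableD f g : cintegrable mu f -> cintegrable mu g ->
  cintegrable mu (fun x => f x + g x).
Proof.
move=> [f1 f2] [g1 g2]; split.
  under eq_fun do rewrite ReD EFinD; exact: integrableD.
under eq_fun do rewrite ImD EFinD; exact: integrableD.
Qed.

Lemma cintegrableM f g (M : R) : cintegrable mu f -> cmeasurable g ->
  (forall x, normc (g x) <= M) -> cintegrable mu (fun x => g x * f x).
Proof.
move=> If mg gM; apply: (@cintegrable_le _ (fun x => M * normc (f x))).
- by apply: cmeasM => //; exact: cintegrable_meas If.
- by apply: integrable_scale; exact: cintegrable_norm.
- by move=> x; rewrite Normc.normcM ler_wpM2r// normc_ge0.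
Qed.

Lemma cintegrableZ (z : R[i]) f : cintegrable mu f ->
  cintegrable mu (fun x => z * f x).
Proof. by move=> If; apply: (cintegrableM (M := normc z)) => //; exact: cmeas_cst. Qed.

Lemma cintegrable_conj f : cintegrable mu f ->
  cintegrable mu (fun x => conjc (f x)).
Proof.
move=> If; apply: (cintegrable_le2 _ If); last by move=> x; rewrite normc_conj.
by apply: cmeas_conj; exact: cintegrable_meas If.
Qed.

Lemma cintegralD f g : cintegrable mu f -> cintegrable mu g ->
  cintegral mu (fun x => f x + g x) = cintegral mu f + cintegral mu g.
Proof.
move=> [f1 f2] [g1 g2]; rewrite /cintegral; apply: eq_complexP => /=.
  by under eq_Rintegral => x _ do rewrite ReD; exact: RintegralD.
by under eq_Rintegral => x _ do rewrite ImD; exact: RintegralD.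
Qed.

Lemma cintegralZ (z : R[i]) f : cintegrable mu f ->
  cintegral mu (fun x => z * f x) = z * cintegral mu f.
Proof.
move=> [f1 f2]; rewrite /cintegral; apply: eq_complexP.
  rewrite ReM /=.
  under eq_Rintegral => x _ do rewrite ReM.
  rewrite RintegralB//=; [|exact: integrable_scale..].
  by rewrite !RintegralZl.
rewrite ImM /=.
under eq_Rintegral => x _ do rewrite ImM.
rewrite RintegralD//=; [|exact: integrable_scale..].
by rewrite !RintegralZl.
Qed.

Lemma cintegralB f g : cintegrable mu f -> cintegrable mu g ->
  cintegral mu (fun x => f x - g x) = cintegral mu f - cintegral mu g.
Proof.
move=> If Ig; rewrite -[- cintegral mu g]mulN1r -cintegralZ// -cintegralD//.
  by congr cintegral; apply/funext => x; rewrite mulN1r.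
exact: cintegrableZ.
Qed.

Lemma cintegral_conj f :
  cintegrable mu f -> cintegral mu (fun x => conjc (f x)) = conjc (cintegral mu f).
Proof.
move=> [f1 f2]; rewrite /cintegral; apply: eq_complexP => /=.
  by apply: eq_Rintegral => x _; rewrite Re_conj.
rewrite -[RHS]mulN1r -RintegralZl//; apply: eq_Rintegral => x _.
by rewrite Im_conj mulN1r.
Qed.

Lemma cintegral_real (h : T -> R) :
  cintegral mu (fun x => (h x)%:C) = (\int[mu]_x h x)%:C.
Proof.
rewrite /cintegral; apply: eq_complexP => //=.
by rewrite Rintegral_cst// mul0r.
Qed.

Lemma eq_cintegral f g : f =1 g -> cintegral mu f = cintegral mu g.
Proof. by move=> fg; congr cintegral; exact/funext. Qed.

(* Multiplying by the conjugate phase of the integral reduces the bound to that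
   of a real integral. *)
Lemma normc_cintegral f : cintegrable mu f ->
  ((normc (cintegral mu f))%:E <= \int[mu]_x (normc (f x))%:E)%E.
Proof.
move=> If; set I := cintegral mu f.
have [I0|I0] := eqVneq I 0.
  rewrite I0 Normc.normc0 integral_ge0// => x _.
  by rewrite lee_fin normc_ge0.
have nI0 : 0 < normc I.
  rewrite lt_neqAle normc_ge0 andbT eq_sym; apply: contra_neq I0.
  exact: Normc.eq0_normc.
have fin := integrable_fin_num measurableT (cintegrable_norm If).
have h : complex.Re (conjc I * I) <= \int[mu]_x (normc I * normc (f x)).
  rewrite -cintegralZ// [X in X <= _](_ : _ = \int[mu]_x complex.Re (conjc I * f x))//.
  have [Icf1 Icf2] := cintegrableZ (conjc I) If.
  apply: le_Rintegral => //.
    by apply: integrable_scale; exact: cintegrable_norm.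
  move=> x _; rewrite (le_trans (ler_norm _))// (le_trans (normr_Re _))//.
  by rewrite Normc.normcM normc_conj.
rewrite RintegralZl// in h; last exact: cintegrable_norm.
move: h; rewrite mulrC mulc_conj /= -normc_sq expr2 ler_pM2l// => h.
by rewrite -(fineK fin) lee_fin.
Qed.

Lemma ae_eq_cintegral f g : cmeasurable f -> cmeasurable g ->
  {ae mu, forall x, f x = g x} -> cintegral mu f = cintegral mu g.
Proof.
move=> [f1 f2] [g1 g2] fg; rewrite /cintegral /Rintegral; congr (fine _ +i* fine _).
- apply: ae_eq_integral => //; try exact/measurable_EFinP.
  by apply: filterS fg => x -> _.
- apply: ae_eq_integral => //; try exact/measurable_EFinP.
  by apply: filterS fg => x -> _.
Qed.

End CIntegral.

(** * Fubini's theorem for complex-valued functions *)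

Section Fubini.
Context d1 d2 (T1 : measurableType d1) (T2 : measurableType d2) {R : realType}.
Variable m1 : {sigma_finite_measure set T1 -> \bar R}.
Variable m2 : {sigma_finite_measure set T2 -> \bar R}.

Lemma cmeas_section1 (f : T1 * T2 -> R[i]) (x : T1) : cmeasurable f ->
  cmeasurable (fun y => f (x, y)).
Proof. by move=> mf; exact: (cmeas_comp (h := pair x) (pair1_measurable x) mf). Qed.

Lemma cmeas_section2 (f : T1 * T2 -> R[i]) (y : T2) : cmeasurable f ->
  cmeasurable (fun x => f (x, y)).
Proof. by move=> mf; exact: (cmeas_comp (h := pair^~ y) (pair2_measurable y) mf). Qed.

(** No integrability is assumed: Tonelli's theorem makes the integrals of the positive and negative
    parts measurable in the parameter, and [fine] of their difference is measurable whether or not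
    it is finite. *)
Lemma meas_Rparam (f : T1 * T2 -> R) : measurable_fun setT f ->
  measurable_fun setT (fun x => \int[m2]_y f (x, y)).
Proof.
move=> mf; rewrite /Rintegral; apply: measurableT_comp => //.
have mF : measurable_fun setT (EFin \o f) by exact/measurable_EFinP.
under eq_fun => x do rewrite integralE.
apply: emeasurable_funB.
- have := @measurable_fun_fubini_tonelli_F _ _ T1 T2 R m2 _
    (measurable_funepos mF) (fun x => funepos_ge0 _ x).
  rewrite /fubini_F; congr measurable_fun; apply/funext => x.
  by apply: eq_integral => y _; rewrite !funeposE.
- have := @measurable_fun_fubini_tonelli_F _ _ T1 T2 R m2 _
    (measurable_funeneg mF) (fun x => funeneg_ge0 _ x).
  rewrite /fubini_F; congr measurable_fun; apply/funext => x.
  by apply: eq_integral => y _; rewrite !funenegE.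
Qed.

Lemma cmeas_param (f : T1 * T2 -> R[i]) : cmeasurable f ->
  cmeasurable (fun x => cintegral m2 (fun y => f (x, y))).
Proof.
move=> [f1 f2]; split => /=.
  exact: (meas_Rparam f1).
exact: (meas_Rparam f2).
Qed.

(** On the left [fine] is applied to each inner integral; these are finite for almost every x, so
    that [fine] can be removed there. *)
Lemma Rintegral12_prod (f : T1 * T2 -> R) :
  (m1 \x m2)%E.-integrable setT (EFin \o f) ->
  \int[m1]_x \int[m2]_y f (x, y) = fine (\int[(m1 \x m2)%E]_z (f z)%:E).
Proof.
move=> If; rewrite -(integral12_prod_meas1 If) /Rintegral; congr fine.
have IF := integrable_fubini_F If.
apply: ae_eq_integral => //.
- apply/measurable_EFinP; apply: (@meas_Rparam f).
  by apply/measurable_EFinP; exact: measurable_int If.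
- exact: measurable_int IF.
- have := integrable_ae measurableT IF.
  by apply: filterS => x /(_ Logic.I) h _; rewrite fineK.
Qed.

Lemma Rintegral21_prod (f : T1 * T2 -> R) :
  (m1 \x m2)%E.-integrable setT (EFin \o f) ->
  \int[m2]_y \int[m1]_x f (x, y) = fine (\int[(m1 \x m2)%E]_z (f z)%:E).
Proof.
move=> If; rewrite -(integral21_prod_meas1 If) /Rintegral; congr fine.
have mG := measurable_fubini_G If.
apply: ae_eq_integral => //.
- by apply/measurable_EFinP; exact: (measurableT_comp _ mG).
- have := ae_integrable2 If.
  by apply: filterS => x h _; rewrite fineK//; exact: integrable_fin_num.
Qed.

Lemma cintegral12_prod (f : T1 * T2 -> R[i]) : cintegrable (m1 \x m2)%E f ->
  cintegral m1 (fun x => cintegral m2 (fun y => f (x, y))) =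
  cintegral (m1 \x m2)%E f.
Proof.
move=> [f1 f2]; apply: eq_complexP => /=.
  exact: (Rintegral12_prod f1).
exact: (Rintegral12_prod f2).
Qed.

Lemma cFubini (f : T1 * T2 -> R[i]) : cintegrable (m1 \x m2)%E f ->
  cintegral m1 (fun x => cintegral m2 (fun y => f (x, y))) =
  cintegral m2 (fun y => cintegral m1 (fun x => f (x, y))).
Proof.
move=> If; rewrite cintegral12_prod//.
case: If => f1 f2; apply: eq_complexP => /=.
  by rewrite (Rintegral21_prod f1).
by rewrite (Rintegral21_prod f2).
Qed.

Lemma integrable_tensor (a : T1 -> R[i]) (b : T2 -> R[i]) (K : T1 * T2 -> R[i]) :
  cintegrable m1 a -> cintegrable m2 b -> cmeasurable K ->
  (forall z, normc (K z) <= 1) ->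
  cintegrable (m1 \x m2)%E (fun z => K z * (a z.1 * b z.2)).
Proof.
move=> Ia Ib mK K1; apply: (@cintegrableM _ _ _ _ _ _ 1) => //.
have ma := cintegrable_meas Ia; have mb := cintegrable_meas Ib.
have mab : cmeasurable (fun z : T1 * T2 => a z.1 * b z.2).
  apply: cmeasM.
    exact: (cmeas_comp (h := fst) measurable_fst ma).
  exact: (cmeas_comp (h := snd) measurable_snd mb).
apply/cintegrableP; split => //.
rewrite fubini_tonelli1//=; last 2 first.
- by apply/measurable_EFinP; exact: meas_normc.
- by move=> z; rewrite lee_fin normc_ge0.
rewrite /fubini_F/=.
under eq_integral => x _.
  under eq_integral => y _ do rewrite Normc.normcM EFinM.
  rewrite ge0_integralZl_EFin ?normc_ge0//; last 2 first.
  - by move=> y _; rewrite lee_fin normc_ge0.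
  - by apply/measurable_EFinP; exact: meas_normc.
  over.
have /cintegrableP[_ fa] := Ia; have /cintegrableP[_ fb] := Ib.
rewrite ge0_integralZr//; last 3 first.
- by apply/measurable_EFinP; exact: meas_normc.
- by move=> y _; rewrite lee_fin normc_ge0.
- by apply: integral_ge0 => y _; rewrite lee_fin normc_ge0.
by rewrite lte_mul_pinfty// ?ge0_fin_numE//; apply: integral_ge0 => y _;
  rewrite lee_fin normc_ge0.
Qed.

Lemma cintegral_tensor (a : T1 -> R[i]) (b : T2 -> R[i]) :
  cintegrable m1 a -> cintegrable m2 b ->
  cintegral (m1 \x m2)%E (fun z => a z.1 * b z.2) =
  cintegral m1 a * cintegral m2 b.
Proof.
move=> Ia Ib.
have I1 : cintegrable (m1 \x m2)%E (fun z => a z.1 * b z.2).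
  have := @integrable_tensor a b (fun _ => 1) Ia Ib (cmeas_cst _ _).
  rewrite Normc.normc1 => /(_ (fun _ => lexx _)); congr cintegrable.
  by apply/funext => z; rewrite mul1r.
rewrite -cintegral12_prod//=.
under eq_cintegral => x do rewrite cintegralZ//.
under eq_cintegral => x do rewrite mulrC.
by rewrite cintegralZ// mulrC.
Qed.

(** Transposition of a bounded kernel. This is the form of Fubini's theorem behind both Schur's test
    and the multiplication formula of the Fourier transform. *)
Lemma cintegral_kernelC (a : T1 -> R[i]) (b : T2 -> R[i]) (K : T1 * T2 -> R[i]) :
  cintegrable m1 a -> cintegrable m2 b -> cmeasurable K ->
  (forall z, normc (K z) <= 1) ->
  cintegral m1 (fun x => a x * cintegral m2 (fun y => K (x, y) * b y)) =
  cintegral m2 (fun y => b y * cintegral m1 (fun x => K (x, y) * a x)).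
Proof.
move=> Ia Ib mK K1.
have IK := integrable_tensor Ia Ib mK K1.
transitivity (cintegral m1 (fun x => cintegral m2 (fun y => K (x, y) * (a x * b y)))).
  apply: eq_cintegral => x; rewrite -cintegralZ.
    by apply: eq_cintegral => y; ring.
  apply: (@cintegrableM _ _ _ _ _ _ 1) => //.
  exact: cmeas_section1.
rewrite (cFubini IK); apply: eq_cintegral => y; rewrite -cintegralZ.
  by apply: eq_cintegral => x; ring.
apply: (@cintegrableM _ _ _ _ _ _ 1) => //.
exact: cmeas_section2.
Qed.

End Fubini.

Lemma le_integralT d (T : measurableType d) (R : realType)
    (mu : {measure set T -> \bar R}) (f g : T -> \bar R) :
  measurable_fun setT f -> measurable_fun setT g ->
  (forall x, 0 <= f x)%E -> (forall x, f x <= g x)%E ->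
  (\int[mu]_x f x <= \int[mu]_x g x)%E.
Proof. by move=> mf mg f0 fg; exact: ge0_le_integral. Qed.

Lemma meas_eparam1 d1 d2 (T1 : measurableType d1) (T2 : measurableType d2)
    (R : realType) (m2 : {sigma_finite_measure set T2 -> \bar R})
    (f : T1 * T2 -> \bar R) : measurable_fun setT f -> (forall z, 0 <= f z)%E ->
  measurable_fun setT (fun x => \int[m2]_y f (x, y))%E.
Proof.
by move=> mf f0; exact: (measurable_fun_fubini_tonelli_F (m2 := m2) f mf f0).
Qed.

Lemma meas_eparam2 d1 d2 (T1 : measurableType d1) (T2 : measurableType d2)
    (R : realType) (m1 : {sigma_finite_measure set T1 -> \bar R})
    (f : T1 * T2 -> \bar R) : measurable_fun setT f -> (forall z, 0 <= f z)%E ->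
  measurable_fun setT (fun y => \int[m1]_x f (x, y))%E.
Proof.
by move=> mf f0; exact: (measurable_fun_fubini_tonelli_G (m1 := m1) f mf f0).
Qed.

Lemma integral_normc_fin d (T : measurableType d) (R : realType)
    (mu : {measure set T -> \bar R}) (f : T -> R[i]) : cintegrable mu f ->
  (\int[mu]_x (normc (f x))%:E)%E = (\int[mu]_x normc (f x))%:E.
Proof.
move=> If; rewrite /Rintegral fineK//.
by apply: integrable_fin_num => //; exact: cintegrable_norm.
Qed.

Lemma Rintegral_normc_ge0 d (T : measurableType d) (R : realType)
    (mu : {measure set T -> \bar R}) (f : T -> R[i]) :
  0 <= \int[mu]_x normc (f x).
Proof. by apply: Rintegral_ge0 => x _; exact: normc_ge0. Qed.

Lemma normc_cintegralR d (T : measurableType d) (R : realType)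
    (mu : {measure set T -> \bar R}) (f : T -> R[i]) : cintegrable mu f ->
  normc (cintegral mu f) <= \int[mu]_x normc (f x).
Proof.
by move=> If; rewrite -lee_fin -integral_normc_fin//; exact: normc_cintegral.
Qed.

Lemma cmeas_kernel_int d1 d2 (T1 : measurableType d1) (T2 : measurableType d2)
    (R : realType) (m2 : {sigma_finite_measure set T2 -> \bar R})
    (K : T1 * T2 -> R[i]) (b : T2 -> R[i]) : cmeasurable K -> cmeasurable b ->
  cmeasurable (fun x => cintegral m2 (fun y => K (x, y) * b y)).
Proof.
move=> mK mb; apply: (@cmeas_param _ _ _ _ _ m2 (fun z => K z * b z.2)).
by apply: cmeasM => //; exact: (cmeas_comp (h := snd) measurable_snd mb).
Qed.

Lemma cintegrable_kernel1 d1 d2 (T1 : measurableType d1) (T2 : measurableType d2)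
    (R : realType) (m2 : {measure set T2 -> \bar R})
    (K : T1 * T2 -> R[i]) (b : T2 -> R[i]) (x : T1) :
  cmeasurable K -> (forall z, normc (K z) <= 1) -> cintegrable m2 b ->
  cintegrable m2 (fun y => K (x, y) * b y).
Proof.
by move=> mK K1 Ib; apply: (@cintegrableM _ _ _ _ _ _ 1) => //;
  exact: cmeas_section1.
Qed.

Lemma cintegrable_kernel2 d1 d2 (T1 : measurableType d1) (T2 : measurableType d2)
    (R : realType) (m1 : {measure set T1 -> \bar R})
    (K : T1 * T2 -> R[i]) (b : T1 -> R[i]) (y : T2) :
  cmeasurable K -> (forall z, normc (K z) <= 1) -> cintegrable m1 b ->
  cintegrable m1 (fun x => K (x, y) * b x).
Proof.
by move=> mK K1 Ib; apply: (@cintegrableM _ _ _ _ _ _ 1) => //;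
  exact: cmeas_section2.
Qed.

Lemma normc_kernel_int d1 d2 (T1 : measurableType d1) (T2 : measurableType d2)
    (R : realType) (m2 : {sigma_finite_measure set T2 -> \bar R})
    (K : T1 * T2 -> R[i]) (b : T2 -> R[i]) : cmeasurable K -> cintegrable m2 b ->
  (forall z, normc (K z) <= 1) -> forall x,
  normc (cintegral m2 (fun y => K (x, y) * b y)) <= \int[m2]_y normc (b y).
Proof.
move=> mK Ib K1 x.
have I1 := cintegrable_kernel1 x mK K1 Ib.
apply: (le_trans (normc_cintegralR I1)).
apply: le_Rintegral => //; try exact: cintegrable_norm.
by move=> y _; rewrite Normc.normcM ler_piMl// normc_ge0.
Qed.

Lemma cmeas_swap d1 d2 (T1 : measurableType d1) (T2 : measurableType d2)
    (R : realType) (K : T1 * T2 -> R[i]) : cmeasurable K ->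
  cmeasurable (fun z : T2 * T1 => K (z.2, z.1)).
Proof. by move=> mK; exact: (cmeas_comp (@measurable_swap _ _ T2 T1) mK). Qed.

(** * Schur's test for weighted oscillatory integrals *)

Section Schur.
Context d1 d2 (X : measurableType d1) (Y : measurableType d2) {R : realType}.
Variable mX : {sigma_finite_measure set X -> \bar R}.
Variable mY : {sigma_finite_measure set Y -> \bar R}.
Variables (w : X -> R) (th : X * Y -> R) (k : Y * Y -> R).
Hypothesis w0 : forall x, 0 <= w x.
Hypothesis iw : mX.-integrable setT (EFin \o w).
Hypothesis mth : measurable_fun setT th.
Hypothesis mk : measurable_fun setT k.
Hypothesis k0 : forall z, 0 <= k z.
Hypothesis k_sym : forall y z, k (y, z) = k (z, y).
Hypothesis wk : forall y z,
  normc (cintegral mX (fun x => cis (th (x, y) - th (x, z)) * (w x)%:C)) <= k (y, z).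

(** The [T T^*] method: in [A x * conjc (A x)] both factors are integrals over Y; integrating first
    in x leaves the oscillatory integral of the weight, which [wk] bounds by [k]. *)
Lemma weighted_osc_le (a : Y -> R[i]) : cintegrable mY a ->
  (\int[mX]_x (w x * sqc (cintegral mY (fun y => cis (th (x, y)) * a y)))%:E <=
   \int[mY]_y \int[mY]_z (normc (a y) * normc (a z) * k (y, z))%:E)%E.
Proof.
move=> Ia; pose A x := cintegral mY (fun y => cis (th (x, y)) * a y).
have ma := cintegrable_meas Ia.
have Iw : cintegrable mX (fun x => (w x)%:C).
  have mw : measurable_fun setT w by apply/measurable_EFinP; exact: measurable_int iw.
  by split => //=; exact: integrable0.
have mK : cmeasurable (fun z => cis (th z)) by exact: cmeas_cis.
have mK' : cmeasurable (fun z => cis (- th z)).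
  by apply: cmeas_cis; exact: measurableT_comp.
have K1 z : normc (cis (th z)) <= 1 by rewrite normc_cis.
have K1' z : normc (cis (- th z)) <= 1 by rewrite normc_cis.
have mA : cmeasurable A by exact: (cmeas_kernel_int mY mK ma).
pose M := \int[mY]_y normc (a y).
have AM x : normc (A x) <= M by exact: (normc_kernel_int mK Ia K1).
have Iac : cintegrable mY (fun y => conjc (a y)) by exact: cintegrable_conj.
have Ac x : conjc (A x) = cintegral mY (fun y => cis (- th (x, y)) * conjc (a y)).
  rewrite -cintegral_conj//.
    by apply: eq_cintegral => y; rewrite rmorphM/= cisN.
  exact: (cintegrable_kernel1 x mK K1 Ia).
have IwA : cintegrable mX (fun x => conjc (A x) * (w x)%:C).
  apply: (@cintegrableM _ _ _ _ _ _ M) => //; first exact: cmeas_conj.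
  by move=> x; rewrite normc_conj.
have IwAA : cintegrable mX (fun x => A x * (conjc (A x) * (w x)%:C)).
  exact: (@cintegrableM _ _ _ _ _ _ M).
have AA x : A x * (conjc (A x) * (w x)%:C) = (w x * sqc (A x))%:C.
  by rewrite mulrA mulc_conj -rmorphM/= mulrC.
have E1 : cintegral mX (fun x => A x * (conjc (A x) * (w x)%:C)) =
    (\int[mX]_x (w x * sqc (A x)))%:C.
  by rewrite -cintegral_real; exact: eq_cintegral.
pose B y := cintegral mX (fun x => cis (th (x, y)) * (conjc (A x) * (w x)%:C)).
(* [conjc (A x)] is itself an integral in z; exchanging it with the integral in x produces the phase
   difference between y and z. *)
have BE y : B y = cintegral mY (fun z => conjc (a z) *
      cintegral mX (fun x => cis (th (x, y) - th (x, z)) * (w x)%:C)).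
  have Ia' := cintegrable_kernel2 y mK K1 Iw.
  have := cintegral_kernelC Ia' Iac mK' K1'.
  under eq_cintegral => x.
    rewrite -Ac mulrAC -mulrA.
    over.
  rewrite /B => ->; apply: eq_cintegral => z; congr (_ * _).
  apply: eq_cintegral => x; rewrite mulrA -cisD; congr (cis _ * _).
  by rewrite addrC.
have E2 : cintegral mX (fun x => A x * (conjc (A x) * (w x)%:C)) =
    cintegral mY (fun y => a y * B y).
  under eq_cintegral => x do rewrite mulrC.
  exact: (cintegral_kernelC IwA Ia mK K1).
have I3 : cintegrable mY (fun y => a y * B y).
  have mB : cmeasurable B.
    apply: (@cmeas_kernel_int _ _ _ _ _ _ (fun z : Y * X => cis (th (z.2, z.1)))).
      exact: (cmeas_swap mK).
    exact: cintegrable_meas IwA.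
  have BM y : normc (B y) <= \int[mX]_x normc (conjc (A x) * (w x)%:C).
    apply: (@normc_kernel_int _ _ _ _ _ _ (fun z : Y * X => cis (th (z.2, z.1)))) => //.
    exact: (cmeas_swap mK).
  have := cintegrableM Ia mB BM.
  by under eq_fun do rewrite mulrC.
(* The left-hand side is a nonnegative real number, finite by [IwAA], hence equal to the modulus of
   its complex version. *)
have E3 : (\int[mX]_x (w x * sqc (A x))%:E)%E =
    (normc (cintegral mX (fun x => A x * (conjc (A x) * (w x)%:C))))%:E.
  rewrite E1 normc_real ger0_norm; last first.
    by apply: Rintegral_ge0 => x _; rewrite mulr_ge0// sqc_ge0.
  rewrite /Rintegral fineK//; apply: integrable_fin_num => //.
  by have [h _] := IwAA; move: h; under eq_fun do rewrite AA.
rewrite E3 E2; apply: (le_trans (normc_cintegral I3)).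
have mkk : measurable_fun setT (fun z : Y * Y => (normc (a z.1) * normc (a z.2) * k z)%:E).
  apply/measurable_EFinP; apply: measurable_funM => //.
  apply: measurable_funM.
    exact: (measurableT_comp (meas_normc ma) measurable_fst).
  exact: (measurableT_comp (meas_normc ma) measurable_snd).
have ge0 y z : (0 <= (normc (a y) * normc (a z) * k (y, z))%:E)%E.
  by rewrite lee_fin !mulr_ge0// normc_ge0.
apply: le_integralT => //.
- by apply/measurable_EFinP; apply: meas_normc; exact: cintegrable_meas I3.
- by apply: (meas_eparam1 mY mkk) => z; rewrite lee_fin !mulr_ge0// normc_ge0.
- by move=> y; rewrite lee_fin normc_ge0.
move=> y; rewrite BE Normc.normcM EFinM.
have mcg : cmeasurable (fun z =>
    cintegral mX (fun x => cis (th (x, y) - th (x, z)) * (w x)%:C)).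
  have mKy : cmeasurable (fun p : Y * X => cis (th (p.2, y) - th (p.2, p.1))).
    apply: cmeas_cis; apply: measurable_funB.
      exact: (measurableT_comp (f := fun x => th (x, y)) (measurableT_comp mth (pair2_measurable y)) measurable_snd).
    exact: (measurableT_comp mth (@measurable_swap _ _ Y X)).
  by apply: (cmeas_kernel_int (T1 := Y) mX mKy); exact: cintegrable_meas Iw.
have mKy1 z : cmeasurable (fun x => cis (th (x, y) - th (x, z))).
  by apply: cmeas_cis; apply: measurable_funB;
    [exact: (measurableT_comp mth (pair2_measurable y))
    |exact: (measurableT_comp mth (pair2_measurable z))].
have cgM z : normc (cintegral mX (fun x => cis (th (x, y) - th (x, z)) * (w x)%:C)) <=
    \int[mX]_x normc ((w x)%:C : R[i]).
  have I5 : cintegrable mX (fun x => cis (th (x, y) - th (x, z)) * (w x)%:C).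
    by apply: (@cintegrableM _ _ _ _ _ _ 1) => // x; rewrite normc_cis.
  apply: (le_trans (normc_cintegralR I5)).
  apply: le_Rintegral => //; try exact: cintegrable_norm.
  by move=> x _; rewrite Normc.normcM normc_cis mul1r.
have I4 : cintegrable mY (fun z => conjc (a z) *
    cintegral mX (fun x => cis (th (x, y) - th (x, z)) * (w x)%:C)).
  by have := cintegrableM Iac mcg cgM; under eq_fun do rewrite mulrC.
apply: (@le_trans _ _ ((normc (a y))%:E * \int[mY]_z (normc (conjc (a z) *
    cintegral mX (fun x => cis (th (x, y) - th (x, z)) * (w x)%:C)))%:E)%E).
  by rewrite lee_wpmul2l ?lee_fin ?normc_ge0//; exact: normc_cintegral.
have mkz : measurable_fun setT (fun z => (normc (a z) * k (y, z))%:E).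
  apply/measurable_EFinP; apply: measurable_funM; first exact: meas_normc.
  exact: (measurableT_comp mk (pair1_measurable y)).
rewrite [leRHS](_ : _ = (normc (a y))%:E * \int[mY]_z (normc (a z) * k (y, z))%:E)%E.
  rewrite lee_wpmul2l ?lee_fin ?normc_ge0//.
  apply: le_integralT => //.
  - by apply/measurable_EFinP; apply: meas_normc; exact: cintegrable_meas I4.
  - by move=> z; rewrite lee_fin normc_ge0.
  - move=> z; rewrite lee_fin Normc.normcM normc_conj ler_wpM2l ?normc_ge0//.
rewrite -ge0_integralZl_EFin ?normc_ge0//.
- by apply: eq_integral => z _; rewrite -EFinM mulrA.
- by move=> z _; rewrite lee_fin mulr_ge0// normc_ge0.
Qed.

(** For [a = a1 a2], the product |a(y) a(z)| is at most half of |a1(y) a2(z)|^2 + |a1(z) a2(y)|^2;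
    as [k] is symmetric, the two terms have the same integral after exchanging y and z. The freedom
    in splitting [a] is what allows different cutoffs on the two factors. *)
Lemma schur_osc (a1 a2 : Y -> R[i]) : cmeasurable a1 -> cmeasurable a2 ->
  cintegrable mY (fun y => a1 y * a2 y) ->
  (\int[mX]_x (w x * sqc (cintegral mY (fun y => cis (th (x, y)) * (a1 y * a2 y))))%:E <=
   \int[mY]_y \int[mY]_z (sqc (a1 y) * sqc (a2 z) * k (y, z))%:E)%E.
Proof.
move=> ma1 ma2 Ia; apply: (le_trans (weighted_osc_le Ia)).
pose Phi (z : Y * Y) := (sqc (a1 z.1) * sqc (a2 z.2) * k z)%:E.
have mPhi : measurable_fun setT Phi.
  apply/measurable_EFinP; apply: measurable_funM => //.
  apply: measurable_funM.
    exact: (measurableT_comp (meas_sqc ma1) measurable_fst).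
  exact: (measurableT_comp (meas_sqc ma2) measurable_snd).
have Phi0 z : (0 <= Phi z)%E by rewrite lee_fin !mulr_ge0// sqc_ge0.
have mPhi' : measurable_fun setT (fun z => Phi (z.2, z.1)).
  exact: (measurableT_comp mPhi (@measurable_swap _ _ Y Y)).
have ma : cmeasurable (fun y => a1 y * a2 y) by exact: cmeasM.
set L := (X in (X <= _)%E); set J := (X in (_ <= X)%E).
have -> : L = (\int[mY \x mY]_z (normc (a1 z.1 * a2 z.1) *
    normc (a1 z.2 * a2 z.2) * k z)%:E)%E.
  rewrite fubini_tonelli1//=.
    apply/measurable_EFinP; apply: measurable_funM => //.
    apply: measurable_funM.
      exact: (measurableT_comp (meas_normc ma) measurable_fst).
    exact: (measurableT_comp (meas_normc ma) measurable_snd).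
  by move=> z; rewrite lee_fin !mulr_ge0// normc_ge0.
have JE : J = (\int[mY \x mY]_z Phi z)%E by rewrite fubini_tonelli1.
have JE' : J = (\int[mY \x mY]_z (fun z => Phi (z.2, z.1)) z)%E.
  rewrite fubini_tonelli2//.
apply: (@le_trans _ _ (\int[mY \x mY]_z (2^-1%:E * (Phi z + (fun z => Phi (z.2, z.1)) z)))%E).
  apply: le_integralT => //.
  - apply/measurable_EFinP; apply: measurable_funM => //.
    apply: measurable_funM.
      exact: (measurableT_comp (meas_normc ma) measurable_fst).
    exact: (measurableT_comp (meas_normc ma) measurable_snd).
  - by apply: measurable_funeM; exact: emeasurable_funD.
  - by move=> z; rewrite lee_fin !mulr_ge0// normc_ge0.
  - move=> [y z]; rewrite /Phi /= -EFinD -EFinM lee_fin (k_sym z y) -mulrDl mulrA.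
    rewrite ler_wpM2r// !Normc.normcM -!normc_sq.
    have := sqr_ge0 (normc (a1 y) * normc (a2 z) - normc (a1 z) * normc (a2 y)).
    nra.
rewrite ge0_integralZl//; last 2 first.
- exact: emeasurable_funD.
- by move=> z _; rewrite adde_ge0.
rewrite ge0_integralD//.
rewrite -JE -JE' -{2}(mul1e J) -{1}(mul1e J) -ge0_muleDl// muleA -EFinD -EFinM.
by rewrite mulVf// mul1e.
Qed.

End Schur.

(** * Square-integrable functions *)

Section L2.
Context d (T : measurableType d) {R : realType}.
Variable mu : {measure set T -> \bar R}.
Implicit Types f g : T -> R[i].

Definition n2 f : \bar R := (\int[mu]_x (sqc (f x))%:E)%E.

Lemma n2_ge0 f : (0 <= n2 f)%E.
Proof. by apply: integral_ge0 => x _; rewrite lee_fin sqc_ge0. Qed.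

Lemma meas_sqcE f : cmeasurable f -> measurable_fun setT (fun x => (sqc (f x))%:E).
Proof. by move=> mf; apply/measurable_EFinP; exact: meas_sqc. Qed.

Lemma n2_L2norm f : n2 f = (L2norm mu f `^ 2)%E.
Proof.
rewrite /n2 /L2norm poweR_Lnorm//; apply: eq_integral => x _.
rewrite /= ger0_norm ?normc_ge0//.
by rewrite powR_mulrn ?normc_ge0// normc_sq.
Qed.

Lemma L2norm_n2 f : L2norm mu f = (n2 f `^ 2^-1)%E.
Proof.
rewrite n2_L2norm -poweRrM mulfV// poweRe1//; exact: Lnorm_ge0.
Qed.

Lemma L2norm_lty f : (L2norm mu f < +oo)%E <-> (n2 f < +oo)%E.
Proof.
split; [rewrite n2_L2norm|rewrite L2norm_n2]; exact: poweR_lty.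
Qed.

Definition sqint f : Prop := cmeasurable f /\ (n2 f < +oo)%E.

Lemma inL2P f : inL2 mu f <-> sqint f.
Proof. by split=> -[mf nf]; split => //; apply/L2norm_lty. Qed.

Lemma n2_le f g : cmeasurable f -> cmeasurable g ->
  (forall x, sqc (f x) <= sqc (g x)) -> (n2 f <= n2 g)%E.
Proof.
move=> mf mg fg; apply: le_integralT; [exact: meas_sqcE|exact: meas_sqcE| |].
  by move=> x; rewrite lee_fin sqc_ge0.
by move=> x; rewrite lee_fin.
Qed.

Lemma n2_ae f g : cmeasurable f -> cmeasurable g ->
  {ae mu, forall x, f x = g x} -> n2 f = n2 g.
Proof.
move=> mf mg fg; apply: ge0_ae_eq_integral => //; try exact: meas_sqcE.
- by move=> x _; rewrite lee_fin sqc_ge0.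
- by move=> x _; rewrite lee_fin sqc_ge0.
- by apply: filterS fg => x -> _.
Qed.

Lemma n2D_le f g : cmeasurable f -> cmeasurable g ->
  (n2 (fun x => f x + g x)%R <= 2%:E * (n2 f + n2 g))%E.
Proof.
move=> mf mg; rewrite /n2 -ge0_integralD//; last 4 first.
- by move=> x _; rewrite lee_fin sqc_ge0.
- exact: meas_sqcE.
- by move=> x _; rewrite lee_fin sqc_ge0.
- exact: meas_sqcE.
rewrite -ge0_integralZl//; last 2 first.
- by apply: emeasurable_funD; exact: meas_sqcE.
- by move=> x _; rewrite -EFinD lee_fin addr_ge0// sqc_ge0.
apply: le_integralT.
- by apply: meas_sqcE; exact: cmeasD.
- by apply: measurable_funeM; apply: emeasurable_funD; exact: meas_sqcE.
- by move=> x; rewrite lee_fin sqc_ge0.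
- by move=> x; rewrite -EFinD -EFinM lee_fin sqcD_le.
Qed.

Lemma n2N f : n2 (fun x => - f x) = n2 f.
Proof. by apply: eq_integral => x _; rewrite sqcN. Qed.

Lemma n2_sym f g : n2 (fun x => f x - g x) = n2 (fun x => g x - f x).
Proof. by rewrite -n2N; congr n2; apply/funext => x; rewrite opprB. Qed.

Lemma n2B_le f g : cmeasurable f -> cmeasurable g ->
  (n2 (fun x => f x - g x)%R <= 2%:E * (n2 f + n2 g))%E.
Proof. by move=> mf mg; rewrite -(n2N g); apply: n2D_le => //; exact: cmeasN. Qed.

Lemma n2_triangle f g h : cmeasurable f -> cmeasurable g -> cmeasurable h ->
  (n2 (fun x => f x - h x)%R <=
   2%:E * (n2 (fun x => f x - g x)%R + n2 (fun x => g x - h x)%R))%E.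
Proof.
move=> mf mg mh; apply: le_trans (n2D_le (cmeasB mf mg) (cmeasB mg mh)).
rewrite le_eqVlt; apply/orP; left; apply/eqP; congr n2; apply/funext => x.
by rewrite addrA subrK.
Qed.

Lemma sqintB f g : sqint f -> sqint g -> sqint (fun x => f x - g x).
Proof.
move=> [mf nf] [mg ng]; split; first exact: cmeasB.
apply: (le_lt_trans (n2B_le mf mg)).
by rewrite lte_mul_pinfty// lte_add_pinfty.
Qed.

Lemma sqint_le f g : cmeasurable f -> sqint g ->
  (forall x, sqc (f x) <= sqc (g x)) -> sqint f.
Proof. by move=> mf [mg ng] fg; split => //; exact: le_lt_trans (n2_le mf mg fg) ng. Qed.

Lemma n2Z (z : R[i]) f : cmeasurable f ->
  n2 (fun x => z * f x) = ((sqc z)%:E * n2 f)%E.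
Proof.
move=> mf; rewrite /n2 -ge0_integralZl//.
- by apply: eq_integral => x _; rewrite sqcM EFinM.
- exact: meas_sqcE.
- by move=> x _; rewrite lee_fin sqc_ge0.
- by rewrite lee_fin sqc_ge0.
Qed.

(* Weighted AM-GM: [2 |z w| <= s |z|^2 + |w|^2 / s] *)
Lemma integral_mul_le f g (s : R) : 0 < s -> cmeasurable f -> cmeasurable g ->
  (\int[mu]_x (normc (f x * g x))%:E <= s%:E * n2 f + (s^-1)%:E * n2 g)%E.
Proof.
move=> s0 mf mg; rewrite /n2.
have mz (h : T -> R[i]) : cmeasurable h -> forall c : R, measurable_fun setT (fun x => (c%:E * (sqc (h x))%:E)%E).
  by move=> mh c; apply: measurable_funeM; exact: (meas_sqcE mh).
rewrite -!ge0_integralZl// ?lee_fin ?invr_ge0 ?(ltW s0)//; last 4 first.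
- exact: meas_sqcE.
- by move=> x _; rewrite lee_fin sqc_ge0.
- exact: meas_sqcE.
- by move=> x _; rewrite lee_fin sqc_ge0.
rewrite -ge0_integralD//; last 4 first.
- by move=> x _; rewrite -EFinM lee_fin mulr_ge0 ?sqc_ge0// ltW.
- exact: mz.
- by move=> x _; rewrite -EFinM lee_fin mulr_ge0 ?sqc_ge0// invr_ge0 ltW.
- exact: mz.
apply: le_integralT.
- by apply/measurable_EFinP; apply: meas_normc; exact: cmeasM.
- by apply: emeasurable_funD; exact: mz.
- by move=> x; rewrite lee_fin normc_ge0.
move=> x; rewrite -!EFinM -EFinD lee_fin Normc.normcM -!normc_sq.
have sn : s != 0 by rewrite gt_eqF.
have a0 := normc_ge0 (f x); have b0 := normc_ge0 (g x).
set a := normc (f x) in a0 *; set b := normc (g x) in b0 *.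
have h : 0 <= s^-1 * (s * a - b) ^+ 2 by rewrite mulr_ge0 ?invr_ge0 ?(ltW s0)// sqr_ge0.
have e : s^-1 * (s * a - b) ^+ 2 = s * a ^+ 2 - 2 * (a * b) + s^-1 * b ^+ 2 by field.
have := mulr_ge0 a0 b0; rewrite e in h; lra.
Qed.

Lemma cintegrable_mul f g : sqint f -> sqint g -> cintegrable mu (fun x => f x * g x).
Proof.
move=> [mf nf] [mg ng]; apply/cintegrableP; split; first exact: cmeasM.
apply: (le_lt_trans (integral_mul_le ltr01 mf mg)).
by rewrite invr1 !mul1e lte_add_pinfty.
Qed.

(** The free parameter [s] does the work of Cauchy-Schwarz: if [n2 f] is tiny, a large [s] makes the
    contribution of the fixed [g] small. *)
Lemma normc_pairing_le f g (s : R) : 0 < s -> sqint f -> sqint g ->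
  ((normc (cintegral mu (fun x => f x * g x)))%:E <=
   s%:E * n2 f + (s^-1)%:E * n2 g)%E.
Proof.
move=> s0 hf hg; apply: (le_trans (normc_cintegral (cintegrable_mul hf hg))).
by apply: integral_mul_le => //; [case: hf|case: hg].
Qed.

(** Continuity of the bilinear pairing: an identity known for arbitrarily close approximations
    passes to the limit, because the defect is a pairing of the two errors with [b] and [c]. *)
Lemma pairing_limit (F b v c : T -> R[i]) : sqint F -> sqint b -> sqint v -> sqint c ->
  (forall e : R, 0 < e -> exists F' v', [/\ sqint F', sqint v',
      (n2 (fun x => F x - F' x)%R <= e%:E)%E, (n2 (fun x => v x - v' x)%R <= e%:E)%E &
      cintegral mu (fun x => F' x * b x) = cintegral mu (fun x => v' x * c x)]) ->
  cintegral mu (fun x => F x * b x) = cintegral mu (fun x => v x * c x).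
Proof.
move=> hF hb hv hc H; apply/eqP; rewrite -subr_eq0; apply/eqP; apply: Normc.eq0_normc.
apply/eqP; rewrite eq_le normc_ge0 andbT; apply/ler_addgt0Pr => e e0; rewrite add0r.
have [_ nb] := hb; have [_ nc] := hc.
(* With this [M] and the next [s], the terms [s^-1 * M] stay below [e / 2], while errors of size
   [e / (4 * s)] contribute [e / 4] each. *)
pose M := fine (n2 b) + fine (n2 c).
have M0 : 0 <= M by rewrite addr_ge0// fine_ge0// n2_ge0.
pose s := (2 * M + 1) / e.
have s0 : 0 < s by rewrite divr_gt0// ltr_wpDl// mulr_ge0.
have [F' [v' [hF' hv' nF nv E]]] := H (e / (4 * s)) (divr_gt0 e0 (mulr_gt0 (ltr0n R 4) s0)).
have -> : cintegral mu (fun x => F x * b x) - cintegral mu (fun x => v x * c x) =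
    cintegral mu (fun x => (F x - F' x) * b x) - cintegral mu (fun x => (v x - v' x) * c x).
  under [X in _ = X - _]eq_cintegral => x do rewrite mulrBl.
  under [X in _ = _ - X]eq_cintegral => x do rewrite mulrBl.
  by rewrite !cintegralB; try exact: cintegrable_mul; rewrite E; ring.
apply: (le_trans (le_normcD _ _)); rewrite normcN.
rewrite -lee_fin EFinD.
have h1 := normc_pairing_le s0 (sqintB hF hF') hb.
have h2 := normc_pairing_le s0 (sqintB hv hv') hc.
apply: (le_trans (leeD h1 h2)).
have nb0 := n2_ge0 b; have nc0 := n2_ge0 c.
rewrite -(fineK (_ : n2 b \is a fin_num)) ?ge0_fin_numE//.
rewrite -(fineK (_ : n2 c \is a fin_num)) ?ge0_fin_numE//.
have sE : (s%:E * (e / (4 * s))%:E = (e / 4)%:E)%E.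
  by rewrite -EFinM; congr EFin; field; rewrite gt_eqF.
have l1 : (s%:E * n2 (fun x => F x - F' x)%R <= (e / 4)%:E)%E.
  by rewrite -sE lee_wpmul2l// lee_fin ltW.
have l2 : (s%:E * n2 (fun x => v x - v' x)%R <= (e / 4)%:E)%E.
  by rewrite -sE lee_wpmul2l// lee_fin ltW.
apply: (le_trans (leeD (leeD l1 (lexx _)) (leeD l2 (lexx _)))).
rewrite -!EFinM -!EFinD lee_fin.
have : s^-1 * M <= e / 2.
  rewrite /s invf_div mulrAC ler_pdivrMr; last by rewrite ltr_wpDl// mulr_ge0.
  have := mulr_ge0 (ltW e0) M0; lra.
rewrite /M; lra.
Qed.

End L2.

(** * Completeness of L2 and almost everywhere convergence *)

Section Completeness.
Context d (T : measurableType d) {R : realType}.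
Variable mu : {measure set T -> \bar R}.

(** The series of 4^j |f_j|^2 has a finite integral, since 4^j 8^-(j+1) is summable; so it is finite
    almost everywhere, and its sum bounds every term. The rate 1/8 is chosen to leave room for the
    weight 4^j. *)
Lemma ae_geometric (f : nat -> T -> R[i]) :
  (forall j, cmeasurable (f j)) ->
  (forall j, (n2 mu (f j) <= ((8^-1) ^+ j.+1)%:E)%E) ->
  {ae mu, forall x, exists C : R, forall j,
    2 ^+ j * `|complex.Re (f j x)| <= C /\ 2 ^+ j * `|complex.Im (f j x)| <= C}.
Proof.
move=> mf nf.
pose h j x := (((4 : R) ^+ j)%:E * (sqc (f j x))%:E)%E.
have mh j : measurable_fun setT (h j).
  by apply: measurable_funeM; exact: meas_sqcE.
have h0 j x : (0 <= h j x)%E by rewrite /h -EFinM lee_fin mulr_ge0 ?exprn_ge0 ?sqc_ge0.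
have ih j : (\int[mu]_x h j x <= (1 / (2 ^ j.+1)%:R)%:E)%E.
  rewrite ge0_integralZl//; last 2 first.
  - exact: meas_sqcE.
  - by move=> x _; rewrite lee_fin sqc_ge0.
  apply: (@le_trans _ _ (((4 : R) ^+ j)%:E * ((8^-1) ^+ j.+1)%:E)%E).
    by rewrite lee_wpmul2l ?lee_fin ?exprn_ge0//; exact: nf.
  rewrite -EFinM lee_fin mul1r natrX -exprVn !exprSr mulrA -exprMn.
  have -> : (4 * 8^-1 : R) = 2^-1 by field.
  by rewrite ler_wpM2l ?exprn_ge0//; lra.
have mH : measurable_fun setT (fun x => \sum_(j <oo) h j x)%E.
  by apply: ge0_emeasurable_sum => // j x _ _; exact: h0.
have H0 x : (0 <= \sum_(j <oo) h j x)%E by apply: nneseries_ge0 => j _ _; exact: h0.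
have iH : mu.-integrable setT (fun x => \sum_(j <oo) h j x)%E.
  apply/integrableP; split => //.
  under eq_integral => x _ do rewrite gee0_abs//.
  rewrite integral_nneseries//.
  apply: (@le_lt_trans _ _ (\sum_(j <oo) (1 / (2 ^ j.+1)%:R)%:E)%E).
    by apply: lee_nneseries => // j _ _; exact: integral_ge0.
  by apply: le_lt_trans (epsilon_trick0 xpredT ler01) _; rewrite ltry.
have := integrable_ae measurableT iH.
apply: filterS => x /(_ Logic.I) fS.
pose S := fine (\sum_(j <oo) h j x)%E.
have SE : (\sum_(j <oo) h j x = S%:E)%E by rewrite fineK.
have S0 : 0 <= S by rewrite fine_ge0.
have hS j : 4 ^+ j * sqc (f j x) <= S.
  rewrite -lee_fin EFinM -SE.
  apply: le_trans (nneseries_lim_ge j.+1 _) => /=; last by move=> n _ _; exact: h0.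
  rewrite big_nat_recr//= leeDr// sume_ge0//.
exists (S + 1) => j.
have aux (a : R) : a ^+ 2 <= sqc (f j x) -> 2 ^+ j * `|a| <= S + 1.
  move=> ha.
  have : (2 ^+ j * `|a|) ^+ 2 <= S.
    apply: le_trans (hS j); rewrite exprMn -exprM mulnC exprM.
    rewrite -normrX ger0_norm ?sqr_ge0//.
    by rewrite (_ : 2 ^+ 2 = 4 :> R) ?ler_wpM2l ?exprn_ge0// -natrX.
  have : 0 <= 2 ^+ j * `|a| by rewrite mulr_ge0// exprn_ge0.
  nra.
by split; apply: aux; rewrite /sqc ?lerDl ?lerDr sqr_ge0.
Qed.

(** Subtracting the tail [2 * C * 2^-j] of the geometric majorant makes the sequence nondecreasing,
    and it is bounded; convergence then follows by monotonicity. *)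
Lemma cvg_of_geometric (u : R^nat) (C : R) :
  (forall j, 2 ^+ j * `|u j.+1 - u j| <= C) -> cvgn u.
Proof.
move=> uC; have C0 : 0 <= C by apply: le_trans (uC 0%N); rewrite expr0 mul1r.
have du j : `|u j.+1 - u j| <= C * (2^-1) ^+ j.
  by rewrite exprVn ler_pdivlMr ?exprn_gt0// mulrC.
pose v j := u j - 2 * C * (2^-1) ^+ j.
have nv : {homo v : n m / (n <= m)%N >-> n <= m}.
  apply/nondecreasing_seqP => j; rewrite /v exprS.
  have := du j; rewrite ler_norml => /andP[+ _]; lra.
have ub n : u n <= u 0%N + 2 * C - 2 * C * (2^-1) ^+ n.
  elim: n => [|n ih]; first by rewrite expr0; lra.
  have := du n; rewrite ler_norml => /andP[_ +]; rewrite exprS; lra.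
have cv : cvgn v.
  apply: nondecreasing_is_cvgn => //; exists (u 0%N + 2 * C) => _ [n _ <-].
  rewrite /v; have := ub n.
  have : 0 <= C * (2^-1) ^+ n by rewrite mulr_ge0// exprn_ge0.
  lra.
have cg : (2^-1 : R) ^+ n @[n --> \oo] --> 0.
  by apply: cvg_expr; rewrite ger0_norm; lra.
rewrite (_ : u = v \+ (fun j => 2 * C * (2^-1) ^+ j)); last first.
  by apply/funext => j; rewrite /v/= subrK.
apply: is_cvgD => //; apply: is_cvgM; first exact: is_cvg_cst.
by apply/cvg_ex; exists 0.
Qed.

Lemma cvg0_of_geometric (u : R^nat) (C : R) :
  (forall j, 2 ^+ j * `|u j| <= C) -> u @ \oo --> 0.
Proof.
move=> uC.
have cg : C * (2^-1 : R) ^+ n @[n --> \oo] --> 0.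
  rewrite -[X in _ --> X](mulr0 C); apply: cvgM; first exact: cvg_cst.
  by apply: cvg_expr; rewrite ger0_norm; lra.
apply: norm_cvg0; apply: (@squeeze_cvgr _ _ _ _ (cst 0) (fun n => C * (2^-1) ^+ n)) => //.
- near=> n; rewrite /= normr_ge0/= exprVn ler_pdivlMr ?exprn_gt0//.
  by rewrite mulrC.
- exact: cvg_cst.
Unshelve. all: by end_near. Qed.

(** Coordinatewise, so that the limit theorems for real sequences apply as they are. *)
Definition ccvg (u : nat -> R[i]) (z : R[i]) : Prop :=
  (fun n => complex.Re (u n)) @ \oo --> complex.Re z /\
  (fun n => complex.Im (u n)) @ \oo --> complex.Im z.

Lemma ccvg_sqc (u : nat -> R[i]) (z : R[i]) : ccvg u z ->
  (fun n => (sqc (u n))%:E) @ \oo --> (sqc z)%:E.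
Proof.
move=> [h1 h2]; apply: cvg_EFin; first exact: nearW.
by apply: cvgD; rewrite !expr2; apply: cvgM.
Qed.

Lemma ccvgB (u : nat -> R[i]) (w z : R[i]) : ccvg u z -> ccvg (fun n => w - u n) (w - z).
Proof.
by case: w => a b [h1 h2]; split => /=; under eq_fun do rewrite ?ReD ?ImD ?ReN ?ImN/=;
  rewrite ?ReD ?ImD ?ReN ?ImN/=; apply: cvgB => //; exact: cvg_cst.
Qed.

(** Fatou's lemma for the squared moduli; besides completeness, it serves to remove the damping
    factors from estimates that are uniform in them. *)
Lemma n2_fatou (f : nat -> T -> R[i]) (F : T -> R[i]) (c : \bar R) :
  (forall j, cmeasurable (f j)) -> cmeasurable F ->
  {ae mu, forall x, ccvg (f^~ x) (F x)} ->
  (\forall n \near \oo, (n2 mu (f n) <= c)%E) -> (n2 mu F <= c)%E.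
Proof.
move=> mf mF fF nc.
have mh j : measurable_fun setT (fun x => (sqc (f j x))%:E) by exact: meas_sqcE.
have h0 j x : setT x -> (0 <= (sqc (f j x))%:E)%E by rewrite lee_fin sqc_ge0.
have mlim : measurable_fun setT (fun x => limn_einf (fun j => (sqc (f j x))%:E)).
  rewrite /limn_einf; apply: measurableT_comp => //.
  by apply: measurable_fun_limn_esup => j; exact: measurableT_comp.
have E : n2 mu F = (\int[mu]_x limn_einf (fun j => (sqc (f j x))%:E))%E.
  apply: ae_eq_integral => //; first exact: meas_sqcE.
  by apply: filterS fF => x fx _; rewrite (cvg_limn_einf_sup (ccvg_sqc fx)).1.
rewrite E; apply: (le_trans (fatou mu measurableT mh h0)).
rewrite limn_einf_lim; apply: lime_le; first exact: is_cvg_einfs.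
near=> n; apply: (@le_trans _ _ (n2 mu (f n))).
  by apply: ereal_inf_lbound; exists n => //=.
by near: n.
Unshelve. all: by end_near. Qed.

(** Riesz-Fischer for a rapidly Cauchy sequence. The limit is taken as the finite part of an upper
    limit in each coordinate, which is measurable without discussing the exceptional set; Fatou's
    lemma bounds the distance to it. *)
Lemma L2_complete_geometric (f : nat -> T -> R[i]) : (forall j, sqint mu (f j)) ->
  (forall j m, (j <= m)%N ->
    (n2 mu (fun x => f j x - f m x)%R <= ((8^-1) ^+ j.+1)%:E)%E) ->
  exists F, [/\ sqint mu F,
    forall j, (n2 mu (fun x => f j x - F x)%R <= ((8^-1) ^+ j.+1)%:E)%E &
    {ae mu, forall x, ccvg (f^~ x) (F x)}].
Proof.
move=> hf hc; have mf j : cmeasurable (f j) by have [] := hf j.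
pose F x := fine (limn_esup (fun j => (complex.Re (f j x))%:E)) +i*
            fine (limn_esup (fun j => (complex.Im (f j x))%:E)).
have mF : cmeasurable F.
  split => /=; apply: measurableT_comp => //; apply: measurable_fun_limn_esup => j;
    apply/measurable_EFinP; by have [] := mf j.
have aeF : {ae mu, forall x, ccvg (f^~ x) (F x)}.
  have mD j : cmeasurable (fun x => f j x - f j.+1 x) by exact: cmeasB.
  have := ae_geometric mD (fun j => hc j j.+1 (leqnSn j)).
  apply: filterS => x [C hC].
  have cvg_fine (u : R^nat) : cvgn u -> u @ \oo --> fine (limn_esup (fun j => (u j)%:E)).
    move=> cu; have h : (u j)%:E @[j --> \oo] --> (limn u)%:E.
      by apply: cvg_EFin => //; exact: nearW.
    by rewrite (cvg_limn_einf_sup h).2.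
  split; apply: cvg_fine; apply: (@cvg_of_geometric _ C) => j.
    by have [+ _] := hC j; rewrite ReD ReN distrC.
  by have [_] := hC j; rewrite ImD ImN distrC.
have nF j : (n2 mu (fun x => f j x - F x)%R <= ((8^-1) ^+ j.+1)%:E)%E.
  apply: (@n2_fatou (fun m x => f j x - f m x)).
  - by move=> m; exact: cmeasB.
  - exact: cmeasB.
  - by apply: filterS aeF => x; exact: ccvgB.
  - by exists j => // m /= jm; exact: hc.
exists F; split => //; split => //.
have := n2B_le mu (mf 0%N) (cmeasB (mf 0%N) mF).
under [X in (n2 _ X <= _)%E]eq_fun do rewrite opprB addrC subrK.
move=> /le_lt_trans -> //; rewrite lte_mul_pinfty// lte_add_pinfty//.
  by have [] := hf 0%N.
by apply: (le_lt_trans (nF 0%N)); rewrite ltry.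
Qed.

Definition n2cvg (f : nat -> T -> R[i]) (F : T -> R[i]) : Prop :=
  forall e : R, 0 < e -> exists N, forall n, (N <= n)%N ->
    (n2 mu (fun x => f n x - F x)%R <= e%:E)%E.

Definition n2cauchy (f : nat -> T -> R[i]) : Prop :=
  forall e : R, 0 < e -> exists N, forall n m, (N <= n)%N -> (n <= m)%N ->
    (n2 mu (fun x => f n x - f m x)%R <= e%:E)%E.

Lemma pow8_gt0 j : 0 < (8^-1 : R) ^+ j.+1.
Proof. by rewrite exprn_gt0. Qed.

Lemma pow8_small (e : R) : 0 < e -> exists j, 4 * (8^-1 : R) ^+ j.+1 <= e.
Proof.
move=> e0.
have cg : 4 * (8^-1 : R) ^+ n.+1 @[n --> \oo] --> 0.
  rewrite -[X in _ --> X](mulr0 4); apply: cvgM; first exact: cvg_cst.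
  rewrite (cvg_shiftS (fun n => (8^-1 : R) ^+ n)).
  by apply: cvg_expr; rewrite ger0_norm; lra.
move/cvgrPdist_le : cg => /(_ _ e0) [N _ /(_ N (leqnn _))] h.
exists N; move: h; rewrite sub0r normrN ger0_norm// mulr_ge0// ltW//; exact: pow8_gt0.
Qed.

Lemma subsequence_choice (P : nat -> nat -> Prop) :
  (forall j, exists N, forall n, (N <= n)%N -> P j n) ->
  exists phi : nat -> nat, (forall i j, (i <= j)%N -> (phi i <= phi j)%N) /\
    forall j n, (phi j <= n)%N -> P j n.
Proof.
move=> H; have [N HN] := choice H.
(* Partial sums of the chosen ranks are nondecreasing, and the sum through index [j] is at least
   [N j]. *)
exists (fun j => \sum_(i < j.+1) N i)%N; split.
  move=> i j ij; elim: j ij => [|j ih]; first by rewrite leqn0 => /eqP ->.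
  rewrite leq_eqVlt => /predU1P[->//|/ih ij]; apply: (leq_trans ij).
  by rewrite [X in (_ <= X)%N]big_ord_recr/= leq_addr.
move=> j n jn; apply: HN; apply: leq_trans jn.
by rewrite big_ord_recr/= leq_addl.
Qed.

Lemma L2_complete (f : nat -> T -> R[i]) : (forall j, sqint mu (f j)) ->
  n2cauchy f -> exists F, sqint mu F /\ n2cvg f F.
Proof.
move=> hf hc; have mf j : cmeasurable (f j) by have [] := hf j.
have [phi [phi_nd hphi]] := @subsequence_choice
  (fun j n => forall m, (n <= m)%N ->
     (n2 mu (fun x => f n x - f m x)%R <= ((8^-1) ^+ j.+1)%:E)%E)
  (fun j => let: ex_intro N hN := hc _ (pow8_gt0 j) in
            ex_intro _ N (fun n Nn m nm => hN n m Nn nm)).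
have [F [hF nF _]] := @L2_complete_geometric (fun j => f (phi j)) (fun j => hf _)
  (fun j m jm => hphi j (phi j) (leqnn _) _ (phi_nd _ _ jm)).
exists F; split => // e e0; have [j je] := pow8_small e0.
exists (phi j) => n jn; have [mF _] := hF.
apply: (le_trans (n2_triangle mu (mf n) (mf (phi j)) mF)).
have h1 := hphi j _ (leqnn _) _ jn; rewrite n2_sym in h1.
apply: (@le_trans _ _ (2%:E * (((8^-1) ^+ j.+1)%:E + ((8^-1) ^+ j.+1)%:E))%E).
  by rewrite lee_wpmul2l// leeD.
rewrite -EFinD -EFinM lee_fin; apply: le_trans je; lra.
Qed.

(** Along a subsequence approaching [F] at the rate 1/8, [ae_geometric] bounds 2^j times the error
    at almost every point. *)
Lemma n2cvg_ae_subsequence (f : nat -> T -> R[i]) (F : T -> R[i]) :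
  (forall j, cmeasurable (f j)) -> cmeasurable F -> n2cvg f F ->
  exists phi : nat -> nat, {ae mu, forall x, ccvg (fun j => f (phi j) x) (F x)}.
Proof.
move=> mf mF fF.
have [phi [_ hphi]] := @subsequence_choice
  (fun j n => (n2 mu (fun x => f n x - F x)%R <= ((8^-1) ^+ j.+1)%:E)%E)
  (fun j => fF _ (pow8_gt0 j)).
exists phi.
have mD j : cmeasurable (fun x => f (phi j) x - F x) by exact: cmeasB.
have := ae_geometric mD (fun j => hphi j _ (leqnn _)).
apply: filterS => x [C hC].
have aux (u : R^nat) (l : R) : (forall j, 2 ^+ j * `|u j - l| <= C) -> u @ \oo --> l.
  by move=> uC; apply: cvg_sub0 (cvg_cst l) => //; exact: (@cvg0_of_geometric _ C).
by split; apply: aux => j; have := hC j; rewrite ReD ReN ImD ImN => -[].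
Qed.

End Completeness.

(** * Changes of variables and the Poisson kernel *)

Section Affine.
Context {R : realType}.
Local Notation leb := (@lebesgue_measure R).

Lemma affine_preimage_ocitv (a b u v : R) : a != 0 ->
  (leb ((fun x : R => a * x + b)%R @^-1` `]u, v]) = (`|a|^-1)%:E * leb `]u, v])%E.
Proof.
move=> a0; have [a_gt0|a_lt0|a_eq0] := ltgtP 0 a; last by rewrite a_eq0 eqxx in a0.
- rewrite (_ : _ @^-1` _ = `](u - b) / a, (v - b) / a]%classic); last first.
    apply/seteqP; split => x /=; rewrite !in_itv/= ltr_pdivrMr// ler_pdivlMr//;
      by rewrite ltrBlDr lerBrDr mulrC.
  rewrite !lebesgue_measure_itv/= !lte_fin ltr_pM2r ?invr_gt0// ltrD2r gtr0_norm//.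
  case: ifPn => _; last by rewrite mule0.
  by rewrite -!EFinB -EFinM; congr EFin; field.
- rewrite (_ : _ @^-1` _ = `[(v - b) / a, (u - b) / a[%classic); last first.
    apply/seteqP; split => x /=; rewrite !in_itv/= ler_ndivrMr// ltr_ndivlMr//;
      by rewrite ltrBlDr lerBrDr mulrC andbC.
  rewrite !lebesgue_measure_itv/= !lte_fin ltr_nM2r ?invr_lt0// ltrD2r ltr0_norm//.
  case: ifPn => _; last by rewrite mule0.
  by rewrite -!EFinB -EFinM; congr EFin; field.
Qed.

Lemma measurable_affine (a b : R) : measurable_fun setT (fun x : R => a * x + b).
Proof. by apply: measurable_funD => //; exact: mulrl_measurable. Qed.

(** The pushforward by the affine map, rescaled by |a|, agrees with Lebesgue measure on half-open
    intervals, hence everywhere by uniqueness. *)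
Lemma lebesgue_affine (a b : R) (A : set R) : a != 0 -> measurable A ->
  (leb ((fun x : R => a * x + b)%R @^-1` A) = (`|a|^-1)%:E * leb A)%E.
Proof.
move=> a0 mA; pose phi : measurableTypeR R -> measurableTypeR R := fun x => a * x + b.
have mphi : measurable_fun [set: measurableTypeR R] phi.
  exact: measurable_affine.
have a_ge0 : 0 <= `|a| by [].
suff h : leb A = mscale (NngNum a_ge0) (pushforward leb phi) A.
  rewrite (h mphi) /mscale/= /pushforward.
  by rewrite muleA -EFinM mulVf ?normr_eq0// mul1e.
move=> mphi'; apply: lebesgue_measure_unique => //= _ [[u v]] _ <-.
rewrite /mscale /= /pushforward affine_preimage_ocitv//.
by rewrite muleA -EFinM mulfV ?normr_eq0// mul1e.
Qed.

Lemma ge0_integral_affine (a b : R) (f : R -> \bar R) : a != 0 ->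
  measurable_fun setT f -> (forall x, 0 <= f x)%E ->
  (\int[leb]_x f (a * x + b)%R = (`|a|^-1)%:E * \int[leb]_x f x)%E.
Proof.
move=> a0 mf f0; pose phi : measurableTypeR R -> measurableTypeR R := fun x => a * x + b.
have mphi : measurable_fun [set: measurableTypeR R] phi.
  exact: measurable_affine.
have a_ge0 : 0 <= `|a|^-1 by rewrite invr_ge0.
rewrite -[RHS](ge0_integral_mscale leb measurableT (NngNum a_ge0))//.
rewrite -[LHS](ge0_integral_pushforward mphi (f := f) _ measurableT)//.
by apply: eq_measure_integral => A mA _; exact: lebesgue_affine.
Qed.

Lemma ge0_integral_translation (b : R) (f : R -> \bar R) :
  measurable_fun setT f -> (forall x, 0 <= f x)%E ->
  (\int[leb]_x f (x + b)%R = \int[leb]_x f x)%E.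
Proof.
move=> mf f0; have := @ge0_integral_affine 1 b f (oner_neq0 _) mf f0.
rewrite normr1 invr1 mul1e => <-.
by apply: eq_integral => x _; rewrite mul1r.
Qed.

Lemma ge0_integral_reflection (b : R) (f : R -> \bar R) :
  measurable_fun setT f -> (forall x, 0 <= f x)%E ->
  (\int[leb]_x f (b - x)%R = \int[leb]_x f x)%E.
Proof.
move=> mf f0; have N0 : (-1 : R) != 0 by rewrite oppr_eq0 oner_neq0.
have := @ge0_integral_affine (-1) b f N0 mf f0.
rewrite normrN1 invr1 mul1e => <-.
by apply: eq_integral => x _; rewrite mulN1r addrC.
Qed.

End Affine.

(** * Integrals computed from primitives *)

Section FTC.
Context {R : realType}.
Local Notation leb := (@lebesgue_measure R).

Lemma ftc_itv (f F : R -> R) (a b : R) : a <= b -> continuous f ->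
  (forall x : R, is_derive x (1 : R) F (f x)) ->
  (\int[leb]_(x in `[a, b]) (f x)%:E = (F b - F a)%:E)%E.
Proof.
move=> ab cf dF.
have cF : continuous F.
  by move=> x; apply: differentiable_continuous; apply/derivable1_diffP;
    apply: ex_derive.
move: ab; rewrite le_eqVlt => /predU1P[<-|ab].
  by rewrite set_itv1 integral_set1 subrr.
rewrite (@continuous_FTC2 _ f F)//.
- exact: continuous_subspaceT.
- split.
  + by move=> x _; exact: ex_derive.
  + by apply: cvg_at_right_filter; exact: cF.
  + by apply: cvg_at_left_filter; exact: cF.
- by move=> x _; rewrite derive1E; exact: derive_val.
Qed.

Lemma ftc_y (f F : R -> R) (a l : R) : (forall x, 0 <= f x) -> continuous f ->
  (forall x : R, is_derive x (1 : R) F (f x)) -> F x @[x --> +oo] --> l ->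
  (\int[leb]_(x in `[a, +oo[) (f x)%:E = (l - F a)%:E)%E.
Proof.
move=> f0 cf dF Fl.
have cF : continuous F.
  by move=> x; apply: differentiable_continuous; apply/derivable1_diffP;
    apply: ex_derive.
rewrite (@ge0_continuous_FTC2y _ f F a l)//.
- exact: continuous_subspaceT.
- by apply: cvg_at_right_filter; exact: cF.
- by move=> x _; rewrite derive1E; exact: derive_val.
Qed.

(** A primitive is asked only of [g], which agrees with [f] on the half-line: typically [f] involves
    |t|, and [g] has t in its place. *)
Lemma ge0_even_integral (f g F : R -> R) (l : R) : (forall x, 0 <= f x) ->
  continuous f -> (forall x, f (- x) = f x) -> (forall x, 0 <= g x) ->
  continuous g -> (forall x, 0 <= x -> f x = g x) ->
  (forall x : R, is_derive x (1 : R) F (g x)) -> F x @[x --> +oo] --> l ->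
  (\int[leb]_x (f x)%:E = (2 * (l - F 0))%:E)%E.
Proof.
move=> f0 cf ef g0 cg fg dF Fl; rewrite ge0_symfun_integralT//; last by move=> x /=.
rewrite (_ : [set x | _] = `[0, +oo[%classic); last first.
  by apply/seteqP; split => x/=; rewrite in_itv/= andbT.
rewrite EFinM -(ftc_y 0 g0 cg dF Fl); congr (_ * _)%E.
by apply: eq_integral => x; rewrite inE/= in_itv/= andbT => x0; rewrite fg.
Qed.

End FTC.

(** * The Poisson kernel as Fourier transform of the exponential damping *)

Section Poisson.
Context {R : realType}.
Local Notation leb := (@lebesgue_measure R).

(** The Poisson kernel without its factor 1/(2 pi): the total mass is 2 pi, and [2 * atan (t / e)]
    is a primitive. *)
Definition poisson (e t : R) : R := 2 * e / (e ^+ 2 + t ^+ 2).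

Lemma poisson_ge0 (e t : R) : 0 <= e -> 0 <= poisson e t.
Proof. by move=> e0; rewrite mulr_ge0 ?mulr_ge0// invr_ge0 addr_ge0// sqr_ge0. Qed.

Lemma poissonN (e t : R) : poisson e (- t) = poisson e t.
Proof. by rewrite /poisson sqrrN. Qed.

Lemma sqrD_gt0 (e t : R) : 0 < e -> 0 < e ^+ 2 + t ^+ 2.
Proof. by move=> e0; rewrite ltr_pwDl ?sqr_ge0// exprn_gt0. Qed.

Lemma continuous_compose (f g : R -> R) : continuous f -> continuous g ->
  continuous (fun t : R => g (f t)).
Proof. by move=> cf cg t; exact: continuous_comp (cf t) (cg (f t)). Qed.

Lemma continuous_mulc (c : R) : continuous (fun t : R => c * t).
Proof. by move=> t; apply: cvgM; [exact: cvg_cst|exact: cvg_id]. Qed.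

Lemma continuous_poisson (e : R) : 0 < e -> continuous (poisson e).
Proof.
move=> e0 t; apply: cvgM; first exact: cvg_cst.
apply: cvgV; first by rewrite gt_eqF// sqrD_gt0.
by apply: cvgD; [exact: cvg_cst|exact: exprn_continuous].
Qed.

Lemma measurable_poisson (e : R) : 0 < e -> measurable_fun setT (poisson e).
Proof. by move=> e0; apply: continuous_measurable_fun; exact: continuous_poisson. Qed.

Lemma is_derive_poisson (e c t : R) : 0 < e ->
  is_derive t (1 : R) (fun s : R => 2 * atan ((s - c) / e)) (poisson e (t - c)).
Proof.
move=> e0; have e_neq0 : e != 0 by rewrite gt_eqF.
apply: is_derive_eq; rewrite /GRing.scale/= /poisson; field.
by rewrite e_neq0 gt_eqF// sqrD_gt0.
Qed.

Lemma poisson_itv (e c a b : R) : 0 < e -> a <= b ->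
  (\int[leb]_(t in `[a, b]) (poisson e (t - c))%:E =
   (2 * atan ((b - c) / e) - 2 * atan ((a - c) / e))%:E)%E.
Proof.
move=> e0 ab.
rewrite (ftc_itv ab (f := fun t => poisson e (t - c)) _
  (fun t : R => is_derive_poisson c t e0))//.
apply: (continuous_compose (f := fun t => t - c)); last exact: continuous_poisson.
by move=> t; apply: cvgB => //; exact: cvg_cst.
Qed.

Lemma poisson_total (e c : R) : 0 < e ->
  (\int[leb]_t (poisson e (t - c))%:E = (2 * pi)%:E)%E.
Proof.
move=> e0; rewrite (@ge0_integral_translation _ (- c) (fun t : R => (poisson e t)%:E)).
- have dF (t : R) : is_derive t (1 : R) (fun s : R => 2 * atan ((s - 0) / e)) (poisson e t).
    by have := is_derive_poisson 0 t e0; rewrite subr0.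
  rewrite (ge0_even_integral (f := poisson e) (l := pi) _ _ _ _ _ _ dF)//.
  + by rewrite subrr mul0r atan0 mulr0 subr0.
  + by move=> t; rewrite poisson_ge0// ltW.
  + exact: continuous_poisson.
  + by move=> t; rewrite poissonN.
  + by move=> t; rewrite poisson_ge0// ltW.
  + exact: continuous_poisson.
  + rewrite [X in _ --> X](_ : _ = 2 * (pi / 2)); last by field.
    apply: cvgM; first exact: cvg_cst.
    have ey : (x - 0) / e @[x --> +oo] --> +oo.
      apply: gt0_cvgMly; first by rewrite invr_gt0.
      by under eq_fun do rewrite subr0; exact: cvg_id.
    exact: (cvg_comp _ _ ey (@cvgy_atan R)).
- by apply/measurable_EFinP; exact: measurable_poisson.
- by move=> t; rewrite lee_fin poisson_ge0// ltW.
Qed.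

Definition expdecay (e t : R) : R := expR (- (e * `|t|)).

Lemma expdecay_ge0 (e t : R) : 0 <= expdecay e t.
Proof. exact: expR_ge0. Qed.

Lemma expdecay_le1 (e t : R) : 0 <= e -> expdecay e t <= 1.
Proof. by move=> e0; rewrite -expR0 ler_expR oppr_le0 mulr_ge0. Qed.

Lemma continuous_expdecay (e : R) : continuous (expdecay e).
Proof.
apply: (continuous_compose (f := fun t => - (e * `|t|))); last exact: continuous_expR.
move=> t; apply: cvgN; apply: cvgM; first exact: cvg_cst.
exact: norm_continuous.
Qed.

Lemma measurable_expdecay (e : R) : measurable_fun setT (expdecay e).
Proof. by apply: continuous_measurable_fun; exact: continuous_expdecay. Qed.

Lemma expR_bounded_cvg0 (e : R) (h : R -> R) (M : R) : 0 < e -> (forall t, `|h t| <= M) ->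
  expR (- e * t) * h t @[t --> +oo] --> 0.
Proof.
move=> e0 hM.
have E0 : expR (- e * t) * M @[t --> +oo] --> 0.
  rewrite -[X in _ --> X](mul0r M); apply: cvgM; last exact: cvg_cst.
  have : e * t @[t --> +oo] --> +oo.
    by apply: gt0_cvgMry => //; exact: cvg_id.
  move=> ety; have := cvg_comp _ _ ety (@cvgr_expR R).
  by under [in X in _ -> X]eq_fun do rewrite mulNr.
apply: norm_cvg0.
apply: (@squeeze_cvgr _ _ _ _ (cst 0) (fun t : R => expR (- e * t) * M)) => //.
- near=> t; rewrite /= normr_ge0/= normrM ger0_norm ?expR_ge0//.
  by rewrite ler_wpM2l// expR_ge0.
- exact: cvg_cst.
Unshelve. all: by end_near. Qed.

Lemma expdecay_total (e : R) : 0 < e -> (\int[leb]_t (expdecay e t)%:E = (2 / e)%:E)%E.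
Proof.
move=> e0; have e_neq0 : e != 0 by rewrite gt_eqF.
have dF (t : R) : is_derive t (1 : R) (fun t : R => expR (- e * t) * (- e^-1)) (expR (- e * t)).
  by apply: is_derive_eq; rewrite /GRing.scale/=; field.
rewrite (ge0_even_integral (f := expdecay e) (l := 0) _ _ _ _ _ _ dF)//.
- by rewrite mulr0 expR0 mul1r sub0r opprK.
- exact: expdecay_ge0.
- exact: continuous_expdecay.
- by move=> t; rewrite /expdecay normrN.
- exact: (continuous_compose (continuous_mulc (c := - e)) (@continuous_expR R)).
- by move=> t t0; rewrite /expdecay ger0_norm// mulNr.
- by apply: (@expR_bounded_cvg0 e (cst (- e^-1)) (e^-1)) => // t;
    rewrite normrN ger0_norm// invr_ge0 ltW.
Qed.

(** The summand 1 makes the integrand nonnegative, as [ge0_even_integral] requires; it is subtracted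
    again in [cintegral_expdecay]. The primitive comes from integrating exp((-e + ic)t) and taking
    real parts. *)
Lemma expdecay_cos_total (e c : R) : 0 < e ->
  (\int[leb]_t (expdecay e t * (1 + cos (c * t)))%:E = (2 / e + poisson e c)%:E)%E.
Proof.
move=> e0; have e_neq0 : e != 0 by rewrite gt_eqF.
have cos1 t : 0 <= 1 + cos (c * t) by rewrite -lerBlDl sub0r cos_geN1.
have ccos : continuous (fun t : R => 1 + cos (c * t)).
  move=> t; apply: cvgD; first exact: cvg_cst.
  exact: (continuous_compose (continuous_mulc (c := c)) (@continuous_cos R)).
have ecc : e ^+ 2 + c ^+ 2 != 0 by rewrite gt_eqF// sqrD_gt0.
have dF (t : R) : is_derive t (1 : R) (fun t : R => expR (- e * t) * (- e^-1 +
     (- e * cos (c * t) + c * sin (c * t)) / (e ^+ 2 + c ^+ 2)))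
     (expR (- e * t) * (1 + cos (c * t))).
  apply: is_derive_eq; rewrite /GRing.scale/=; field.
  by rewrite e_neq0 ecc.
rewrite (ge0_even_integral (f := fun t => expdecay e t * (1 + cos (c * t)))
  (l := 0) _ _ _ _ _ _ dF)//.
- rewrite !mulr0 expR0 cos0 sin0 !mul1r /poisson; congr EFin; field.
  by rewrite e_neq0 ecc.
- by move=> t; rewrite mulr_ge0// expdecay_ge0.
- by move=> t; apply: cvgM; [exact: continuous_expdecay|exact: ccos].
- by move=> t; rewrite /expdecay normrN mulrN cosN.
- move=> t; apply: cvgM; last exact: ccos.
  exact: (continuous_compose (continuous_mulc (c := - e)) (@continuous_expR R)).
- by move=> t t0; rewrite /expdecay ger0_norm// mulNr.
- apply: (@expR_bounded_cvg0 e _ (e^-1 + (e + `|c|) / (e ^+ 2 + c ^+ 2))) => // t.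
  rewrite (le_trans (ler_normD _ _))// normrN ger0_norm ?invr_ge0 ?(ltW e0)//.
  rewrite lerD2l normrM (@ger0_norm _ (_^-1)) ?invr_ge0 ?(ltW (sqrD_gt0 _ _))//.
  rewrite ler_wpM2r ?invr_ge0 ?(ltW (sqrD_gt0 _ _))//.
  rewrite (le_trans (ler_normD _ _))// !normrM normrN (gtr0_norm e0) lerD//.
    by rewrite ler_piMr ?(ltW e0)// ler_norml cos_geN1 cos_le1.
  by rewrite ler_piMr// ler_norml sin_geN1 sin_le1.
Qed.

Lemma integrable_expdecay (e : R) : 0 < e -> leb.-integrable setT (EFin \o expdecay e).
Proof.
move=> e0; apply/integrableP; split.
  by apply/measurable_EFinP; exact: measurable_expdecay.
under eq_integral => t _ do rewrite gee0_abs ?lee_fin ?expdecay_ge0//.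
by rewrite expdecay_total// ltry.
Qed.

(** The real part is the difference of the two totals just computed. The imaginary part has an odd
    integrand, whose positive and negative parts are exchanged by t -> -t. *)
Lemma cintegral_expdecay (e c : R) : 0 < e ->
  cintegral leb (fun t : R => cis (c * t) * (expdecay e t)%:C) = (poisson e c)%:C.
Proof.
move=> e0; have Ie := integrable_expdecay e0.
have mc : measurable_fun setT (fun t : R => c * t).
  by apply: continuous_measurable_fun; exact: continuous_mulc.
have mcis : cmeasurable (fun t : R => cis (c * t)) by exact: cmeas_cis.
have Ice : cintegrable leb (fun t : R => cis (c * t) * (expdecay e t)%:C).
  apply: (cintegrable_le _ Ie).
    by apply: cmeasM => //; apply: cmeas_real; exact: measurable_expdecay.
  move=> t; rewrite Normc.normcM normc_cis mul1r normc_real ger0_norm//.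
  exact: expdecay_ge0.
have [I1 I2] := Ice.
apply: eq_complexP => /=.
- have E : (\int[leb]_t (expdecay e t * (1 + cos (c * t))) = 2 / e + poisson e c).
    by rewrite /Rintegral expdecay_cos_total.
  have E1 : (\int[leb]_t expdecay e t = 2 / e) by rewrite /Rintegral expdecay_total.
  apply: (addrI (2 / e)); rewrite -E -{1}E1 -RintegralD//.
  apply: eq_Rintegral => t _; rewrite mulr0 subr0; ring.
- pose h t := cos (c * t) * 0 + sin (c * t) * expdecay e t.
  have mh : measurable_fun setT (EFin \o h) by exact: measurable_int I2.
  rewrite -/h /Rintegral integralE.
  suff -> : (\int[leb]_x (EFin \o h)^\+ x = \int[leb]_x (EFin \o h)^\- x)%E.
    rewrite subee//; apply: integrable_fin_num => //; exact: integrable_funeneg.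
  rewrite -[LHS](ge0_integral_reflection 0)//; last exact: measurable_funepos.
  apply: eq_integral => t _; rewrite funeposE funenegE sub0r /= /h /expdecay.
  by rewrite normrN mulrN cosN sinN !mulr0 !add0r mulNr.
Qed.

End Poisson.

Section ProdIntegral.
Context {R : realType}.
Local Notation leb := (@lebesgue_measure R).
Local Open Scope ereal_scope.
Variable f : R3 R -> \bar R.
Hypothesis mf : measurable_fun setT f.
Hypothesis f0 : forall x, 0 <= f x.

(** The several orders of integration differ in the innermost variable, which has to be the one that
    a given shear translates. *)
Lemma leb3_zxy : \int[@leb3 R]_x f x =
  \int[leb]_z \int[leb]_x \int[leb]_y f (x, y, z).
Proof.
rewrite /leb3 (fubini_tonelli2 (m1 := @leb2 R) (m2 := leb))//.
apply: eq_integral => z _; rewrite /fubini_G /leb2.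
by rewrite (fubini_tonelli1 (m1 := leb) (m2 := leb) (fun p => f (p, z)))//;
  exact: (measurableT_comp mf (pair2_measurable z)).
Qed.

Lemma leb3_zyx : \int[@leb3 R]_x f x =
  \int[leb]_z \int[leb]_y \int[leb]_x f (x, y, z).
Proof.
rewrite /leb3 (fubini_tonelli2 (m1 := @leb2 R) (m2 := leb))//.
apply: eq_integral => z _; rewrite /fubini_G /leb2.
by rewrite (fubini_tonelli2 (m1 := leb) (m2 := leb) (fun p => f (p, z)))//;
  exact: (measurableT_comp mf (pair2_measurable z)).
Qed.

Lemma leb3_xyz : \int[@leb3 R]_x f x =
  \int[@leb2 R]_p \int[leb]_z f (p, z).
Proof. by rewrite /leb3 (fubini_tonelli1 (m1 := @leb2 R) (m2 := leb)). Qed.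

End ProdIntegral.

(** * Rotations and reflections preserve Lebesgue measure in space *)

Section Isometries.
Context {R : realType}.
Local Notation leb := (@lebesgue_measure R).
Implicit Types xi : R3 R.

(** Phrased with integrals of nonnegative functions rather than measures of sets: this is how it is
    used, and it composes at once. *)
Definition preserves3 (phi : R3 R -> R3 R) : Prop :=
  measurable_fun setT phi /\
  forall f : R3 R -> \bar R, measurable_fun setT f -> (forall x, 0 <= f x)%E ->
    (\int[@leb3 R]_x f (phi x) = \int[@leb3 R]_x f x)%E.

Lemma preserves3_comp phi psi : preserves3 phi -> preserves3 psi ->
  preserves3 (phi \o psi).
Proof.
move=> [m1 h1] [m2 h2]; split; first exact: measurableT_comp.
move=> f mf f0; rewrite -(h1 f)// -(h2 (f \o phi))//; first exact: measurableT_comp.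
by move=> x; exact: f0.
Qed.

Lemma measurable_fun3 (a b c : R3 R -> R) : measurable_fun setT a ->
  measurable_fun setT b -> measurable_fun setT c ->
  measurable_fun setT (fun x => (a x, b x, c x) : R3 R).
Proof.
by move=> ma mb mc; apply: measurable_fun_pair => //; exact: measurable_fun_pair.
Qed.

Lemma meas_x1 : measurable_fun setT (fun x : R3 R => x.1.1).
Proof. exact: (measurableT_comp (@measurable_fst _ _ R R) measurable_fst). Qed.

Lemma meas_x2 : measurable_fun setT (fun x : R3 R => x.1.2).
Proof. exact: (measurableT_comp (@measurable_snd _ _ R R) measurable_fst). Qed.

Lemma meas_x3 : measurable_fun setT (fun x : R3 R => x.2).
Proof. exact: measurable_snd. Qed.

Lemma preserves3_shear12 (a : R) : preserves3 (fun x : R3 R => (x.1.1 + a * x.1.2, x.1.2, x.2)).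
Proof.
set phi := (fun x => _).
have mphi : measurable_fun setT phi.
  apply: measurable_fun3; [|exact: meas_x2|exact: meas_x3].
  by apply: measurable_funD; [exact: meas_x1|apply: measurable_funM => //; exact: meas_x2].
split=> // f mf f0.
have mf' : measurable_fun setT (f \o phi) by exact: (measurableT_comp mf mphi).
rewrite (leb3_zyx mf f0) [LHS](leb3_zyx mf' (fun x => f0 (phi x))).
apply: eq_integral => z _; apply: eq_integral => y _ /=.
apply: (@ge0_integral_translation _ (a * y) (fun x : R => f (x, y, z))) => //.
by apply: measurableT_comp => //; apply: measurable_fun_pair => //; exact: measurable_fun_pair.
Qed.

Lemma preserves3_shear21 (a : R) : preserves3 (fun x : R3 R => (x.1.1, x.1.2 + a * x.1.1, x.2)).
Proof.
set phi := (fun x => _).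
have mphi : measurable_fun setT phi.
  apply: measurable_fun3; [exact: meas_x1| |exact: meas_x3].
  by apply: measurable_funD; [exact: meas_x2|apply: measurable_funM => //; exact: meas_x1].
split=> // f mf f0.
have mf' : measurable_fun setT (f \o phi) by exact: (measurableT_comp mf mphi).
rewrite (leb3_zxy mf f0) [LHS](leb3_zxy mf' (fun x => f0 (phi x))).
apply: eq_integral => z _; apply: eq_integral => x _ /=.
apply: (@ge0_integral_translation _ (a * x) (fun y : R => f (x, y, z))) => //.
by apply: measurableT_comp => //; apply: measurable_fun_pair => //; exact: measurable_fun_pair.
Qed.

Lemma preserves3_shear13 (a : R) : preserves3 (fun x : R3 R => (x.1.1 + a * x.2, x.1.2, x.2)).
Proof.
set phi := (fun x => _).
have mphi : measurable_fun setT phi.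
  apply: measurable_fun3; [|exact: meas_x2|exact: meas_x3].
  by apply: measurable_funD; [exact: meas_x1|apply: measurable_funM => //; exact: meas_x3].
split=> // f mf f0.
have mf' : measurable_fun setT (f \o phi) by exact: (measurableT_comp mf mphi).
rewrite (leb3_zyx mf f0) [LHS](leb3_zyx mf' (fun x => f0 (phi x))).
apply: eq_integral => z _; apply: eq_integral => y _ /=.
apply: (@ge0_integral_translation _ (a * z) (fun x : R => f (x, y, z))) => //.
by apply: measurableT_comp => //; apply: measurable_fun_pair => //; exact: measurable_fun_pair.
Qed.

Lemma preserves3_shear31 (a : R) : preserves3 (fun x : R3 R => (x.1.1, x.1.2, x.2 + a * x.1.1)).
Proof.
set phi := (fun x => _).
have mphi : measurable_fun setT phi.
  apply: measurable_fun3; [exact: meas_x1|exact: meas_x2|].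
  by apply: measurable_funD; [exact: meas_x3|apply: measurable_funM => //; exact: meas_x1].
split=> // f mf f0.
have mf' : measurable_fun setT (f \o phi) by exact: (measurableT_comp mf mphi).
rewrite (leb3_xyz mf f0) [LHS](leb3_xyz mf' (fun x => f0 (phi x))).
apply: eq_integral => -[x y] _ /=.
apply: (@ge0_integral_translation _ (a * x) (fun z : R => f (x, y, z))) => //.
exact: (measurableT_comp mf (pair1_measurable (x, y))).
Qed.

Lemma preserves3_reflect3 : preserves3 (fun x : R3 R => (x.1.1, x.1.2, - x.2)).
Proof.
set phi := (fun x => _).
have mphi : measurable_fun setT phi.
  apply: measurable_fun3; [exact: meas_x1|exact: meas_x2|].
  by apply: measurableT_comp => //; exact: meas_x3.
split=> // f mf f0.
have mf' : measurable_fun setT (f \o phi) by exact: (measurableT_comp mf mphi).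
rewrite (leb3_xyz mf f0) [LHS](leb3_xyz mf' (fun x => f0 (phi x))).
apply: eq_integral => -[x y] _ /=.
rewrite -(@ge0_integral_reflection _ 0 (fun z : R => f (x, y, z)))//.
  by apply: eq_integral => z _; rewrite sub0r.
exact: (measurableT_comp mf (pair1_measurable (x, y))).
Qed.

(** The substitution y -> xi - y of convolutions, performed one coordinate at a time. *)
Lemma preserves3_reflection xi :
  preserves3 (fun x : R3 R => (xi.1.1 - x.1.1, xi.1.2 - x.1.2, xi.2 - x.2)).
Proof.
set phi := (fun x => _).
have mphi : measurable_fun setT phi.
  by apply: measurable_fun3; apply: measurable_funB => //; [exact: meas_x1|exact: meas_x2].
split=> // f mf f0.
have mf' : measurable_fun setT (f \o phi) by exact: (measurableT_comp mf mphi).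
rewrite (leb3_zyx mf f0) [LHS](leb3_zyx mf' (fun x => f0 (phi x))).
rewrite -(@ge0_integral_reflection _ xi.2 (fun z : R => \int[leb]_y \int[leb]_x f (x, y, z))%E); last 2 first.
- apply: (meas_eparam2 (T2 := R) leb (f := fun p : R * R => \int[leb]_x f (x, p.1, p.2))%E).
    apply: (meas_eparam2 (T2 := (R * R)%type) leb (f := fun p : R * (R * R) => f (p.1, p.2.1, p.2.2))) => //.
    apply: measurableT_comp => //; apply: measurable_fun_pair; last first.
      exact: (measurableT_comp (@measurable_snd _ _ R R) measurable_snd).
    apply: measurable_fun_pair; first exact: measurable_fst.
    exact: (measurableT_comp (@measurable_fst _ _ R R) measurable_snd).
  by move=> z; exact: integral_ge0.
- by move=> z; apply: integral_ge0 => y _; exact: integral_ge0.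
apply: eq_integral => z _.
rewrite -(@ge0_integral_reflection _ xi.1.2 (fun y : R => \int[leb]_x f (x, y, (xi.2 - z)%R))%E); last 2 first.
- apply: (meas_eparam2 (T2 := R) leb (f := fun p : R * R => f (p.1, p.2, xi.2 - z))) => //.
  apply: (measurableT_comp mf); apply: measurable_fun_pair => //.
  by apply: measurable_fun_pair; [exact: measurable_fst|exact: measurable_snd].
- by move=> y; exact: integral_ge0.
apply: eq_integral => y _.
rewrite -(@ge0_integral_reflection _ xi.1.1 (fun x : R => f (x, xi.1.2 - y, xi.2 - z)))//.
by apply: measurableT_comp => //; apply: measurable_fun_pair => //; exact: measurable_fun_pair.
Qed.

(* A plane rotation by a nonzero angle is a product of three shears. *)
Lemma preserves3_rot12 (c s : R) : c ^+ 2 + s ^+ 2 = 1 -> s != 0 ->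
  preserves3 (fun x : R3 R => (c * x.1.1 - s * x.1.2, s * x.1.1 + c * x.1.2, x.2)).
Proof.
move=> cs s0.
have := preserves3_comp (preserves3_shear12 ((c - 1) / s))
  (preserves3_comp (preserves3_shear21 s) (preserves3_shear12 ((c - 1) / s))).
congr preserves3; apply/funext => -[[x y] z] /=; congr (_, _, _).
- apply: (mulfI s0); transitivity (s * c * x + (c ^+ 2 - 1) * y); first by field.
  by rewrite -cs; ring.
- by field.
Qed.

Lemma preserves3_rot13 (c s : R) : c ^+ 2 + s ^+ 2 = 1 -> s != 0 ->
  preserves3 (fun x : R3 R => (c * x.1.1 - s * x.2, x.1.2, s * x.1.1 + c * x.2)).
Proof.
move=> cs s0.
have := preserves3_comp (preserves3_shear13 ((c - 1) / s))
  (preserves3_comp (preserves3_shear31 s) (preserves3_shear13 ((c - 1) / s))).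
congr preserves3; apply/funext => -[[x y] z] /=; congr (_, _, _).
- apply: (mulfI s0); transitivity (s * c * x + (c ^+ 2 - 1) * z); first by field.
  by rewrite -cs; ring.
- by field.
Qed.

Lemma rotate12 (a b : R) : exists (rho : R3 R -> R3 R) (r : R),
  [/\ preserves3 rho, forall x, dot3 (rho x) (rho x) = dot3 x x,
      r ^+ 2 = a ^+ 2 + b ^+ 2
    & forall x d, dot3 (rho x) (a, b, d) = r * x.1.1 + d * x.2].
Proof.
(* The factorization into shears divides by the sine [b / r], so this case is settled separately by
   the identity. *)
have [->|b0] := eqVneq b 0.
  exists id, a; split => //; first by rewrite expr0n/= addr0.
  by move=> x d; rewrite /dot3/=; ring.
pose r := Num.sqrt (a ^+ 2 + b ^+ 2).
have ab0 : 0 < a ^+ 2 + b ^+ 2 by rewrite ltr_wpDl ?sqr_ge0// exprn_even_gt0.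
have r2 : r ^+ 2 = a ^+ 2 + b ^+ 2 by rewrite sqr_sqrtr// ltW.
have r0 : r != 0 by rewrite gt_eqF// sqrtr_gt0.
have cs : (a / r) ^+ 2 + (b / r) ^+ 2 = 1.
  by rewrite !expr_div_n -mulrDl -r2 divff// expf_neq0.
have s0 : b / r != 0 by rewrite mulf_neq0// invr_neq0.
exists (fun x => (a / r * x.1.1 - b / r * x.1.2, b / r * x.1.1 + a / r * x.1.2, x.2)), r.
split => //; first exact: preserves3_rot12.
  move=> [[x y] z]; rewrite /dot3/=.
  transitivity (((a / r) ^+ 2 + (b / r) ^+ 2) * (x ^+ 2 + y ^+ 2) + z ^+ 2).
    by ring.
  by rewrite cs; ring.
move=> [[x y] z] d; rewrite /dot3/=; apply: (mulfI r0).
transitivity ((a ^+ 2 + b ^+ 2) * x + r * d * z); first by field.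
by rewrite -r2; ring.
Qed.

Lemma rotate13 (r d : R) : exists rho : R3 R -> R3 R,
  [/\ preserves3 rho, forall x, dot3 (rho x) (rho x) = dot3 x x
    & forall x, r * (rho x).1.1 + d * (rho x).2 = Num.sqrt (r ^+ 2 + d ^+ 2) * x.2].
Proof.
have [->|r0] := eqVneq r 0.
  rewrite expr0n/= add0r sqrtr_sqr; have [d0|d0] := leP 0 d.
    by exists id; split => // x; rewrite mul0r add0r ger0_norm.
  (* With zero sine and [d < 0] a reflection is used in place of a rotation; only the invariance of
     the measure and of the squared length matters. *)
  exists (fun x => (x.1.1, x.1.2, - x.2)); split => //.
  - exact: preserves3_reflect3.
  - by move=> x; rewrite /dot3/= mulrNN.
  - by move=> x /=; rewrite ltr0_norm// mul0r add0r mulrN mulNr.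
pose m := Num.sqrt (r ^+ 2 + d ^+ 2).
have rd0 : 0 < r ^+ 2 + d ^+ 2 by rewrite ltr_pwDl ?sqr_ge0// exprn_even_gt0.
have m2 : m ^+ 2 = r ^+ 2 + d ^+ 2 by rewrite sqr_sqrtr// ltW.
have m0 : m != 0 by rewrite gt_eqF// sqrtr_gt0.
have cs : (d / m) ^+ 2 + (- r / m) ^+ 2 = 1.
  by rewrite !expr_div_n sqrrN -mulrDl addrC -m2 divff// expf_neq0.
have s0 : - r / m != 0 by rewrite mulf_neq0 ?oppr_eq0// invr_neq0.
exists (fun x => (d / m * x.1.1 - (- r / m) * x.2, x.1.2, (- r / m) * x.1.1 + d / m * x.2)).
split => //; first exact: preserves3_rot13.
  move=> [[x y] z]; rewrite /dot3/=.
  transitivity (((d / m) ^+ 2 + (- r / m) ^+ 2) * (x ^+ 2 + z ^+ 2) + y ^+ 2).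
    by ring.
  by rewrite cs; ring.
move=> [[x y] z] /=; apply: (mulfI m0).
transitivity ((r ^+ 2 + d ^+ 2) * z); first by field.
by rewrite -/m -m2; ring.
Qed.

(** One rotation in the first two coordinates, then one in the first and third, reduce the scalar
    product with [xi] to the third coordinate. *)
Lemma rotate_to_axis xi : exists rho : R3 R -> R3 R,
  [/\ preserves3 rho, forall x, dot3 (rho x) (rho x) = dot3 x x
    & forall x, dot3 (rho x) xi = enorm3 xi * x.2].
Proof.
case: xi => [[a b] d].
have [rho1 [r [p1 q1 r2 d1]]] := rotate12 a b.
have [rho2 [p2 q2 d2]] := rotate13 r d.
exists (rho1 \o rho2); split; first exact: preserves3_comp.
  by move=> x /=; rewrite q1 q2.
by move=> x /=; rewrite d1 d2 r2.
Qed.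

End Isometries.

Ltac mreal := repeat first
  [ assumption | exact: measurable_cst | exact: measurable_id
  | exact: measurable_fst | exact: measurable_snd
  | apply: measurable_funX | apply: measurable_funD | apply: measurable_funN
  | apply: measurable_funM | apply: measurable_fun_pair ].

Lemma ge0_integralZlT d (T : measurableType d) (R : realType)
    (mu : {measure set T -> \bar R}) (c : R) (f : T -> \bar R) : 0 <= c ->
  measurable_fun setT f -> (forall x, 0 <= f x)%E ->
  (\int[mu]_x (c%:E * f x) = c%:E * \int[mu]_x f x)%E.
Proof. by move=> c0 mf f0; rewrite ge0_integralZl ?lee_fin. Qed.

Lemma pushforward_measure_ex d1 d2 (X : measurableType d1) (Y : measurableType d2)
    (R : realType) (mu : {measure set X -> \bar R}) (phi : X -> Y) :
  measurable_fun setT phi ->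
  exists m : {measure set Y -> \bar R}, (forall A, m A = mu (phi @^-1` A)) /\
    forall f : Y -> \bar R, measurable_fun setT f -> (forall y, 0 <= f y)%E ->
      (\int[m]_y f y = \int[mu]_x f (phi x))%E.
Proof.
move=> mphi; unshelve eexists (pushforward mu phi); first exact: mphi.
by split => // f mf f0; rewrite ge0_integral_pushforward.
Qed.

(** * Bipolar coordinates *)

Section Disc.
Context {R : realType}.
Local Notation leb := (@lebesgue_measure R).

Definition nsq2 (p : R * R) : R := p.1 ^+ 2 + p.2 ^+ 2.

Lemma measurable_nsq2 : measurable_fun setT nsq2.
Proof. by rewrite /nsq2; mreal. Qed.

Definition disc (s : R) : set (R * R) := [set p | nsq2 p <= s].

Lemma measurable_disc s : measurable (disc s).
Proof.
rewrite (_ : disc s = nsq2 @^-1` `]-oo, s]); last first.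
  by apply/seteqP; split => p /=; rewrite in_itv.
rewrite -[X in measurable X]setTI; exact: measurable_nsq2.
Qed.

Lemma ge0_integral_scale2 (r : R) (f : R * R -> \bar R) : 0 < r ->
  measurable_fun setT f -> (forall x, 0 <= f x)%E ->
  (\int[@leb2 R]_p f (r * p.1, r * p.2)%R = ((r ^+ 2)^-1)%:E * \int[@leb2 R]_p f p)%E.
Proof.
move=> r0 mf f0; rewrite /leb2 !fubini_tonelli1//; last first.
  by apply: (measurableT_comp mf); mreal.
rewrite /fubini_F/=.
have r_neq0 : r != 0 by rewrite gt_eqF.
have scale1 (g : R -> \bar R) : measurable_fun setT g -> (forall x, 0 <= g x)%E ->
    (\int[leb]_x g (r * x)%R = (r^-1)%:E * \int[leb]_x g x)%E.
  move=> mg g0; have := @ge0_integral_affine _ r 0 g r_neq0 mg g0.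
  by under eq_integral do rewrite addr0; rewrite gtr0_norm.
under eq_integral => x _.
  rewrite (scale1 (fun y => f (r * x, y)))//; last first.
    exact: (measurableT_comp mf (pair1_measurable (r * x : R))).
  over.
have mF : measurable_fun setT (fun x => \int[leb]_y f (x, y))%E by exact: meas_eparam1.
have F0 x : (0 <= \int[leb]_y f (x, y))%E by exact: integral_ge0.
rewrite ge0_integralZl//; last 2 first.
- apply: (measurableT_comp mF); mreal.
- by rewrite lee_fin invr_ge0 ltW.
rewrite (scale1 (fun x => \int[leb]_y f (x, y)))%E// muleA -EFinM.
by congr (_%:E * _)%E; rewrite expr2 invfM.
Qed.

(* The area of the unit disc, whose value plays no role. *)
Definition disc_area : R := fine (@leb2 R (disc 1)).

Lemma leb2_rect (a b c d : R) : a <= b -> c <= d ->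
  @leb2 R (`[a, b] `*` `[c, d]) = ((b - a) * (d - c))%:E.
Proof.
move=> ab cd; rewrite /leb2 product_measure1E//= !lebesgue_measure_itv/= !lte_fin.
move: ab; rewrite le_eqVlt => /predU1P[->|ab]; first by rewrite ltxx subrr mul0r mul0e.
rewrite ab; move: cd; rewrite le_eqVlt => /predU1P[->|cd].
  by rewrite ltxx subrr mulr0 mule0.
by rewrite cd.
Qed.

Lemma disc1_fin : (@leb2 R (disc 1) <= 4%:E)%E.
Proof.
apply: (@le_trans _ _ (@leb2 R (`[-1, 1] `*` `[-1, 1]))).
  apply: le_measure; rewrite ?inE; [exact: measurable_disc|exact: measurableX|].
  move=> [x y] /=; rewrite /disc /nsq2/= !in_itv/= -!ler_norml => h.
  have x2 : `|x| ^+ 2 <= 1.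
    by rewrite -normrX ger0_norm ?sqr_ge0// (le_trans _ h)// lerDl sqr_ge0.
  have y2 : `|y| ^+ 2 <= 1.
    by rewrite -normrX ger0_norm ?sqr_ge0// (le_trans _ h)// lerDr sqr_ge0.
  by rewrite !expr_le1 in x2 y2.
rewrite leb2_rect ?lee_fin; lra.
Qed.

Lemma disc_areaE : @leb2 R (disc 1) = disc_area%:E.
Proof.
by rewrite fineK// ge0_fin_numE// (le_lt_trans disc1_fin)// ltry.
Qed.

Lemma disc_area_gt0 : 0 < disc_area.
Proof.
rewrite -lte_fin -disc_areaE.
apply: (@lt_le_trans _ _ (@leb2 R (`[0, 2^-1] `*` `[0, 2^-1]))).
  by rewrite leb2_rect ?invr_ge0// lte_fin; lra.
apply: le_measure; rewrite ?inE; [exact: measurableX|exact: measurable_disc|].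
move=> [x y] /=; rewrite /disc /nsq2/= !in_itv/= => -[/andP[x0 x1] /andP[y0 y1]].
nra.
Qed.

Lemma leb2_disc s : 0 <= s -> @leb2 R (disc s) = (disc_area * s)%:E.
Proof.
have discI (t : R) : (\int[@leb2 R]_p (\1_(disc t) p)%:E = @leb2 R (disc t))%E.
  have := integral_indic (@leb2 R) measurableT (measurable_disc t).
  by rewrite setIT.
have pos (t : R) : 0 < t -> @leb2 R (disc t) = (disc_area * t)%:E.
  move=> t0; pose r := Num.sqrt t.
  have r0 : 0 < r by rewrite sqrtr_gt0.
  have r2 : r ^+ 2 = t by rewrite sqr_sqrtr// ltW.
  have mi : measurable_fun setT (fun p => (\1_(disc t) p)%:E : \bar R).
    by apply/measurable_EFinP; apply: measurable_indic; exact: measurable_disc.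
  have i0 p : (0 <= (\1_(disc t) p)%:E :> \bar R)%E by rewrite lee_fin.
  have := ge0_integral_scale2 r0 mi i0.
  rewrite discI r2 => h.
  have : (\int[@leb2 R]_p (\1_(disc t) (r * p.1, r * p.2)%R)%:E = disc_area%:E)%E.
    rewrite -disc_areaE -discI.
    apply: eq_integral => p _; congr EFin; rewrite !indicE; congr (_ %:R); congr nat_of_bool.
    have nr : nsq2 (r * p.1, r * p.2) = t * nsq2 p.
      by rewrite /nsq2/= !exprMn r2 mulrDr.
    apply/idP/idP; rewrite !inE /disc/= nr.
      by rewrite -[X in _ <= X -> _]mulr1 ler_pM2l.
    by move=> h1; rewrite -[X in _ <= X]mulr1 ler_pM2l.
  rewrite h => {}h.
  rewrite -[LHS]mul1e -(@mulfV _ t) ?gt_eqF// EFinM -muleA h -EFinM.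
  by rewrite mulrC.
rewrite le_eqVlt => /predU1P[<-|]; last exact: pos.
rewrite mulr0; apply/eqP; rewrite eq_le measure_ge0 andbT.
apply/lee_addgt0Pr => e e0; rewrite add0e.
have e1 : 0 < e / disc_area by rewrite divr_gt0// disc_area_gt0.
rewrite (_ : e%:E = @leb2 R (disc (e / disc_area))); last first.
  by rewrite pos//; congr EFin; rewrite mulrC divfK// gt_eqF// disc_area_gt0.
apply: le_measure; rewrite ?inE; [exact: measurable_disc|exact: measurable_disc|].
by move=> p; rewrite /disc/= => /le_trans -> //; exact: ltW.
Qed.

Lemma leb_ocitv (u v : R) : u <= v -> leb `]u, v] = (v - u)%:E.
Proof.
rewrite lebesgue_measure_itv/= lte_fin le_eqVlt => /predU1P[->|->//].
by rewrite ltxx subrr.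
Qed.

(** Polar coordinates with the angle integrated out: in the variable v = |p|^2 the area is a
    constant multiple of dv. *)
Lemma ge0_integral_nsq2 (f : R -> \bar R) :
  measurable_fun setT f -> (forall v, 0 <= f v)%E ->
  (\int[@leb2 R]_p f (nsq2 p) =
   disc_area%:E * \int[leb]_(v in `]0%R, +oo[) f v)%E.
Proof.
move=> mf f0.
have [m [mE mint]] := pushforward_measure_ex (Y := measurableTypeR R) (@leb2 R) measurable_nsq2.
pose D : set R := `]0, +oo[%classic.
have mD : measurable D by exact: measurable_itv.
have DC : ~` D = `]-oo, 0]%classic.
  apply/seteqP; split => x; rewrite /D/= !in_itv/= andbT; last by rewrite ltNge => ->.
  by move/negP; rewrite -leNgt.
have mDC : measurable (~` D) by exact: measurableC.
have om0 : 0 <= disc_area by rewrite ltW// disc_area_gt0.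
have omV0 : 0 <= disc_area^-1 by rewrite invr_ge0.
have om_neq0 : disc_area != 0 by rewrite gt_eqF// disc_area_gt0.
have discE (s : R) : m `]-oo, s]%classic = (disc_area * Num.max s 0)%:E.
  rewrite mE (_ : nsq2 @^-1` _ = disc s); last first.
    by apply/seteqP; split => p /=; rewrite in_itv.
  have [s0|s0] := leP 0 s; first by rewrite [LHS]leb2_disc.
  rewrite mulr0 (_ : disc s = set0) ?measure0//.
  apply/seteqP; split => // p; rewrite /disc /nsq2/= => h.
  have := le_lt_trans h s0; rewrite ltNge addr_ge0 ?sqr_ge0//.
have mDle : m (~` D) = 0.
  by rewrite DC discE maxxx mulr0.
have itvE (u v : R) : u <= v -> m `]u, v]%classic = (disc_area * (Num.max v 0 - Num.max u 0))%:E.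
  move=> uv; rewrite (_ : `]u, v]%classic = `]-oo, v] `\` `]-oo, u]); last first.
    apply/seteqP; split => x /=; rewrite !in_itv/=.
      by move=> /andP[ux ->]; split => //; apply/negP; rewrite -ltNge.
    by move=> [-> /negP]; rewrite -ltNge => ->.
  rewrite measureD//=; last by rewrite discE ltry.
  rewrite (_ : `]-oo, v] `&` `]-oo, u] = `]-oo, u]%classic); last first.
    apply/seteqP; split => x /=; rewrite !in_itv/=; first by move=> [].
    by move=> xu; split => //; exact: le_trans uv.
  by rewrite !discE -EFinB -mulrBr.
(* The image measure lives on the positive half-line only. Completing its normalization by Lebesgue
   measure on the other half-line gives a measure on the whole line, to which uniqueness of Lebesgue
   measure applies. *)
pose n := measure_add (mscale (NngNum omV0) (mrestr m mD)) (mrestr leb mDC).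
have nE A : n A = ((disc_area^-1)%:E * m (A `&` D) + leb (A `&` ~` D))%E.
  by rewrite /n measure_addE.
have leb_n A : measurable A -> leb A = n A.
  apply: lebesgue_measure_unique => // _ [[u v]] _ <-.
  rewrite -[RHS]/(n _) nE /= DC /D.
  have [uv|vu] := leP u v; last first.
    by rewrite set_itv_ge ?bnd_simp -?leNgt ?(ltW vu)// !set0I !measure0 mule0 adde0.
  rewrite (_ : `]u, v] `&` `]0, +oo[ = `]Num.max u 0, Num.max v 0]%classic); last first.
    apply/seteqP; split => x /=; rewrite !in_itv/= andbT gt_max le_max.
      by move=> [/andP[-> ->] ->].
    move=> /andP[/andP[-> x0] /orP[->//|]]; by rewrite leNgt x0.
  rewrite (_ : `]u, v] `&` `]-oo, 0] = `]Num.min u 0, Num.min v 0]%classic); last first.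
    apply/seteqP; split => x /=; rewrite !in_itv/= gt_min le_min.
      by move=> [/andP[-> ->] ->].
    move=> /andP[/orP[->|x0] /andP[-> xle]//]; by rewrite ltNge xle in x0.
  have M : Num.max u 0 <= Num.max v 0 by rewrite ge_max !le_max uv lexx !orbT.
  have M' : Num.min u 0 <= Num.min v 0 by rewrite le_min !ge_min uv lexx !orbT.
  rewrite itvE// !leb_ocitv// -EFinM mulKf// -EFinD -!maxA maxxx; congr EFin.
  have mm (x : R) : x = Num.max x 0 + Num.min x 0 by rewrite addr_max_min addr0.
  by rewrite [in LHS](mm u) [in LHS](mm v); ring.
rewrite -mint//.
have -> : (\int[m]_y f y = \int[m]_(y in D) f y)%E.
  have := @ge0_negligible_integral _ (measurableTypeR R) R m setT (~` D) f
    mDC measurableT mf (fun x _ => f0 x) mDle.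
  by rewrite setTD setCK.
have om : (forall x, D x -> 0 <= f x)%E by [].
rewrite -[RHS](ge0_integral_mscale leb mD (NngNum om0))//; last exact: measurable_funS mf.
apply: eq_measure_integral => A mA AD.
suff : m A = (disc_area%:E * leb A)%E by [].
rewrite (leb_n A mA).
rewrite nE (setIidl AD) (_ : A `&` ~` D = set0) ?measure0 ?adde0; last first.
  by apply/disjoints_subset; rewrite setCK.
by rewrite muleA -EFinM mulfV// mul1e.
Qed.

End Disc.

Section Bipolar.
Context {R : realType}.
Local Notation leb := (@lebesgue_measure R).
Implicit Types xi : R3 R.

Lemma measurable_dot3 d (T : measurableType d) (f g : T -> R3 R) :
  measurable_fun setT f -> measurable_fun setT g ->
  measurable_fun setT (fun x => dot3 (f x) (g x)).
Proof.
move=> mf mg; have m1 (h : T -> R3 R) : measurable_fun setT h -> measurable_fun setT (fun x : T => (h x).1.1 : R).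
  by move=> mh; exact: (measurableT_comp meas_x1 mh).
have m2 (h : T -> R3 R) : measurable_fun setT h -> measurable_fun setT (fun x : T => (h x).1.2 : R).
  by move=> mh; exact: (measurableT_comp meas_x2 mh).
have m3 (h : T -> R3 R) : measurable_fun setT h -> measurable_fun setT (fun x : T => (h x).2 : R).
  by move=> mh; exact: (measurableT_comp meas_x3 mh).
by rewrite /dot3; mreal; auto.
Qed.

Lemma enorm3_sq xi : enorm3 xi ^+ 2 = dot3 xi xi :> R.
Proof. by rewrite /enorm3 sqr_sqrtr// /dot3 !addr_ge0// -expr2 sqr_ge0. Qed.

Definition sub3 (x y : R3 R) : R3 R := (x.1.1 - y.1.1, x.1.2 - y.1.2, x.2 - y.2).

Lemma dot3_sub3 (x y : R3 R) :
  dot3 (sub3 x y) (sub3 x y) = dot3 x x - 2 * dot3 y x + dot3 y y :> R.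
Proof. by rewrite /dot3/=; ring. Qed.

(* The squares of three lengths q, p, k^2 are those of the sides of a
   nondegenerate triangle. *)
Definition triangle (k q p : R) : bool := (q + k ^+ 2 - p) ^+ 2 < 4 * k ^+ 2 * q.

Lemma triangle_sym k q p : triangle k q p = triangle k p q.
Proof.
by rewrite /triangle -subr_gt0 -[RHS]subr_gt0; congr (0 < _); ring.
Qed.

Lemma measurable_if0 d (T : measurableType d) (b : T -> bool) (f : T -> \bar R) :
  measurable_fun setT b -> measurable_fun setT f ->
  measurable_fun setT (fun x => if b x then f x else 0%E).
Proof. by move=> mb mf; apply: measurable_fun_ifT. Qed.

(* Typed bound variables: [eq_integral] would give them the generated
   sigma-algebra as their type. *)
Lemma eq_integral_leb (f g : R -> \bar R) : (forall x : R, f x = g x) ->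
  (\int[leb]_x f x = \int[leb]_x g x)%E.
Proof. by move=> fg; apply: eq_integral => x _. Qed.

Lemma eq_integral_leb2 (f g : R * R -> \bar R) : (forall x : R * R, f x = g x) ->
  (\int[@leb2 R]_x f x = \int[@leb2 R]_x g x)%E.
Proof. by move=> fg; apply: eq_integral => x _. Qed.

(** The plane at height [z] cuts the open ball of squared radius [q]. *)
Definition chord (q z : R) : bool := z ^+ 2 < q.

(** At a fixed height z, planar polar coordinates turn the area into a multiple of dq with q =
    |x|^2. The constant density in (q, z) is Archimedes' theorem on spherical zones. *)
Lemma ge0_integral_axis (F : R * R -> \bar R) :
  measurable_fun setT F -> (forall z, 0 <= F z)%E ->
  (\int[@leb3 R]_x F (dot3 x x, x.2) =
   disc_area%:E * \int[leb]_q \int[leb]_z (if chord q z then F (q, z) else 0))%E.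
Proof.
move=> mF F0.
have mF3 : measurable_fun setT (fun x : R3 R => F (dot3 x x, x.2)).
  apply: (measurableT_comp mF); apply: measurable_fun_pair; last exact: meas_x3.
  exact: measurable_dot3.
have mif : measurable_fun setT (fun p : R * R => if chord p.2 p.1 then F (p.2, p.1) else 0%E).
  apply: measurable_if0; first by rewrite /chord; apply: measurable_fun_ltr; mreal.
  by apply: (measurableT_comp mF); mreal.
have if0 p : (0 <= if chord p.2 p.1 then F (p.2, p.1) else 0)%E by case: ifP.
rewrite /leb3 (fubini_tonelli2 (m1 := @leb2 R) (m2 := leb))//.
transitivity (\int[leb]_z (disc_area%:E * \int[leb]_q (if chord q z then F (q, z) else 0)))%E.
  apply: eq_integral_leb => z; rewrite /fubini_G/=.
  have mFz : measurable_fun setT (fun v : R => F (v + z ^+ 2, z)).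
    by apply: (measurableT_comp mF); mreal.
  transitivity (\int[@leb2 R]_p F ((nsq2 p + z ^+ 2)%R, z))%E.
    by apply: eq_integral_leb2 => p; congr (F (_, _)); rewrite /dot3 /nsq2/=; ring.
  rewrite (ge0_integral_nsq2 mFz)//; congr (_ * _)%E.
  rewrite -(@ge0_integral_translation _ (z ^+ 2) (fun q : R => if chord q z then F (q, z) else 0)%E).
  - rewrite [LHS]integral_mkcond; apply: eq_integral_leb => v.
    rewrite patchE mem_setE in_itv/= andbT /chord ltrDr; case: ifP => //.
  - apply: measurable_if0; first by rewrite /chord; apply: measurable_fun_ltr; mreal.
    by apply: (measurableT_comp mF); mreal.
  - by move=> q; case: ifP.
have mI : measurable_fun setT (fun z : R => \int[leb]_q (if chord q z then F (q, z) else 0))%E.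
  exact: (meas_eparam1 (T1 := R) leb mif).
have I0 (z : R) : (0 <= \int[leb]_q (if chord q z then F (q, z) else 0))%E.
  by apply: integral_ge0 => q _; case: ifP.
rewrite (ge0_integralZlT leb (ltW (@disc_area_gt0 R)) mI I0); congr (_ * _)%E.
exact: (fubini_tonelli (m1 := leb) (m2 := leb)
  (fun p : R * R => if chord p.2 p.1 then F (p.2, p.1) else 0)%E mif if0).
Qed.

Lemma measurable_sub3 xi : measurable_fun setT (sub3 xi).
Proof. by have [] := preserves3_reflection xi. Qed.

(** Once [xi] is rotated to the third axis, p = k^2 - 2kz + q is affine in the height z; the
    substitution costs 1/(2k) and turns the condition [chord] into [triangle]. *)
Lemma ge0_integral_bipolar xi (G : R * R -> \bar R) : 0 < enorm3 xi :> R ->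
  measurable_fun setT G -> (forall z, 0 <= G z)%E ->
  (\int[@leb3 R]_y G (dot3 y y, dot3 (sub3 xi y) (sub3 xi y)) =
   (disc_area / (2 * enorm3 xi))%:E *
   \int[leb]_q \int[leb]_p (if triangle (enorm3 xi) q p then G (q, p) else 0))%E.
Proof.
set k := enorm3 xi => k0 mG G0.
have [rho [[mrho irho] qrho drho]] := rotate_to_axis xi.
have mG3 : measurable_fun setT (fun y : R3 R => G (dot3 y y, dot3 (sub3 xi y) (sub3 xi y))).
  apply: (measurableT_comp mG); apply: measurable_fun_pair; first exact: measurable_dot3.
  by apply: measurable_dot3; exact: measurable_sub3.
rewrite -[LHS](irho _ mG3 (fun y => G0 _)).
pose F (z : R * R) := G (z.1, k ^+ 2 - 2 * k * z.2 + z.1).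
have mF : measurable_fun setT F by apply: (measurableT_comp mG); mreal.
transitivity (\int[@leb3 R]_y F (dot3 y y, y.2))%E.
  apply: eq_integral => y _; rewrite /F/= dot3_sub3 qrho drho -(enorm3_sq xi).
  by rewrite -/k !mulrA.
rewrite (ge0_integral_axis mF (fun z => G0 _)).
rewrite EFinM -muleA; congr (_ * _)%E.
have mI : measurable_fun setT (fun q : R => \int[leb]_p (if triangle k q p then G (q, p) else 0))%E.
  apply: (meas_eparam1 (T1 := R) leb (f := fun z : R * R => if triangle k z.1 z.2 then G (z.1, z.2) else 0%E)).
    apply: measurable_if0; last by apply: (measurableT_comp mG); mreal.
    by rewrite /triangle; apply: measurable_fun_ltr; mreal.
  by move=> z; case: ifP.
have I0 (q : R) : (0 <= \int[leb]_p (if triangle k q p then G (q, p) else 0))%E.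
  by apply: integral_ge0 => p _; case: ifP.
have kV0 : 0 <= (2 * k)^-1 by rewrite invr_ge0 mulr_ge0// ltW.
rewrite -(ge0_integralZlT leb kV0 mI I0).
apply: eq_integral_leb => q.
have k2 : - (2 * k) != 0 by rewrite oppr_eq0 mulf_neq0// gt_eqF.
have := @ge0_integral_affine _ (- (2 * k)) (q + k ^+ 2)
  (fun p : R => if triangle k q p then G (q, p) else 0)%E k2.
rewrite normrN gtr0_norm ?mulr_gt0// => <-.
- apply: eq_integral_leb => z; rewrite /F/=.
  have -> : triangle k q (- (2 * k) * z + (q + k ^+ 2)) = chord q z.
    rewrite /triangle /chord (_ : (_ - _) ^+ 2 = 4 * k ^+ 2 * z ^+ 2); last by ring.
    by rewrite ltr_pM2l// mulr_gt0// exprn_gt0.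
  by case: ifP => // _; congr (G (_, _)); ring.
- apply: measurable_if0; last by apply: (measurableT_comp mG); mreal.
  by rewrite /triangle; apply: measurable_fun_ltr; mreal.
- by move=> p; case: ifP.
Qed.

(** If [r ^+ 2 <= q], all heights in ]0, r[ satisfy [chord q]. A lower bound is enough: it serves to
    control one-dimensional masses by norms in space. *)
Lemma ge0_integral_radial_ge (A : R -> \bar R) (r : R) : 0 < r ->
  measurable_fun setT A -> (forall q, 0 <= A q)%E ->
  ((disc_area * r)%:E * \int[leb]_q (if (r ^+ 2 <= q)%R then A q else 0) <=
   \int[@leb3 R]_x A (dot3 x x))%E.
Proof.
move=> r0 mA A0.
rewrite (ge0_integral_axis (F := fun z => A z.1))//; last by apply: (measurableT_comp mA).
rewrite EFinM -muleA lee_wpmul2l//; first by rewrite lee_fin ltW// disc_area_gt0.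
have mif : measurable_fun setT (fun q : R => if r ^+ 2 <= q then A q else 0%E).
  by apply: measurable_if0 => //; apply: measurable_fun_ler.
rewrite -(ge0_integralZlT leb (ltW r0) mif); last by move=> q; case: ifP.
have pt (q : R) : (r%:E * (if (r ^+ 2 <= q)%R then A q else 0) <=
    \int[leb]_z (if chord q z then A q else 0))%E.
  case: ifPn => rq; last first.
    by rewrite mule0; apply: integral_ge0 => z _; case: ifP.
  have -> : (r%:E * A q = \int[leb]_(z in `]0%R, r[) A q)%E.
    rewrite integral_cst//= lebesgue_measure_itv/= lte_fin r0 oppr0 adde0.
    by rewrite muleC.
  rewrite integral_mkcond; apply: le_integralT => //.
  - apply/(measurable_restrictT _ _).1 => //.
  - apply: measurable_if0 => //; rewrite /chord; apply: measurable_fun_ltr => //; mreal.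
  - by move=> z; rewrite patchE; case: ifP.
  - move=> z; rewrite patchE mem_setE in_itv/=; case: ifPn => [/andP[z0 zr]|_]; last by case: ifP.
    rewrite ifT// /chord (lt_le_trans _ rq)// ltr_pXn2r// ?nnegrE ltW//.
apply: le_integralT.
- exact: measurable_funeM.
- apply: (meas_eparam1 (T1 := R) leb (f := fun z : R * R => if chord z.1 z.2 then A z.1 else 0%E)).
    apply: measurable_if0; first by rewrite /chord; apply: measurable_fun_ltr; mreal.
    by apply: (measurableT_comp mA).
  by move=> z; case: ifP.
- by move=> q; apply: mule_ge0; [rewrite lee_fin ltW|case: ifP].
- exact: pt.
Qed.

End Bipolar.

(** * Plancherel's theorem *)

Section Osc.
Context {R : realType}.
Local Notation leb := (@lebesgue_measure R).
Local Notation L3 := (@leb3 R).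
Implicit Types (a b : R3 R -> R[i]) (x y c : R3 R) (e : R).

(** [s = -1] gives the Fourier transform and [s = 1] its unnormalized inverse; a single parameter
    covers both. *)
Definition osc (s : R) a x : R[i] :=
  cintegral L3 (fun xi => cis (s * dot3 x xi) * a xi).

Lemma measurable_phase (s : R) :
  measurable_fun setT (fun z : R3 R * R3 R => s * dot3 z.1 z.2).
Proof. by apply: measurable_funM; [exact: measurable_cst|exact: measurable_dot3]. Qed.

Lemma cmeas_phase (s : R) :
  cmeasurable (fun z : R3 R * R3 R => cis (s * dot3 z.1 z.2)).
Proof. by apply: cmeas_cis; exact: measurable_phase. Qed.

Lemma cmeas_osc s a : cmeasurable a -> cmeasurable (osc s a).
Proof. by move=> ma; exact: (cmeas_kernel_int L3 (cmeas_phase s) ma). Qed.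

Lemma dot3C x y : dot3 x y = dot3 y x.
Proof. by rewrite /dot3; congr (_ + _ + _); rewrite mulrC. Qed.

(** A product over the coordinates instead of a function of [enorm3 x]: its Fourier transform is
    then a product of one-dimensional Poisson kernels. *)
Definition damp (e : R) x : R := expdecay e x.1.1 * expdecay e x.1.2 * expdecay e x.2.
Definition poisson3 (e : R) x : R := poisson e x.1.1 * poisson e x.1.2 * poisson e x.2.

Lemma damp_ge0 e x : 0 <= damp e x.
Proof. by rewrite /damp !mulr_ge0// expdecay_ge0. Qed.

Lemma damp_le1 e x : 0 <= e -> damp e x <= 1.
Proof.
move=> e0; rewrite /damp -[leRHS]mulr1 -[X in _ <= X * _]mulr1.
by rewrite !ler_pM// ?mulr_ge0 ?expdecay_ge0 ?expdecay_le1.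
Qed.

Lemma measurable_damp e : measurable_fun setT (damp e).
Proof.
have m (p : R3 R -> R) : measurable_fun setT p -> measurable_fun setT (fun x => expdecay e (p x)).
  by move=> mp; exact: (measurableT_comp (measurable_expdecay e)).
by apply: measurable_funM; [apply: measurable_funM|]; apply: m;
  [exact: meas_x1|exact: meas_x2|exact: meas_x3].
Qed.

Lemma measurable_poisson3 e : 0 < e -> measurable_fun setT (poisson3 e).
Proof.
move=> e0.
have m (p : R3 R -> R) : measurable_fun setT p -> measurable_fun setT (fun x => poisson e (p x)).
  by move=> mp; exact: (measurableT_comp (measurable_poisson e0)).
by apply: measurable_funM; [apply: measurable_funM|]; apply: m;
  [exact: meas_x1|exact: meas_x2|exact: meas_x3].
Qed.

Lemma poisson3_ge0 e x : 0 <= e -> 0 <= poisson3 e x.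
Proof. by move=> e0; apply: mulr_ge0 (mulr_ge0 _ _) _; exact: poisson_ge0. Qed.

Definition damped_exp (e c : R) (t : R) : R[i] := cis (c * t) * (expdecay e t)%:C.

Lemma cintegrable_damped_exp e (c : R) : 0 < e -> cintegrable leb (damped_exp e c).
Proof.
move=> e0; apply: (cintegrable_le _ (integrable_expdecay e0)); last first.
- move=> t; rewrite Normc.normcM normc_cis mul1r normc_real ger0_norm//.
  exact: expdecay_ge0.
- apply: cmeasM; last by apply: cmeas_real; exact: measurable_expdecay.
  by apply: cmeas_cis; apply: continuous_measurable_fun; exact: continuous_mulc.
Qed.

Lemma cintegrable_damped_exp2 e (c d : R) : 0 < e ->
  cintegrable (@leb2 R) (fun z => damped_exp e c z.1 * damped_exp e d z.2).
Proof.
move=> e0.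
have H := integrable_tensor (cintegrable_damped_exp c e0) (cintegrable_damped_exp d e0)
  (cmeas_cst _ (1 : R[i])).
suff -> : (fun z => damped_exp e c z.1 * damped_exp e d z.2) = (fun z : R * R => 1 * (damped_exp e c z.1 * damped_exp e d z.2)).
  by apply: H => z; rewrite Normc.normc1.
by apply/funext => z; rewrite mul1r.
Qed.

Lemma dampE e c x : cis (dot3 c x) * (damp e x)%:C =
  damped_exp e c.1.1 x.1.1 * damped_exp e c.1.2 x.1.2 * damped_exp e c.2 x.2.
Proof. by rewrite /dot3 !cisD /damp !rmorphM/= /damped_exp; ring. Qed.

Lemma cintegrable_damp e c : 0 < e ->
  cintegrable L3 (fun x => cis (dot3 c x) * (damp e x)%:C).
Proof.
move=> e0.
have H := integrable_tensor (cintegrable_damped_exp2 c.1.1 c.1.2 e0) (cintegrable_damped_exp c.2 e0)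
  (cmeas_cst _ (1 : R[i])).
suff -> : (fun x => cis (dot3 c x) * (damp e x)%:C) = (fun x : R3 R => 1 *
   (damped_exp e c.1.1 x.1.1 * damped_exp e c.1.2 x.1.2 * damped_exp e c.2 x.2)).
  by apply: H => z; rewrite Normc.normc1.
by apply/funext => z; rewrite mul1r dampE.
Qed.

Lemma integrable_damp e : 0 < e -> L3.-integrable setT (EFin \o damp e).
Proof.
move=> e0; pose z (x : R3 R) := cis (dot3 (0, 0, 0) x) * (damp e x)%:C.
suff -> : EFin \o damp e = (fun x => (normc (z x))%:E).
  exact: (cintegrable_norm (cintegrable_damp (0, 0, 0) e0)).
apply/funext => x; rewrite /z.
by rewrite Normc.normcM normc_cis mul1r normc_real ger0_norm// damp_ge0.
Qed.

Lemma cintegral_damp e c : 0 < e ->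
  cintegral L3 (fun x => cis (dot3 c x) * (damp e x)%:C) = (poisson3 e c)%:C.
Proof.
move=> e0.
transitivity (cintegral L3 (fun x : R3 R =>
    damped_exp e c.1.1 x.1.1 * damped_exp e c.1.2 x.1.2 * damped_exp e c.2 x.2)).
  by apply: eq_cintegral => x; exact: dampE.
have -> := cintegral_tensor (cintegrable_damped_exp2 c.1.1 c.1.2 e0) (cintegrable_damped_exp c.2 e0).
have -> := cintegral_tensor (cintegrable_damped_exp c.1.1 e0) (cintegrable_damped_exp c.1.2 e0).
by rewrite /damped_exp !cintegral_expdecay// -!rmorphM.
Qed.

Lemma poisson3_total e y : 0 < e ->
  (\int[L3]_z (poisson3 e (sub3 y z))%:E = ((2 * pi) ^+ 3)%:E)%E.
Proof.
move=> e0.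
have tot (c : R) : (\int[leb]_t (poisson e (c - t)%R)%:E = (2 * pi)%:E)%E.
  rewrite -(poisson_total c e0); apply: eq_integral_leb => t.
  by rewrite -poissonN opprB.
have pi0 : 0 <= 2 * pi :> R by rewrite mulr_ge0// pi_ge0.
rewrite leb3_zyx; last 2 first.
- apply/measurable_EFinP; apply: (measurableT_comp (measurable_poisson3 e0)).
  exact: measurable_sub3.
- by move=> x; rewrite lee_fin poisson3_ge0// ltW.
have mp (c : R) : measurable_fun setT (fun t : R => (poisson e (c - t))%:E).
  apply/measurable_EFinP; apply: (measurableT_comp (measurable_poisson e0)).
  by apply: measurable_funB => //; exact: measurable_id.
have p0 (c t : R) : (0 <= (poisson e (c - t))%:E)%E by rewrite lee_fin poisson_ge0// ltW.
have totZ (m c : R) : 0 <= m ->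
    (\int[leb]_t (m%:E * (poisson e (c - t)%R)%:E) = (m * (2 * pi))%:E)%E.
  by move=> m0; rewrite ge0_integralZlT ?tot//; exact: mp.
have q0 t : 0 <= poisson e t by rewrite poisson_ge0// ltW.
transitivity (\int[leb]_z (((2 * pi) ^+ 2)%:E * (poisson e (y.2 - z)%R)%:E))%E.
  apply: eq_integral_leb => z.
  transitivity (\int[leb]_t ((2 * pi * poisson e (y.2 - z))%:E * (poisson e (y.1.2 - t)%R)%:E))%E.
    apply: eq_integral_leb => t.
    transitivity (\int[leb]_u ((poisson e (y.1.2 - t) * poisson e (y.2 - z))%:E * (poisson e (y.1.1 - u)%R)%:E))%E.
      by apply: eq_integral_leb => u; rewrite -EFinM /poisson3 /=; congr EFin; ring.
    by rewrite totZ; [rewrite -EFinM; congr EFin; ring|exact: mulr_ge0].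
  by rewrite totZ; [rewrite -EFinM; congr EFin; ring|exact: mulr_ge0].
by rewrite totZ ?exprn_ge0//; congr EFin; ring.
Qed.

Lemma measurable_fun_sub3 d (T : measurableType d) (f g : T -> R3 R) :
  measurable_fun setT f -> measurable_fun setT g ->
  measurable_fun setT (fun t => sub3 (f t) (g t)).
Proof.
move=> mf mg.
have mm (h : R3 R -> R) : measurable_fun setT h ->
    measurable_fun setT (fun z => h (f z) - h (g z)).
  by move=> mh; apply: measurable_funB; apply: (measurableT_comp mh).
apply: measurable_fun_pair; last exact: (mm _ meas_x3).
by apply: measurable_fun_pair; [exact: (mm _ meas_x1)|exact: (mm _ meas_x2)].
Qed.

Lemma sqr_sign (s : R) : s ^+ 2 = 1 -> s = 1 \/ s = -1.
Proof. by move/eqP; rewrite sqrf_eq1 => /orP[] /eqP; [left|right]. Qed.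

(** Schur's test with the second factor equal to 1: the integral of the kernel in one variable is
    the mass (2 pi)^3 of [poisson3], whatever [e] is. *)
Lemma weighted_plancherel (s : R) a e : s ^+ 2 = 1 -> 0 < e -> cintegrable L3 a ->
  (\int[L3]_x (damp e x * sqc (osc s a x))%:E <= ((2 * pi) ^+ 3)%:E * n2 L3 a)%E.
Proof.
move=> s2 e0 Ia; have ma := cintegrable_meas Ia.
pose k (z : R3 R * R3 R) := poisson3 e (sub3 z.1 z.2).
have mk : measurable_fun setT k.
  apply: (measurableT_comp (measurable_poisson3 e0)).
  exact: measurable_fun_sub3.
have k0 z : 0 <= k z by rewrite /k poisson3_ge0// ltW.
have k_sym y z : k (y, z) = k (z, y).
  by rewrite /k /poisson3 /sub3/=; congr (_ * _ * _); rewrite -poissonN opprB.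
have wk y z : normc (cintegral L3 (fun x => cis (s * dot3 x y - s * dot3 x z) *
    (damp e x)%:C)) <= k (y, z).
  pose c : R3 R := (s * (y.1.1 - z.1.1), s * (y.1.2 - z.1.2), s * (y.2 - z.2)).
  rewrite (_ : cintegral _ _ = (poisson3 e c)%:C); last first.
    rewrite -cintegral_damp//; apply: eq_cintegral => x.
    by congr (cis _ * _); rewrite /c /dot3/=; ring.
  rewrite normc_real ger0_norm ?poisson3_ge0// ?(ltW e0)//.
  by rewrite /k /c /poisson3 /sub3/=; case: (sqr_sign s2) => ->;
    rewrite ?mul1r// !mulN1r !poissonN.
have Ia1 : cintegrable L3 (fun y => a y * 1) by under eq_fun do rewrite mulr1.
have := schur_osc (mX := L3) (mY := L3) (damp_ge0 e) (integrable_damp e0) (measurable_phase s) mk k0 k_sym wk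
  ma (cmeas_cst _ (1 : R[i])) Ia1.
rewrite (_ : (\int[_]_x _)%E = (\int[L3]_x (damp e x * sqc (osc s a x))%:E)%E); last first.
  apply: eq_integral => x _; rewrite /osc; congr (_ * sqc _)%:E.
  by apply: eq_cintegral => y; rewrite mulr1.
move=> /le_trans; apply.
have pi0 : 0 <= (2 * pi) ^+ 3 :> R by rewrite exprn_ge0// mulr_ge0// pi_ge0.
rewrite -ge0_integralZlT//; last 2 first.
- exact: meas_sqcE.
- by move=> x; rewrite lee_fin sqc_ge0.
rewrite le_eqVlt; apply/orP; left; apply/eqP; apply: eq_integral => y _.
rewrite -(poisson3_total y e0) muleC -ge0_integralZlT//; last 3 first.
- exact: sqc_ge0.
- apply/measurable_EFinP; apply: (measurableT_comp (measurable_poisson3 e0)).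
  exact: measurable_sub3.
- by move=> x; rewrite lee_fin poisson3_ge0// ltW.
apply: eq_integral => z _.
by rewrite -EFinM sqc_real expr1n mulr1.
Qed.

Lemma dampX2 e x : damp e x ^+ 2 = damp (2 * e) x.
Proof.
have h (t : R) : expdecay e t ^+ 2 = expdecay (2 * e) t.
  by rewrite /expdecay expr2 -expRD; congr expR; ring.
by rewrite /damp !exprMn !h.
Qed.

Lemma cvg_damp (c : R) x : damp (c * n.+1%:R^-1) x @[n --> \oo] --> (1 : R).
Proof.
have h (t : R) : expdecay (c * n.+1%:R^-1) t @[n --> \oo] --> (1 : R).
  rewrite -[X in _ --> X]expR0.
  apply: (continuous_cvg _ (@continuous_expR R 0)).
  rewrite -(mulr0 (- (c * `|t|))).
  rewrite (_ : (fun n : nat => _) = (fun n : nat => - (c * `|t|) * harmonic n)); last first.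
    by apply/funext => n; rewrite /harmonic/= mulrAC mulNr.
  by apply: cvgM; [exact: cvg_cst|exact: cvg_harmonic].
by have := cvgM (cvgM (h x.1.1) (h x.1.2)) (h x.2); rewrite !mulr1; exact.
Qed.

Lemma ccvg_cst (z : R[i]) : ccvg (fun _ => z) z.
Proof. by split; exact: cvg_cst. Qed.

Lemma ccvg_real (u : nat -> R) (l : R) : u @ \oo --> l -> ccvg (fun n => (u n)%:C) l%:C.
Proof. by move=> ul; split => //=; exact: cvg_cst. Qed.

Lemma ccvgM (u v : nat -> R[i]) (z w : R[i]) : ccvg u z -> ccvg v w ->
  ccvg (fun n => u n * v n) (z * w).
Proof.
move=> [u1 u2] [v1 v2]; split.
  rewrite ReM; under eq_fun do rewrite ReM.
  by apply: cvgB; apply: cvgM.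
rewrite ImM; under eq_fun do rewrite ImM.
by apply: cvgD; apply: cvgM.
Qed.

Lemma plancherel_le (s : R) a : s ^+ 2 = 1 -> cintegrable L3 a ->
  (n2 L3 (osc s a) <= ((2 * pi) ^+ 3)%:E * n2 L3 a)%E.
Proof.
move=> s2 Ia; have ma := cintegrable_meas Ia.
(* The factor 1/2 in the rate makes the square of the damping equal to the weight
   [damp n.+1%:R^-1]. *)
pose f (n : nat) x : R[i] := (damp (2^-1 * n.+1%:R^-1) x)%:C * osc s a x.
have mf n : cmeasurable (f n).
  by apply: cmeasM; [apply: cmeas_real; exact: measurable_damp|exact: cmeas_osc].
apply: (n2_fatou (mu := L3) mf (cmeas_osc s ma)).
  apply: aeW => x; rewrite -[osc s a x]mul1r.
  by apply: ccvgM; [apply: ccvg_real; exact: cvg_damp|exact: ccvg_cst].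
apply: nearW => n; rewrite /n2.
have e0 : 0 < (n.+1%:R^-1 : R) by rewrite invr_gt0.
apply: le_trans (weighted_plancherel s2 e0 Ia).
rewrite le_eqVlt; apply/orP; left; apply/eqP; apply: eq_integral => x _.
by rewrite /f sqcM sqc_real dampX2 mulrA divff// mul1r.
Qed.

Lemma sqint_osc (s : R) a : s ^+ 2 = 1 -> cintegrable L3 a -> sqint L3 a -> sqint L3 (osc s a).
Proof.
move=> s2 Ia [ma na]; split; first exact: cmeas_osc.
apply: le_lt_trans (plancherel_le s2 Ia) _.
by rewrite lte_mul_pinfty// lee_fin exprn_ge0// mulr_ge0// pi_ge0.
Qed.

Lemma phase_le1 (s : R) (z : R3 R * R3 R) : normc (cis (s * dot3 z.1 z.2)) <= 1.
Proof. by rewrite normc_cis. Qed.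

Lemma osc_bounded (s : R) a x : cintegrable L3 a ->
  normc (osc s a x) <= \int[L3]_y normc (a y).
Proof. by move=> Ia; exact: (normc_kernel_int (m2 := L3) (cmeas_phase s) Ia (phase_le1 s)). Qed.

(** The multiplication formula of the Fourier transform, from the symmetry of the phase. *)
Lemma osc_swap (s : R) a b : cintegrable L3 a -> cintegrable L3 b ->
  cintegral L3 (fun x => a x * osc s b x) = cintegral L3 (fun x => b x * osc s a x).
Proof.
move=> Ia Ib.
rewrite (cintegral_kernelC Ia Ib (cmeas_phase s) (phase_le1 s)).
by apply: eq_cintegral => x; congr (_ * _); apply: eq_cintegral => y; rewrite /= dot3C.
Qed.

(** Two uses of the multiplication formula: the first takes [osc 1] off [a], the second [osc (-1)]
    off [b]. The damping provides integrability, and its own transform is the Poisson kernel. *)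
Lemma damped_parseval a b e : 0 < e -> cintegrable L3 a -> cintegrable L3 b ->
  cintegral L3 (fun x => (damp e x)%:C * (osc 1 a x * osc (-1) b x)) =
  cintegral L3 (fun y => a y * cintegral L3 (fun z => b z * (poisson3 e (sub3 y z))%:C)).
Proof.
move=> e0 Ia Ib.
have Idamp : cintegrable L3 (fun x => (damp e x)%:C).
  suff -> : (fun x => (damp e x)%:C) = (fun x => cis (dot3 (0, 0, 0) x) * (damp e x)%:C).
    exact: cintegrable_damp.
  by apply/funext => x; rewrite /dot3/= !mul0r !addr0 cis0 mul1r.
have mob := cmeas_osc (-1) (cintegrable_meas Ib).
have Iw : cintegrable L3 (fun x => osc (-1) b x * (damp e x)%:C).
  by apply: (cintegrableM Idamp mob) => x; exact: osc_bounded.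
transitivity (cintegral L3 (fun x => (osc (-1) b x * (damp e x)%:C) * osc 1 a x)).
  by apply: eq_cintegral => x; ring.
rewrite (osc_swap 1 Iw Ia); apply: eq_cintegral => y; apply: f_equal.
have Iy : cintegrable L3 (fun x => cis (dot3 y x) * (damp e x)%:C) by exact: cintegrable_damp.
transitivity (cintegral L3 (fun x => (cis (dot3 y x) * (damp e x)%:C) * osc (-1) b x)).
  by apply: eq_cintegral => x; rewrite mul1r; ring.
rewrite (osc_swap (-1) Iy Ib); apply: eq_cintegral => z; apply: f_equal.
rewrite -cintegral_damp//; apply: eq_cintegral => x.
by rewrite mulrA -cisD; congr (cis _ * _); rewrite /dot3/=; ring.
Qed.

Lemma ccvg_cintegral d (T : measurableType d) (mu : {measure set T -> \bar R})
    (f : nat -> T -> R[i]) (F : T -> R[i]) (h : T -> R) :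
  (forall n, cmeasurable (f n)) -> cmeasurable F ->
  {ae mu, forall t, ccvg (f^~ t) (F t)} ->
  mu.-integrable setT (EFin \o h) -> (forall n t, normc (f n t) <= h t) ->
  ccvg (fun n => cintegral mu (f n)) (cintegral mu F).
Proof.
move=> mf mF fF ih fh.
have key (p : R[i] -> R) : (forall z, `|p z| <= normc z) ->
    (forall n, measurable_fun setT (fun t => p (f n t))) ->
    measurable_fun setT (fun t => p (F t)) ->
    {ae mu, forall t, (fun n => p (f n t)) @ \oo --> p (F t)} ->
    (fun n => \int[mu]_t p (f n t)) @ \oo --> \int[mu]_t p (F t).
  move=> pn mpf mpF pfF.
  have pfF' : {ae mu, forall t, setT t -> (p (f n t))%:E @[n --> \oo] --> (p (F t))%:E}.
    by apply: filterS pfF => t H _; apply: cvg_EFin => //; exact: nearW.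
  have [I _ C] := dominated_convergence measurableT
    (f_ := fun n t => (p (f n t))%:E)
    (fun n => proj2 (measurable_EFinP _ _) (mpf n))
    (proj2 (measurable_EFinP _ _) mpF) pfF' ih
    (aeW mu (fun t n _ => le_trans (pn (f n t)) (fh n t))).
  rewrite /Rintegral; apply: fine_cvg; rewrite fineK//.
  exact: integrable_fin_num.
split.
- apply: (key (fun z => complex.Re z)).
  + exact: normr_Re.
  + by move=> n; case: (mf n).
  + by case: mF.
  + by apply: filterS fF => t [].
- apply: (key (fun z => complex.Im z)).
  + exact: normr_Im.
  + by move=> n; case: (mf n).
  + by case: mF.
  + by apply: filterS fF => t [].
Qed.

Definition slab (u v t : R) : R := \1_(`]u, v]%classic : set R) t.

Definition box (u v : R3 R) x : R :=
  slab u.1.1 v.1.1 x.1.1 * slab u.1.2 v.1.2 x.1.2 * slab u.2 v.2 x.2.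

Lemma measurable_slab u v : measurable_fun setT (slab u v).
Proof. exact: measurable_indic. Qed.

Lemma slab_ge0 u v t : 0 <= slab u v t.
Proof. by rewrite /slab indicE ler0n. Qed.

Lemma slab_le1 u v t : slab u v t <= 1.
Proof. by rewrite /slab indicE lern1 leq_b1. Qed.

Lemma slabX2 u v t : slab u v t ^+ 2 = slab u v t.
Proof. by rewrite /slab indicE; case: (_ \in _); rewrite ?expr1n ?expr0n. Qed.

Lemma integral_slab (f : R -> R) u v : 
  (\int[leb]_t (slab u v t * f t)%:E = \int[leb]_(t in `]u, v]) (f t)%:E)%E.
Proof.
rewrite [RHS]integral_mkcond; apply: eq_integral_leb => t.
by rewrite /slab indicE patchE; case: (_ \in _); rewrite ?mul1r ?mul0r.
Qed.

Lemma integrable_slab u v : u <= v -> leb.-integrable setT (EFin \o slab u v).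
Proof.
move=> uv; apply/integrableP; split; first by apply/measurable_EFinP; exact: measurable_slab.
rewrite (_ : (\int[_]_x _)%E = (\int[leb]_t (slab u v t * 1)%:E)%E); last first.
  by apply: eq_integral_leb => t; rewrite /= ger0_norm ?slab_ge0// mulr1.
rewrite (integral_slab (fun=> 1)) integral_cst//= lebesgue_measure_itv/=.
by case: ifP; rewrite ?mule0 ?mul1e ?ltry.
Qed.

(** The convolution of [slab u v] with the Poisson kernel, evaluated at [t]. *)
Definition atan_gap (u v e t : R) : R := 2 * atan ((v - t) / e) - 2 * atan ((u - t) / e).

Lemma normr_atan_gap u v e t : `|atan_gap u v e t| <= 2 * pi.
Proof.
rewrite /atan_gap.
have := atan_ltpi2 ((v - t) / e); have := atan_gtNpi2 ((v - t) / e).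
have := atan_ltpi2 ((u - t) / e); have := atan_gtNpi2 ((u - t) / e).
by rewrite ler_norml; lra.
Qed.

Lemma integral_slab_poisson u v e (y : R) : 0 < e -> u <= v ->
  cintegral leb (fun t => (slab u v t * poisson e (y - t))%:C) = (atan_gap u v e y)%:C.
Proof.
move=> e0 uv; rewrite cintegral_real /Rintegral integral_slab.
suff -> : (\int[leb]_(t in `]u, v]) (poisson e (y - t))%:E = (atan_gap u v e y)%:E)%E by [].
rewrite integral_itv_obnd_cbnd.
  rewrite -(poisson_itv y e0 uv); apply: eq_integral => t _.
  by rewrite -poissonN opprB.
apply/measurable_EFinP; apply: (measurableT_comp (measurable_poisson e0)).
by apply: measurable_funB => //; exact: measurable_id.
Qed.

Lemma cvg_atan_harmonic (c : R) : 0 < c -> atan (c / n.+1%:R^-1) @[n --> \oo] --> (pi : R) / 2.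
Proof.
move=> c0; apply: (cvg_comp (fun n => c / n.+1%:R^-1) atan); last exact: cvgy_atan.
apply/cvgryPge => M.
have := @near_infty_natSinv_lt R (PosNum (divr_gt0 c0 (ltr_pwDl ltr01 (normr_ge0 M)))).
apply: filterS => n /= h; rewrite invrK.
move: h; rewrite -[_^-1]mul1r ltr_pdivrMr// mulrAC ltr_pdivlMr ?ltr_pwDl// mul1r => h.
by apply: le_trans (ltW h); rewrite (le_trans (ler_norm M))// lerDr.
Qed.

(** Each term [2 * atan] tends to [pi] or [- pi] according to the sign of its numerator; at an
    endpoint a numerator vanishes, hence the two exclusions. *)
Lemma cvg_atan_gap u v t : u <= v -> t != u -> t != v ->
  atan_gap u v n.+1%:R^-1 t @[n --> \oo] --> 2 * pi * slab u v t.
Proof.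
move=> uv tu tv.
have pos (c : R) : 0 < c -> 2 * atan (c / n.+1%:R^-1) @[n --> \oo] --> pi.
  move=> c0; rewrite (_ : pi = 2 * (pi / 2)); last by rewrite mulrC divfK.
  by apply: cvgM; [exact: cvg_cst|exact: cvg_atan_harmonic].
have neg (c : R) : c < 0 -> 2 * atan (c / n.+1%:R^-1) @[n --> \oo] --> - pi.
  move=> c0.
  rewrite (_ : (fun n : nat => _) = (fun n => - (2 * atan (- c / n.+1%:R^-1)))).
    by apply: cvgN; apply: pos; rewrite oppr_gt0.
  by apply/funext => n; rewrite mulNr atanN mulrN opprK.
rewrite /atan_gap /slab indicE mem_setE in_itv/=.
have [tu'|tu'|e] := ltgtP u t; last by rewrite e eqxx in tu.
- have [tv'|tv'|e] := ltgtP t v; last by rewrite e eqxx in tv.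
  + rewrite (_ : 2 * pi * _ = pi - (- pi)); last by rewrite mulr1 opprK; ring.
    by apply: cvgB; [apply: pos|apply: neg]; rewrite ?subr_gt0 ?subr_lt0.
  + rewrite (_ : 2 * pi * _ = (- pi) - (- pi)); last by rewrite mulr0 subrr.
    by apply: cvgB; apply: neg; rewrite subr_lt0.
- rewrite (_ : 2 * pi * _ = pi - pi); last by rewrite mulr0 subrr.
  by apply: cvgB; apply: pos; rewrite subr_gt0// (lt_le_trans tu').
Qed.

(** The planes containing the faces of a box are the exceptional set of [cvg_atan_gap3]. *)
Lemma ae_off_planes (u : R3 R) :
  {ae L3, forall x : R3 R, [/\ x.1.1 != u.1.1, x.1.2 != u.1.2 & x.2 != u.2]}.
Proof.
have m1 (c : R) : measurable [set c] by exact: measurable_set1.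
have l0 (c : R) : leb [set c] = 0%E by exact: lebesgue_measure_set1.
have E3 (A B C : set R) : measurable A -> measurable B -> measurable C ->
    L3 (A `*` B `*` C) = (leb A * leb B * leb C)%E.
  move=> mA mB mC; rewrite /leb3 product_measure1E//; last exact: measurableX.
  by congr (_ * _)%E; exact: product_measure1E.
have N1 : L3 ([set u.1.1] `*` setT `*` setT) = 0%E by rewrite E3// l0 !mul0e.
have N2 : L3 (setT `*` [set u.1.2] `*` setT) = 0%E by rewrite E3// l0 mule0 mul0e.
have N3 : L3 (setT `*` [set u.2]) = 0%E.
  by rewrite -setXTT E3// l0 mule0.
have M1 : measurable ([set u.1.1] `*` setT `*` setT : set (R3 R)).
  by apply: measurableX => //; exact: measurableX.
have M2 : measurable (setT `*` [set u.1.2] `*` setT : set (R3 R)).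
  by apply: measurableX => //; exact: measurableX.
have M3 : measurable (setT `*` [set u.2] : set (R3 R)) by exact: measurableX.
have n1 : L3.-negligible ([set u.1.1] `*` setT `*` setT) by apply/negligibleP.
have n2 : L3.-negligible (setT `*` [set u.1.2] `*` setT) by apply/negligibleP.
have n3 : L3.-negligible (setT `*` [set u.2]) by apply/negligibleP.
have [A [mA A0 sA]] := negligibleU (negligibleU n1 n2) n3.
exists A; split => // x nx; apply: sA => /=.
have [e1|m1'] := eqVneq x.1.1 u.1.1; first by left; left.
have [e2|m2] := eqVneq x.1.2 u.1.2; first by left; right.
have [e3|m3] := eqVneq x.2 u.2; first by right.
by exfalso; apply: nx.
Qed.

Lemma cintegrable_tensor3 (p q r : R -> R[i]) :
  cintegrable leb p -> cintegrable leb q -> cintegrable leb r ->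
  cintegrable L3 (fun x => p x.1.1 * q x.1.2 * r x.2) /\
  cintegral L3 (fun x => p x.1.1 * q x.1.2 * r x.2) =
    cintegral leb p * cintegral leb q * cintegral leb r.
Proof.
move=> Ip Iq Ir.
have Ipq : cintegrable (@leb2 R) (fun z => p z.1 * q z.2).
  have H := integrable_tensor Ip Iq (cmeas_cst _ (1 : R[i])).
  suff -> : (fun z => p z.1 * q z.2) = (fun z : R * R => 1 * (p z.1 * q z.2)).
    by apply: H => z; rewrite Normc.normc1.
  by apply/funext => z; rewrite mul1r.
split.
  have H := integrable_tensor Ipq Ir (cmeas_cst _ (1 : R[i])).
  suff -> : (fun x : R3 R => p x.1.1 * q x.1.2 * r x.2) =
      (fun x : R3 R => 1 * (p x.1.1 * q x.1.2 * r x.2)).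
    by apply: H => z; rewrite Normc.normc1.
  by apply/funext => z; rewrite mul1r.
by have -> := cintegral_tensor Ipq Ir; have -> := cintegral_tensor Ip Iq.
Qed.

Definition le3 (u v : R3 R) := [&& u.1.1 <= v.1.1, u.1.2 <= v.1.2 & u.2 <= v.2].

Lemma box_ge0 u v x : 0 <= box u v x.
Proof. by rewrite /box; do 2?apply: mulr_ge0; exact: slab_ge0. Qed.

Lemma box_le1 u v x : box u v x <= 1.
Proof.
rewrite /box -[leRHS]mulr1 -[X in _ <= X * _]mulr1.
by apply: ler_pM; rewrite ?slab_le1 ?slab_ge0//; [apply: mulr_ge0; exact: slab_ge0|];
  apply: ler_pM; rewrite ?slab_le1 ?slab_ge0.
Qed.

Lemma boxX2 u v x : box u v x ^+ 2 = box u v x.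
Proof. by rewrite /box !exprMn !slabX2. Qed.

Lemma cintegrable_box u v : le3 u v -> cintegrable L3 (fun x => (box u v x)%:C).
Proof.
move=> /and3P[h1 h2 h3].
have I (a b : R) : a <= b -> cintegrable leb (fun t => (slab a b t)%:C).
  move=> ab; have Is := integrable_slab ab.
  apply: (cintegrable_le _ Is); first by apply: cmeas_real; exact: measurable_slab.
  by move=> t; rewrite normc_real ger0_norm// slab_ge0.
have [J _] := cintegrable_tensor3 (I _ _ h1) (I _ _ h2) (I _ _ h3).
suff -> : (fun x => (box u v x)%:C) = (fun x : R3 R => (slab u.1.1 v.1.1 x.1.1)%:C *
  (slab u.1.2 v.1.2 x.1.2)%:C * (slab u.2 v.2 x.2)%:C) by [].
by apply/funext => x; rewrite /box !rmorphM.
Qed.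

Lemma sqint_box u v : le3 u v -> sqint L3 (fun x => (box u v x)%:C).
Proof.
move=> /cintegrable_box /cintegrableP[mb Ib]; split => //.
rewrite /n2 (_ : (\int[_]_x _)%E = (\int[L3]_x (normc (box u v x)%:C)%:E)%E)//.
apply: eq_integral => x _.
by rewrite sqc_real boxX2 normc_real ger0_norm// box_ge0.
Qed.

Definition atan_gap3 u v e x : R := atan_gap u.1.1 v.1.1 e x.1.1 *
  atan_gap u.1.2 v.1.2 e x.1.2 * atan_gap u.2 v.2 e x.2.

Lemma integral_box_poisson3 u v e y : 0 < e -> le3 u v ->
  cintegral L3 (fun z => (box u v z)%:C * (poisson3 e (sub3 y z))%:C) =
  (atan_gap3 u v e y)%:C.
Proof.
move=> e0 /and3P[h1 h2 h3].
pose p (a b c t : R) : R[i] := (slab a b t * poisson e (c - t))%:C.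
have I (a b c : R) : a <= b -> cintegrable leb (p a b c).
  (* [2 / e] is the maximum of the Poisson kernel, reached at 0. *)
  move=> ab; have Is := integrable_scale (2 / e) (integrable_slab ab).
  apply: (cintegrable_le _ Is).
    apply: cmeas_real; apply: measurable_funM; first exact: measurable_slab.
    apply: (measurableT_comp (measurable_poisson e0)).
    by apply: measurable_funB => //; exact: measurable_id.
  move=> t; rewrite normc_real normrM ger0_norm ?slab_ge0// mulrC.
  apply: ler_wpM2r; first exact: slab_ge0.
  rewrite ger0_norm ?poisson_ge0 ?(ltW e0)// /poisson.
  rewrite ler_pdivrMr ?sqrD_gt0// mulrAC ler_pdivlMr// -subr_ge0.
  rewrite (_ : _ - _ = 2 * (c - t) ^+ 2); last by ring.
  by rewrite mulr_ge0// sqr_ge0.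
have [_ J] := cintegrable_tensor3 (I _ _ y.1.1 h1) (I _ _ y.1.2 h2) (I _ _ y.2 h3).
transitivity (cintegral L3 (fun x => p u.1.1 v.1.1 y.1.1 x.1.1 *
    p u.1.2 v.1.2 y.1.2 x.1.2 * p u.2 v.2 y.2 x.2)).
  apply: eq_cintegral => x; rewrite /p /box /poisson3 /= -!rmorphM/=.
  by congr (_ %:C); ring.
by rewrite J /p !integral_slab_poisson// /atan_gap3 -!rmorphM.
Qed.

Lemma normr_atan_gap3 u v e x : `|atan_gap3 u v e x| <= (2 * pi) ^+ 3.
Proof.
rewrite /atan_gap3 !normrM (_ : (2 * pi) ^+ 3 = 2 * pi * (2 * pi) * (2 * pi)); last by ring.
by apply: ler_pM; rewrite ?mulr_ge0 ?normr_atan_gap//; apply: ler_pM; rewrite ?normr_atan_gap.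
Qed.

Lemma cvg_atan_gap3 u v x : le3 u v ->
  [/\ x.1.1 != u.1.1, x.1.2 != u.1.2 & x.2 != u.2] ->
  [/\ x.1.1 != v.1.1, x.1.2 != v.1.2 & x.2 != v.2] ->
  atan_gap3 u v n.+1%:R^-1 x @[n --> \oo] --> (2 * pi) ^+ 3 * box u v x.
Proof.
move=> /and3P[h1 h2 h3] [u1 u2 u3] [v1 v2 v3].
have := cvgM (cvgM (cvg_atan_gap h1 u1 v1) (cvg_atan_gap h2 u2 v2)) (cvg_atan_gap h3 u3 v3).
rewrite (_ : (2 * pi) ^+ 3 * box u v x =
  2 * pi * slab u.1.1 v.1.1 x.1.1 * (2 * pi * slab u.1.2 v.1.2 x.1.2) *
  (2 * pi * slab u.2 v.2 x.2)); first by exact.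
by rewrite /box; ring.
Qed.

Lemma measurable_atan_gap u v e : 0 < e -> u <= v -> measurable_fun setT (atan_gap u v e).
Proof.
move=> e0 uv; apply: continuous_measurable_fun.
have c (a : R) : continuous (fun t : R => 2 * atan ((a - t) / e)).
  move=> t; apply: cvgM; first exact: cvg_cst.
  apply: continuous_comp; last exact: continuous_atan.
  by apply: cvgM; [apply: cvgB => //; exact: cvg_cst|exact: cvg_cst].
by move=> t; apply: cvgB; exact: c.
Qed.

Lemma measurable_atan_gap3 u v e : 0 < e -> le3 u v -> measurable_fun setT (atan_gap3 u v e).
Proof.
move=> e0 /and3P[h1 h2 h3].
apply: measurable_funM; [apply: measurable_funM|].
- exact: (measurableT_comp (measurable_atan_gap e0 h1) meas_x1).
- exact: (measurableT_comp (measurable_atan_gap e0 h2) meas_x2).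
- exact: (measurableT_comp (measurable_atan_gap e0 h3) meas_x3).
Qed.

Lemma measurable_box u v : measurable_fun setT (box u v).
Proof.
apply: measurable_funM; [apply: measurable_funM|].
- exact: (measurableT_comp (measurable_slab _ _) meas_x1).
- exact: (measurableT_comp (measurable_slab _ _) meas_x2).
- exact: (measurableT_comp (measurable_slab _ _) meas_x3).
Qed.

Lemma ccvg_unique (f : nat -> R[i]) z w : ccvg f z -> ccvg f w -> z = w.
Proof.
move=> [f1 f2] [g1 g2]; apply: eq_complexP.
  by rewrite -(cvg_lim _ f1)// (cvg_lim _ g1).
by rewrite -(cvg_lim _ f2)// (cvg_lim _ g2).
Qed.

Lemma ae_mono d (T : measurableType d) (mu : {measure set T -> \bar R}) (P Q : T -> Prop) :
  (forall t, P t -> Q t) -> {ae mu, forall t, P t} -> {ae mu, forall t, Q t}.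
Proof. by move=> PQ; apply: filterS. Qed.

Lemma ae_mono2 d (T : measurableType d) (mu : {measure set T -> \bar R}) (P Q S : T -> Prop) :
  (forall t, P t -> Q t -> S t) -> {ae mu, forall t, P t} -> {ae mu, forall t, Q t} ->
  {ae mu, forall t, S t}.
Proof. by move=> PQ; apply: filterS2. Qed.

(* After damping, the inner integral is a product of differences of arctangents,
   which tends to (2 pi)^3 times the indicator function off the faces of the box. *)
Lemma parseval_box u v a : le3 u v -> cintegrable L3 a -> sqint L3 a ->
  cintegral L3 (fun x => osc 1 a x * osc (-1) (fun z => (box u v z)%:C) x) =
  ((2 * pi) ^+ 3)%:C * cintegral L3 (fun x => a x * (box u v x)%:C).
Proof.
move=> uv Ia Sa; set b := fun z => (box u v z)%:C.
have Ib : cintegrable L3 b by exact: cintegrable_box.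
have Sb : sqint L3 b by exact: sqint_box.
have s1 : (1 : R) ^+ 2 = 1 by rewrite expr1n.
have sN1 : (-1 : R) ^+ 2 = 1 by rewrite sqrrN expr1n.
have IP : cintegrable L3 (fun x => osc 1 a x * osc (-1) b x).
  by apply: cintegrable_mul; exact: sqint_osc.
have mP := cintegrable_meas IP.
pose ev (n : nat) : R := n.+1%:R^-1.
have ev0 n : 0 < ev n by rewrite invr_gt0.
(* The undamped product of two square-integrable transforms is integrable, so it dominates its
   damped versions. *)
have C1 : ccvg (fun n => cintegral L3 (fun x => (damp (ev n) x)%:C * (osc 1 a x * osc (-1) b x)))
    (cintegral L3 (fun x => osc 1 a x * osc (-1) b x)).
  apply: (ccvg_cintegral _ _ _ (cintegrable_norm IP)) => //.
  - by move=> n; apply: cmeasM => //; apply: cmeas_real; exact: measurable_damp.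
  - apply: aeW => x; rewrite -[X in ccvg _ X]mul1r.
    apply: ccvgM; last exact: ccvg_cst.
    apply: ccvg_real; have := @cvg_damp 1 x.
    by rewrite (_ : (fun n => _) = (fun n => damp (ev n) x))//; apply/funext => n; rewrite mul1r.
  - move=> n x; rewrite Normc.normcM normc_real ger0_norm ?damp_ge0//.
    by rewrite ler_piMl ?normc_ge0// damp_le1// ltW.
(* By [damped_parseval] these are the same integrals as in [C1], now dominated by (2 pi)^3 |a|. *)
have C2 : ccvg (fun n => cintegral L3 (fun y => a y * (atan_gap3 u v (ev n) y)%:C))
    (cintegral L3 (fun y => a y * ((2 * pi) ^+ 3 * box u v y)%:C)).
  have Ih := integrable_scale ((2 * pi) ^+ 3) (cintegrable_norm Ia).
  have ma := cintegrable_meas Ia.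
  apply: (ccvg_cintegral _ _ _ Ih).
  - by move=> n; apply: cmeasM => //; apply: cmeas_real; exact: measurable_atan_gap3.
  - apply: cmeasM => //; apply: cmeas_real; apply: measurable_funM => //.
    exact: measurable_box.
  - apply: (ae_mono2 _ (ae_off_planes u) (ae_off_planes v)) => x ux vx.
    apply: ccvgM; first exact: ccvg_cst.
    by apply: ccvg_real; exact: cvg_atan_gap3.
  - move=> n x; rewrite Normc.normcM normc_real mulrC.
    by apply: ler_wpM2r; [exact: normc_ge0|exact: normr_atan_gap3].
rewrite (_ : _ * _ = cintegral L3 (fun y => a y * ((2 * pi) ^+ 3 * box u v y)%:C)).
  apply: (ccvg_unique C1).
  suff <- : (fun n => cintegral L3 (fun y => a y * (atan_gap3 u v (ev n) y)%:C)) =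
    (fun n => cintegral L3 (fun x => (damp (ev n) x)%:C * (osc 1 a x * osc (-1) b x))) by [].
  apply/funext => n; rewrite damped_parseval//; apply: eq_cintegral => y.
  by rewrite integral_box_poisson3.
rewrite -cintegralZ; last first.
  rewrite (_ : (fun x => _) = (fun x => b x * a x)); last by apply/funext => x; rewrite mulrC.
  apply: (cintegrableM Ia (cintegrable_meas Ib) (M := 1)) => x.
  by rewrite normc_real ger0_norm ?box_ge0// box_le1.
by apply: eq_cintegral => x; rewrite rmorphM/=; ring.
Qed.
End Osc.

(** Dynkin's theorem in one variable: since [h] is integrable, the sets [A] with vanishing integral
    are closed under complements and countable disjoint unions. [D] carries the constraints put on
    the other variables. *)
Lemma integral_setI_preimage_eq0 d d' (T : measurableType d) (S : measurableType d')
    (R : realType) (mu : {measure set T -> \bar R}) (h : T -> \bar R) (p : T -> S)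
    (G : set (set S)) (D : set T) :
  mu.-integrable setT h -> measurable D -> measurable_fun setT p ->
  (measurable : set (set S)) = <<s G >> -> setI_closed G -> G setT ->
  (forall A, G A -> \int[mu]_(x in D `&` p @^-1` A) h x = 0)%E ->
  forall A, measurable A -> (\int[mu]_(x in D `&` p @^-1` A) h x = 0)%E.
Proof.
move=> ih mD mp GE GI GT h0.
have mDp B : measurable B -> measurable (D `&` p @^-1` B).
  by move=> mB; apply: measurableI => //; rewrite -[X in measurable X]setTI; exact: mp.
have ihS B : measurable B -> mu.-integrable B h.
  by move=> mB; apply: integrableS ih.
have mhS B : measurable B -> measurable_fun B h.
  by move=> mB; have /integrableP[] := ihS _ mB.
have hD : (\int[mu]_(x in D) h x = 0)%E by have := h0 _ GT; rewrite preimage_setT setIT.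
move=> A; rewrite GE => mA.
apply: (dynkin_induction (P := fun A => (\int[mu]_(x in D `&` p @^-1` A) h x = 0)%E) GE GI) => //.
- by rewrite preimage_setT setIT.
- move=> B mB hB.
  have DE : D = (D `&` p @^-1` B) `|` (D `&` p @^-1` (~` B)).
    by rewrite -setIUr -preimage_setU setUv preimage_setT setIT.
  move: hD; rewrite {1}DE integral_setU ?hB ?add0e//.
  + exact: mDp.
  + by apply: mDp; exact: measurableC.
  + by rewrite -DE; exact: mhS.
  + by apply/disj_set2P; rewrite setIACA -preimage_setI setICr preimage_set0 setI0.
- move=> F mF tF hF.
  have E : D `&` p @^-1` (\bigcup_k F k) = \bigcup_k (D `&` p @^-1` F k).
    by rewrite preimage_bigcup setI_bigcupr.
  have mFk k : measurable (D `&` p @^-1` F k) by exact: mDp.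
  rewrite E integral_bigcup//.
  + by rewrite eseries0.
  + apply: trivIset_setIl; apply/trivIsetP => i j _ _ ij.
    by rewrite -preimage_setI (proj1 (trivIsetP) tF)// preimage_set0.
  + by apply: ihS; exact: bigcup_measurable.
Qed.

(* Adding the whole line to the half-open intervals gives a generator of the
   Borel sets which contains it and is stable by intersection. *)
Definition ocitvT (R : realType) : set (set R) := [set A | A = setT \/ ocitv A].

Lemma ocitvT_measurableE (R : realType) :
  (measurable : set (set (measurableTypeR R))) = <<s @ocitvT R >>.
Proof.
apply/seteqP; split.
  by apply: sub_sigma_algebra2 => A h; right.
apply: smallest_sub; first exact: smallest_sigma_algebra.
by move=> A [->|h]; [exact: measurableT|exact: sub_sigma_algebra].
Qed.

Lemma ocitvT_setI_closed (R : realType) : setI_closed (@ocitvT R).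
Proof.
move=> A B [->|hA] [->|hB]; rewrite ?setTI ?setIT; [by left|by right|by right|].
by right; exact: ocitvI.
Qed.

Definition rectangles d d' (T : measurableType d) (S : measurableType d') : set (set (T * S)) :=
  [set A `*` B | A in measurable & B in measurable].

Lemma rectangles_setI_closed d d' (T : measurableType d) (S : measurableType d') :
  setI_closed (@rectangles _ _ T S).
Proof.
move=> _ _ [A mA [B mB <-]] [A' mA' [B' mB' <-]]; rewrite -setXI.
by exists (A `&` A'); [exact: measurableI|exists (B `&` B'); [exact: measurableI|]].
Qed.

Lemma rectangles_setT d d' (T : measurableType d) (S : measurableType d') :
  @rectangles _ _ T S setT.
Proof. by exists setT => //; exists setT => //; rewrite setXTT. Qed.

(** * Integrals over boxes determine a function almost everywhere *)

Section BoxUnique.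
Context {R : realType}.
Local Notation L3 := (@leb3 R).
Implicit Types (u v x : R3 R).

Definition fibers (A1 A2 A3 : set R) : set (R3 R) :=
  [set x | [/\ A1 x.1.1, A2 x.1.2 & A3 x.2]].

Lemma measurable_fibers A1 A2 A3 : measurable A1 -> measurable A2 -> measurable A3 ->
  measurable (fibers A1 A2 A3).
Proof.
move=> m1 m2 m3.
rewrite (_ : fibers A1 A2 A3 = A1 `*` A2 `*` A3); first by do 2?apply: measurableX.
by apply/seteqP; split => [[[x y] z] []|[[x y] z] [[]]].
Qed.

(** The sides are released one at a time from intervals to Borel sets; two more applications of
    Dynkin's theorem pass from rectangles to Borel sets of the plane, then of space. *)
Lemma integral_fibers_eq0 (h : R3 R -> \bar R) : L3.-integrable setT h ->
  (forall A1 A2 A3, ocitvT A1 -> ocitvT A2 -> ocitvT A3 ->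
    \int[L3]_(x in fibers A1 A2 A3) h x = 0)%E ->
  forall A, measurable A -> (\int[L3]_(x in A) h x = 0)%E.
Proof.
move=> ih h0.
have mG A : ocitvT A -> measurable (A : set (measurableTypeR R)).
  by move=> [->|hA]; [exact: measurableT|exact: sub_sigma_algebra].
have E1 (A1 A2 A3 : set R) :
    fibers A1 A2 A3 = fibers setT A2 A3 `&` (fun x : R3 R => x.1.1) @^-1` A1.
  by apply/seteqP; split => [x []|x [[]]].
have E2 (A1 A2 A3 : set R) :
    fibers A1 A2 A3 = fibers A1 setT A3 `&` (fun x : R3 R => x.1.2) @^-1` A2.
  by apply/seteqP; split => [x []|x [[]]].
have E3 (A1 A2 A3 : set R) :
    fibers A1 A2 A3 = fibers A1 A2 setT `&` (fun x : R3 R => x.2) @^-1` A3.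
  by apply/seteqP; split => [x []|x [[]]].
have S1 A1 A2 A3 : measurable A1 -> ocitvT A2 -> ocitvT A3 ->
    (\int[L3]_(x in fibers A1 A2 A3) h x = 0)%E.
  move=> m1 G2 G3; rewrite E1.
  apply: (integral_setI_preimage_eq0 ih _ meas_x1 (ocitvT_measurableE R)
    (@ocitvT_setI_closed R)) => //.
  - by apply: measurable_fibers => //; exact: mG.
  - by left.
  - by move=> A GA; rewrite -E1; exact: h0.
have S2 A1 A2 A3 : measurable A1 -> measurable A2 -> ocitvT A3 ->
    (\int[L3]_(x in fibers A1 A2 A3) h x = 0)%E.
  move=> m1 m2 G3; rewrite E2.
  apply: (integral_setI_preimage_eq0 ih _ meas_x2 (ocitvT_measurableE R)
    (@ocitvT_setI_closed R)) => //.
  - by apply: measurable_fibers => //; exact: mG.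
  - by left.
  - by move=> A GA; rewrite -E2; exact: S1.
have S3 A1 A2 A3 : measurable A1 -> measurable A2 -> measurable A3 ->
    (\int[L3]_(x in fibers A1 A2 A3) h x = 0)%E.
  move=> m1 m2 m3; rewrite E3.
  apply: (integral_setI_preimage_eq0 ih _ meas_x3 (ocitvT_measurableE R)
    (@ocitvT_setI_closed R)) => //.
  - by apply: measurable_fibers.
  - by left.
  - by move=> A GA; rewrite -E3; exact: S2.
have S4 (E : set (R * R)) (A3 : set R) : measurable E -> measurable A3 ->
    (\int[L3]_(x in fibers setT setT A3 `&` fst @^-1` E) h x = 0)%E.
  move=> mE m3.
  apply: (integral_setI_preimage_eq0 ih _ measurable_fst (measurable_prod_measurableType _ _)
    (@rectangles_setI_closed _ _ _ _)) => //.
  - by apply: measurable_fibers.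
  - exact: rectangles_setT.
  - move=> _ [A1 m1 [A2 m2 <-]].
    rewrite (_ : _ `&` _ = fibers A1 A2 A3); first exact: S3.
    by apply/seteqP; split => [x [[_ _ ?] []]|x []].
move=> A mA.
rewrite (_ : A = setT `&` id @^-1` A); last by rewrite setTI.
apply: (integral_setI_preimage_eq0 ih _ _ (measurable_prod_measurableType _ _)
    (@rectangles_setI_closed _ _ _ _)) => //.
- exact: rectangles_setT.
- move=> _ [E mE [A3 m3 <-]].
  rewrite (_ : _ `&` _ = fibers setT setT A3 `&` fst @^-1` E); first exact: S4.
  by apply/seteqP; split => [x [_ []]|x [[_ _ ?] ?]].
Qed.

Lemma indic_ocitvT_slab (A : set R) (N : R) : 0 <= N -> ocitvT A ->
  exists u v : R, u <= v /\ forall t, slab u v t = (if t \in A then slab (- N) N t else 0).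
Proof.
move=> N0 [->|[[u v] _ <-]].
  exists (- N), N; split; first by lra.
  by move=> t; rewrite in_setT.
(* The ends of the intersection with ]-N, N]; the outer [Num.max] keeps them in order when this
   intersection is empty. *)
exists (Num.max u (- N)), (Num.max (Num.max u (- N)) (Num.min v N)).
split; first by rewrite le_max lexx.
move=> t; rewrite /slab !indicE !mem_setE !in_itv/=.
rewrite gt_max le_max le_max le_min.
case: (ltP u t) => ut /=; last by [].
case: (ltP (- N) t) => Nt /=; last by case: (t <= v).
by case: (t <= v).
Qed.

(** [c] need not be integrable, so it is first cut off by a cube of half-side n. Intersecting a box
    with the cube gives a box again, so all integrals of the cut-off function vanish; then n tends
    to infinity. *)
Lemma ae_eq0_boxes (c : R3 R -> R[i]) : sqint L3 c ->
  (forall u v, le3 u v -> cintegral L3 (fun x => c x * (box u v x)%:C) = 0) ->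
  {ae L3, forall x, c x = 0}.
Proof.
move=> sc c0.
pose w (n : nat) : R3 R := (n%:R, n%:R, n%:R).
pose w' (n : nat) : R3 R := (- n%:R, - n%:R, - n%:R).
have ww n : le3 (w' n) (w n).
  have h : - n%:R <= n%:R :> R by rewrite (@le_trans _ _ 0) ?oppr_le0 ?ler0n.
  by rewrite /le3 /= !h.
have key (n : nat) : {ae L3, forall x, c x * (box (w' n) (w n) x)%:C = 0}.
  have Ic : cintegrable L3 (fun x => c x * (box (w' n) (w n) x)%:C).
    by apply: cintegrable_mul => //; exact: sqint_box.
  have part (p : R[i] -> R) : p 0 = 0 -> (forall z (r : R), p (z * r%:C) = p z * r) ->
      L3.-integrable setT (fun x => (p (c x * (box (w' n) (w n) x)%:C))%:E) ->
      (forall u v, le3 u v -> \int[L3]_x (p (c x * (box u v x)%:C))%:E = 0)%E ->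
      {ae L3, forall x, p (c x * (box (w' n) (w n) x)%:C) = 0}.
    move=> p0 pZ Ip pb.
    have hA A : measurable A -> (\int[L3]_(x in A) (p (c x * (box (w' n) (w n) x)%:C))%:E = 0)%E.
      apply: integral_fibers_eq0 => // A1 A2 A3 G1 G2 G3.
      have [u1 [v1 [uv1 e1]]] := indic_ocitvT_slab (ler0n R n) G1.
      have [u2 [v2 [uv2 e2]]] := indic_ocitvT_slab (ler0n R n) G2.
      have [u3 [v3 [uv3 e3]]] := indic_ocitvT_slab (ler0n R n) G3.
      have uv : le3 (u1, u2, u3) (v1, v2, v3) by apply/and3P.
      rewrite -(pb _ _ uv) integral_mkcond; apply: eq_integral => x _.
      rewrite patchE !pZ.
      have -> : (x \in fibers A1 A2 A3) = [&& x.1.1 \in A1, x.1.2 \in A2 & x.2 \in A3].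
        by apply/idP/and3P; rewrite !inE.
      rewrite /box /= e1 e2 e3.
      case: (_ \in A1) => /=; last by rewrite !mul0r mulr0.
      case: (_ \in A2) => /=; last by rewrite mulr0 mul0r mulr0.
      by case: (_ \in A3) => //=; rewrite !mulr0.
    have := @integral_ae_eq _ _ _ L3 setT measurableT (fun _ => 0%E) _ Ip (measurable_cst _).
    move=> H; have {}H := H (fun E _ mE => etrans (hA E mE) (esym (integral0 _ _))).
    by apply: ae_mono H => x /(_ I) [].
  have [I1 I2] := Ic.
  have R0 := part (fun z => complex.Re z) erefl _ I1 _.
  have J0 := part (fun z => complex.Im z) erefl _ I2 _.
  apply: (ae_mono2 _ (R0 _ _) (J0 _ _)).
  - by move=> x h1 h2; exact: eq_complexP.
  - by move=> z r; rewrite ReM /= mulr0 subr0.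
  - move=> u v uv; have := c0 _ _ uv.
    have [J _] : cintegrable L3 (fun x => c x * (box u v x)%:C).
      by apply: cintegrable_mul => //; exact: sqint_box.
    by move=> [+ _]; rewrite /Rintegral => h; rewrite -(fineK (integrable_fin_num _ J))// h.
  - by move=> z r; rewrite ImM /= mulr0 add0r.
  - move=> u v uv; have := c0 _ _ uv.
    have [_ J] : cintegrable L3 (fun x => c x * (box u v x)%:C).
      by apply: cintegrable_mul => //; exact: sqint_box.
    by move=> [_ +]; rewrite /Rintegral => h; rewrite -(fineK (integrable_fin_num _ J))// h.
have := @ae_foralln _ _ _ L3 (fun (n : nat) x => c x * (box (w' n) (w n) x)%:C = 0) key.
apply: ae_mono => x hx.
pose M := `|x.1.1| + `|x.1.2| + `|x.2|.
have := hx (Num.truncn M).+1.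
have hM : M < (Num.truncn M).+1%:R by rewrite truncnS_gt.
have s (t : R) : `|t| <= M -> slab (- (Num.truncn M).+1%:R) (Num.truncn M).+1%:R t = 1.
  move=> tM; rewrite /slab indicE mem_setE in_itv/=.
  have := le_lt_trans tM hM; rewrite ltr_norml => /andP[-> /ltW ->].
  by [].
rewrite /box /= !s ?mulr1//.
- by rewrite /M lerDr addr_ge0.
- by rewrite /M -addrA addrCA lerDl addr_ge0.
- by rewrite /M -addrA lerDl addr_ge0.
Qed.
End BoxUnique.

(** * The Fourier transform of square-integrable functions *)

Section FourierL2.
Context {R : realType}.
Local Notation L3 := (@leb3 R).
Implicit Types (a b f h F : R3 R -> R[i]) (x : R3 R) (s : R).

Lemma measurable_enorm3 : measurable_fun setT (@enorm3 R).
Proof.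
have md : measurable_fun setT (fun x : R3 R => dot3 x x) by exact: measurable_dot3.
by apply: (measurableT_comp _ md); apply: continuous_measurable_fun; exact: sqrt_continuous.
Qed.

Lemma enorm3_ge_coord (i : R3 R -> R) x :
  i x ^+ 2 <= dot3 x x -> `|i x| <= enorm3 x.
Proof. by move=> h; rewrite -sqrtr_sqr; exact: ler_wsqrtr. Qed.

Lemma enorm3_coords x : [/\ `|x.1.1| <= enorm3 x, `|x.1.2| <= enorm3 x & `|x.2| <= enorm3 x].
Proof.
have h1 := sqr_ge0 x.1.1; have h2 := sqr_ge0 x.1.2; have h3 := sqr_ge0 x.2.
split.
- by apply: (enorm3_ge_coord (i := fun x => x.1.1)); rewrite /dot3 -!expr2; lra.
- by apply: (enorm3_ge_coord (i := fun x => x.1.2)); rewrite /dot3 -!expr2; lra.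
- by apply: (enorm3_ge_coord (i := fun x => x.2)); rewrite /dot3 -!expr2; lra.
Qed.

Definition ball_indic (r : R) x : R[i] := if enorm3 x <= r then 1 else 0.

Lemma measurable_ball r : measurable_fun setT (fun x : R3 R => enorm3 x <= r).
Proof. by apply: measurable_fun_ler; [exact: measurable_enorm3|exact: measurable_cst]. Qed.

Lemma cmeas_ball_indic r : cmeasurable (ball_indic r).
Proof. by apply: cmeas_if; [exact: measurable_ball|exact: cmeas_cst|exact: cmeas_cst]. Qed.

Lemma ball_indic_le_box r : exists u v, le3 u v /\
  forall x, normc (ball_indic r x) <= box u v x.
Proof.
(* The summand 1 makes the inclusion strict, because the boxes lack their lower faces. *)
pose M := `|r| + 1.
have M0 : 0 <= M by rewrite /M addr_ge0.
exists (- M, - M, - M), (M, M, M); split.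
  have h : - M <= M by rewrite (@le_trans _ _ 0)// oppr_le0.
  by rewrite /le3/= !h.
move=> x; rewrite /ball_indic; case: ifP => xr; last by rewrite (normc_real 0) normr0 box_ge0.
rewrite (normc_real 1) normr1.
have [x1 x2 x3] := enorm3_coords x.
have sl t : `|t| <= enorm3 x -> slab (- M) M t = 1.
  move=> tx; rewrite /slab indicE mem_setE in_itv/=.
  have : `|t| < M by rewrite (le_lt_trans tx)// (le_lt_trans xr)// (le_lt_trans (ler_norm r))// ltrDl.
  by rewrite ltr_norml => /andP[-> /ltW ->].
by rewrite /box/= !sl// !mulr1.
Qed.

Lemma sqint_ball_indic r : sqint L3 (ball_indic r).
Proof.
have [u [v [uv h]]] := ball_indic_le_box r.
apply: (sqint_le (mu := L3) (cmeas_ball_indic r) (sqint_box uv)) => x.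
rewrite sqc_real -normc_sq; apply: lerXn2r; rewrite ?nnegrE//; first exact: normc_ge0.
exact: box_ge0.
Qed.

Lemma truncateE n f x : truncate n f x = ball_indic n%:R x * f x.
Proof. by rewrite /truncate /ball_indic; case: ifP; rewrite ?mul1r ?mul0r. Qed.

Lemma cintegrable_truncate n f : sqint L3 f -> cintegrable L3 (truncate n f).
Proof.
move=> sf; rewrite (_ : truncate n f = (fun x => ball_indic n%:R x * f x)).
  exact: (cintegrable_mul (sqint_ball_indic _) sf).
by apply/funext => x; rewrite truncateE.
Qed.

Lemma cmeas_truncate n f : cmeasurable f -> cmeasurable (truncate n f).
Proof. by move=> mf; apply: cmeas_if; [exact: measurable_ball|exact: mf|exact: cmeas_cst]. Qed.

Lemma sqint_truncate n f : sqint L3 f -> sqint L3 (truncate n f).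
Proof.
move=> sf; apply: (sqint_le (mu := L3) (cmeas_truncate n (proj1 sf)) sf) => x.
by rewrite /truncate; case: ifP => // _; rewrite sqc0 sqc_ge0.
Qed.

(** At each point the truncations are eventually equal to [f], and the square of the error is
    dominated by that of [f]. *)
Lemma n2cvg_truncate f : sqint L3 f -> n2cvg L3 (fun n => truncate n f) f.
Proof.
move=> [mf nf] e e0.
pose g (n : nat) x := (sqc (truncate n f x - f x))%:E.
have mg n : measurable_fun setT (g n).
  by apply: meas_sqcE; apply: cmeasB => //; exact: cmeas_truncate.
have If : L3.-integrable setT (fun x => (sqc (f x))%:E).
  apply/integrableP; split; first exact: meas_sqcE.
  apply: le_lt_trans nf; rewrite le_eqVlt; apply/orP; left; apply/eqP.
  by apply: eq_integral => x _; rewrite abse_EFin ger0_norm// sqc_ge0.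
have H1 : {ae L3, forall x, setT x -> g n x @[n --> \oo] --> (0%:E : \bar R)}.
  apply: aeW => x _; apply: cvg_near_cst.
  exists (Num.truncn (enorm3 x)).+1 => // n /= hn.
  rewrite /g /truncate ifT ?subrr ?sqc0//.
  by rewrite (le_trans (ltW (truncnS_gt _)))// ler_nat.
have H2 : {ae L3, forall x n, setT x -> (`|g n x| <= (sqc (f x))%:E)%E}.
  apply: aeW => x n _; rewrite /g abse_EFin ger0_norm ?sqc_ge0// lee_fin /truncate.
  by case: ifP => _; rewrite ?subrr ?sqc0 ?sqc_ge0// sub0r sqcN.
have [_ _ C] := dominated_convergence (mu := L3) measurableT mg (measurable_cst _) H1 If H2.
have {}C : (\int[L3]_x g n x)%E @[n --> \oo] --> (0%:E : \bar R).
  by rewrite -[X in _ --> X](integral0 L3 setT); exact: C.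
have /fine_cvgP[finC /cvgrPdist_le /(_ _ e0)] := C.
move=> h; have [N _ hN] := filterI finC h.
exists N => n Nn; have [/= f1 f2] := hN n Nn.
rewrite /n2 -[X in (X <= _)%E](fineK f1) lee_fin.
by move: f2; rewrite sub0r normrN; apply: le_trans; exact: ler_norm.
Qed.

Lemma cmeas_phase1 s x : cmeasurable (fun y : R3 R => cis (s * dot3 x y)).
Proof.
apply: cmeas_cis; apply: measurable_funM; first exact: measurable_cst.
by apply: measurable_dot3; [exact: measurable_cst|exact: measurable_id].
Qed.

Lemma cintegrable_phase s a x : cintegrable L3 a ->
  cintegrable L3 (fun y => cis (s * dot3 x y) * a y).
Proof.
by move=> Ia; apply: (cintegrableM (M := 1) Ia (cmeas_phase1 s x)) => y; rewrite normc_cis.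
Qed.

Lemma oscB s a b : cintegrable L3 a -> cintegrable L3 b ->
  osc s (fun x => a x - b x) = (fun x => osc s a x - osc s b x).
Proof.
move=> Ia Ib; apply/funext => x; rewrite /osc -cintegralB.
- by apply: eq_cintegral => y; rewrite mulrBr.
- exact: cintegrable_phase.
- exact: cintegrable_phase.
Qed.

Lemma cintegrableB a b : cintegrable L3 a -> cintegrable L3 b ->
  cintegrable L3 (fun x => a x - b x).
Proof.
move=> Ia Ib; rewrite (_ : (fun x => _) = (fun x => a x + (-1) * b x)).
  by apply: cintegrableD => //; exact: cintegrableZ.
by apply/funext => x; rewrite mulN1r.
Qed.

Let P3 : R := (2 * pi) ^+ 3.

Lemma pi3_gt0 : 0 < P3.
Proof. by rewrite exprn_gt0// mulr_gt0// pi_gt0. Qed.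

Lemma n2_oscB s a b (e : R) : s ^+ 2 = 1 -> cintegrable L3 a -> cintegrable L3 b ->
  (n2 L3 (fun x => a x - b x)%R <= (P3^-1 * e)%R%:E)%E ->
  (n2 L3 (fun x => osc s a x - osc s b x)%R <= e%:E)%E.
Proof.
move=> s2 Ia Ib h; rewrite -(oscB s Ia Ib).
apply: le_trans (plancherel_le s2 (cintegrableB Ia Ib)) _.
have p0 := pi3_gt0.
apply: (@le_trans _ _ (P3%:E * (P3^-1 * e)%R%:E)%E).
  by apply: lee_wpmul2l => //; rewrite lee_fin ltW.
by rewrite -EFinM mulrA divff ?mul1r// gt_eqF.
Qed.

(** A relation rather than a function, since the limit is determined only almost everywhere: it
    covers any representative, in particular the one chosen by [xget] in [L2_ext]. *)
Definition osc2 s h F : Prop :=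
  sqint L3 F /\ n2cvg L3 (fun n => osc s (truncate n h)) F.

Lemma osc2_exists s h : s ^+ 2 = 1 -> sqint L3 h -> exists F, osc2 s h F.
Proof.
move=> s2 sh.
have It n := cintegrable_truncate n sh.
apply: (L2_complete (mu := L3) (f := fun n => osc s (truncate n h))) => [n|e e0]; first by apply: sqint_osc => //; exact: sqint_truncate.
have p0 := pi3_gt0.
(* [n2_triangle] doubles the sum of the two errors, so each gets a quarter. *)
have e'0 : 0 < 4^-1 * (P3^-1 * e) by rewrite !mulr_gt0 ?invr_gt0.
have [N hN] := n2cvg_truncate sh e'0.
exists N => n m Nn nm; apply: n2_oscB => //.
have m0 k := cmeas_truncate k (proj1 sh).
apply: le_trans (n2_triangle L3 (m0 n) (proj1 sh) (m0 m)) _.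
rewrite (n2_sym L3 h).
apply: (@le_trans _ _ (2%:E * ((4^-1 * (P3^-1 * e))%R%:E + (4^-1 * (P3^-1 * e))%R%:E))%E).
  by apply: lee_wpmul2l; [rewrite lee_fin|apply: leeD; apply: hN => //; exact: leq_trans nm].
by rewrite -EFinD -EFinM lee_fin; lra.
Qed.

(** The multiplication formula [osc_swap] for truncations of [h], extended by density. *)
Lemma osc2_pairing s h F b : s ^+ 2 = 1 -> sqint L3 h -> osc2 s h F ->
  cintegrable L3 b -> sqint L3 b ->
  cintegral L3 (fun x => F x * b x) = cintegral L3 (fun x => h x * osc s b x).
Proof.
move=> s2 sh [sF cF] Ib sb.
have sob := sqint_osc s2 Ib sb.
apply: (pairing_limit sF sb sh sob).
move=> e e0; have [N hN] := cF e e0; have [M hM] := n2cvg_truncate sh e0.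
have It := cintegrable_truncate (maxn N M) sh.
exists (osc s (truncate (maxn N M) h)), (truncate (maxn N M) h); split.
- by apply: sqint_osc => //; exact: sqint_truncate.
- exact: sqint_truncate.
- by rewrite n2_sym; apply: hN; exact: leq_maxl.
- by rewrite n2_sym; apply: hM; exact: leq_maxr.
- rewrite (osc_swap s It Ib); apply: eq_cintegral => x; exact: mulrC.
Qed.

Lemma osc2_L1 s h : s ^+ 2 = 1 -> cintegrable L3 h -> sqint L3 h -> osc2 s h (osc s h).
Proof.
move=> s2 Ih sh; split; first exact: sqint_osc.
move=> e e0; have e1 : 0 < P3^-1 * e by rewrite mulr_gt0// invr_gt0 pi3_gt0.
have [N hN] := n2cvg_truncate sh e1.
exists N => n Nn; apply: n2_oscB => //; first exact: cintegrable_truncate.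
exact: hN.
Qed.

Lemma ae_eq_boxes F f : sqint L3 F -> sqint L3 f ->
  (forall u v, le3 u v -> cintegral L3 (fun x => F x * (box u v x)%:C) =
                          cintegral L3 (fun x => f x * (box u v x)%:C)) ->
  {ae L3, forall x, F x = f x}.
Proof.
move=> sF sf h.
have H := ae_eq0_boxes (sqintB sF sf) _.
apply: (ae_mono _ (H _)) => [x /subr0_eq//|u v uv].
rewrite -[RHS](subrr (cintegral L3 (fun x => F x * (box u v x)%:C))).
rewrite {2}(h _ _ uv) -cintegralB; try by apply: cintegrable_mul => //; exact: sqint_box.
by apply: eq_cintegral => x; rewrite mulrBl.
Qed.

Lemma sqintZ (z : R[i]) f : sqint L3 f -> sqint L3 (fun x => z * f x).
Proof.
move=> [mf nf]; split; first by apply: cmeasM => //; exact: cmeas_cst.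
by rewrite (n2Z L3 z mf) lte_mul_pinfty// lee_fin sqc_ge0.
Qed.

Lemma sign1 : (1 : R) ^+ 2 = 1. Proof. by rewrite expr1n. Qed.
Lemma signN1 : (-1 : R) ^+ 2 = 1. Proof. by rewrite sqrrN expr1n. Qed.

(** Inversion is tested against boxes: [osc2_pairing] moves the outer transform to the box, and
    [parseval_box] evaluates the resulting pairing for the truncations of [h]. *)
Lemma osc2_inv h F1 F2 : sqint L3 h -> osc2 1 h F1 -> osc2 (-1) F1 F2 ->
  {ae L3, forall x, F2 x = P3%:C * h x}.
Proof.
move=> sh o1 o2; have [sF1 c1] := o1; have [sF2 _] := o2.
apply: ae_eq_boxes => // [|u v uv]; first exact: sqintZ.
have Ib := cintegrable_box uv; have sb := sqint_box uv.
rewrite (osc2_pairing signN1 sF1 o2 Ib sb).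
transitivity (cintegral L3 (fun x => h x * (P3%:C * (box u v x)%:C))); last first.
  by apply: eq_cintegral => x; rewrite mulrCA mulrA.
apply: (pairing_limit sF1 (sqint_osc signN1 Ib sb) sh (sqintZ _ sb)) => e e0.
have [N hN] := c1 e e0; have [M hM] := n2cvg_truncate sh e0.
have It := cintegrable_truncate (maxn N M) sh.
have st := sqint_truncate (maxn N M) sh.
exists (osc 1 (truncate (maxn N M) h)), (truncate (maxn N M) h); split.
- exact: (sqint_osc sign1 It st).
- exact: st.
- by rewrite n2_sym; apply: hN; exact: leq_maxl.
- by rewrite n2_sym; apply: hM; exact: leq_maxr.
- rewrite (parseval_box uv It st) -cintegralZ; last exact: cintegrable_mul.
  by apply: eq_cintegral => x; rewrite mulrCA.
Qed.

(** The loss of a factor 2 against Plancherel's identity comes from [n2D_le]; the constant of the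
    final estimate absorbs it. *)
Lemma osc2_norm s h F : s ^+ 2 = 1 -> sqint L3 h -> osc2 s h F ->
  (n2 L3 F <= (2 * P3)%:E * n2 L3 h)%E.
Proof.
move=> s2 sh [sF cF].
have p0 := pi3_gt0.
apply/lee_addgt0Pr => e e0.
have e2 : 0 < 2^-1 * e by rewrite mulr_gt0// invr_gt0.
have [N hN] := cF _ e2; have {}hN := hN N (leqnn N).
have mt := cmeas_truncate N (proj1 sh).
have mo := cmeas_osc s mt.
have := n2D_le L3 (cmeasB (proj1 sF) mo) mo.
rewrite (_ : (fun x => _) = F); last by apply/funext => x; rewrite subrK.
move=> /le_trans; apply.
rewrite muleDr//; last first.
  by apply: ge0_adde_def; rewrite inE; exact: n2_ge0.
rewrite addeC; apply: leeD.
  rewrite EFinM -muleA; apply: lee_wpmul2l; first by rewrite lee_fin.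
  apply: le_trans (plancherel_le s2 (cintegrable_truncate N sh)) _.
  apply: lee_wpmul2l; first by rewrite lee_fin ltW.
  apply: n2_le => //; first exact: (proj1 sh).
  by move=> x; rewrite /truncate; case: ifP => // _; rewrite sqc0 sqc_ge0.
rewrite n2_sym; apply: (@le_trans _ _ (2%:E * (2^-1 * e)%:E)%E).
  by apply: lee_wpmul2l; rewrite ?lee_fin.
by rewrite -EFinM lee_fin; lra.
Qed.

Lemma oscZ (z : R[i]) s a x : cintegrable L3 a -> osc s (fun y => z * a y) x = z * osc s a x.
Proof.
move=> Ia; rewrite /osc -cintegralZ; last exact: cintegrable_phase.
by apply: eq_cintegral => y; rewrite mulrCA.
Qed.

Lemma osc2Z (z : R[i]) s h F : sqint L3 h -> osc2 s h F ->
  osc2 s (fun x => z * h x) (fun x => z * F x).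
Proof.
move=> sh [sF cF]; split; first exact: sqintZ.
move=> e e0.
(* Adding 1 to [sqc z] avoids dividing by zero when [z = 0]. *)
have z0 : 0 < (sqc z + 1)^-1 * e by rewrite mulr_gt0// invr_gt0 ltr_wpDl// sqc_ge0.
have [N hN] := cF _ z0; exists N => n /hN hn.
have -> : (fun x => osc s (truncate n (fun y => z * h y)) x - z * F x) =
    (fun x => z * (osc s (truncate n h) x - F x)).
  have tZ : truncate n (fun y => z * h y) = (fun y => z * truncate n h y).
    by apply/funext => y; rewrite !truncateE mulrCA.
  have It := cintegrable_truncate n sh.
  by apply/funext => x; rewrite mulrBr -(oscZ z s x It) -tZ.
rewrite n2Z; last first.
  apply: cmeasB (proj1 sF); apply: cmeas_osc; exact: cmeas_truncate (proj1 sh).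
apply: (@le_trans _ _ ((sqc z)%:E * ((sqc z + 1)^-1 * e)%:E)%E).
  by apply: lee_wpmul2l; rewrite ?lee_fin ?sqc_ge0.
have c0 : 0 < sqc z + 1 by rewrite ltr_wpDl// sqc_ge0.
rewrite -EFinM lee_fin mulrA ler_piMl ?(ltW e0)// ler_pdivrMr// mul1r lerDl.
exact: ler01.
Qed.

Lemma L2norm_le d (T : measurableType d) (mu : {measure set T -> \bar R})
    (g : T -> R[i]) (r : R) : 0 <= r ->
  (L2norm mu g <= r%:E)%E <-> (n2 mu g <= (r ^+ 2)%:E)%E.
Proof.
move=> r0; have L0 : (0 <= L2norm mu g)%E by exact: Lnorm_ge0.
split => h.
  rewrite n2_L2norm -[X in (_ <= X)%E]/((r ^+ 2)%:E) -powR_mulrn// -poweR_EFin.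
  by apply: gt0_ler_poweR => //; rewrite in_itv/= ?leey ?andbT ?lee_fin.
rewrite L2norm_n2; have -> : r%:E = ((r ^+ 2)%:E `^ 2^-1)%E.
  by rewrite poweR_EFin powR12_sqrt ?sqr_ge0// sqrtr_sqr ger0_norm.
by apply: gt0_ler_poweR => //; rewrite in_itv/= ?leey ?andbT ?n2_ge0 ?lee_fin ?sqr_ge0.
Qed.

Lemma ge0_cvge0P (u : (\bar R)^nat) : (forall n, 0 <= u n)%E ->
  (u @ \oo --> 0%E) <-> (forall e : R, 0 < e -> exists N, forall n, (N <= n)%N -> (u n <= e%:E)%E).
Proof.
move=> u0; split.
  move=> /fine_cvgP[finC /cvgrPdist_le uC] e e0.
  have [N _ hN] := filterI finC (uC _ e0).
  exists N => n Nn; have [/= f1 f2] := hN n Nn.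
  rewrite -(fineK f1) lee_fin; move: f2; rewrite sub0r normrN.
  by apply: le_trans; exact: ler_norm.
move=> h; apply/fine_cvgP; split.
  have [N hN] := h 1 ltr01; exists N => // n /= Nn.
  by rewrite ge0_fin_numE// (le_lt_trans (hN n Nn))// ltry.
apply/cvgrPdist_le => e e0; have [N hN] := h e e0; exists N => // n /= Nn.
rewrite sub0r normrN ger0_norm ?fine_ge0//.
rewrite -lee_fin fineK ?hN//.
by rewrite ge0_fin_numE// (le_lt_trans (hN n Nn))// ltry.
Qed.

Lemma n2cvg_L2norm (f : nat -> R3 R -> R[i]) F :
  ((fun n => L2norm L3 (fun x => F x - f n x)) @ \oo --> 0%E) <-> n2cvg L3 f F.
Proof.
have L0 n : (0 <= L2norm L3 (fun x => F x - f n x)%R)%E by exact: Lnorm_ge0.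
split.
  move=> /(ge0_cvge0P L0) h e e0.
  have [N hN] := h (Num.sqrt e) ltac:(by rewrite sqrtr_gt0).
  exists N => n /hN /(L2norm_le _ _ (sqrtr_ge0 _)).
  by rewrite sqr_sqrtr ?(ltW e0)// n2_sym.
move=> h; apply/(ge0_cvge0P L0) => e e0.
have [N hN] := h (e ^+ 2) ltac:(by rewrite exprn_gt0).
exists N => n /hN hn; apply/(L2norm_le _ _ (ltW e0)).
by rewrite n2_sym.
Qed.

(** Both transforms of the statement are multiples of [osc]. On L1 the extension is the integral
    itself, where [osc2_L1] applies; elsewhere completeness shows that [xget] chooses from a
    nonempty set, and every element of that set is a valid limit. *)
Lemma osc2_L2_ext (A : (R3 R -> R[i]) -> R3 R -> R[i]) (z : R[i]) s h :
  s ^+ 2 = 1 -> z != 0 -> (forall f, A f = (fun x => z * osc s f x)) -> sqint L3 h ->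
  osc2 s h (fun x => z^-1 * L2_ext A h x).
Proof.
move=> s2 z0 AE sh.
have cancel F : (fun x => z^-1 * (z * F x)) = F.
  by apply/funext => x; rewrite mulrA mulVf// mul1r.
rewrite /L2_ext; case: asboolP => Ih; first by rewrite AE cancel; exact: osc2_L1.
set S := [set F | _ /\ _].
have [F0 o0] := osc2_exists s2 sh.
have S0 : S (fun x => z * F0 x).
  split; first by apply/inL2P; apply: sqintZ; case: o0.
  apply/n2cvg_L2norm => e e0.
  have zz : 0 < (sqc z + 1)^-1 * e by rewrite mulr_gt0// invr_gt0 ltr_wpDl// sqc_ge0.
  have [N hN] := proj2 (osc2Z z sh o0) e e0.
  exists N => n /hN; rewrite AE.
  rewrite (_ : (fun x => z * osc s (truncate n h) x - _) =
    (fun x => osc s (truncate n (fun y => z * h y)) x - z * F0 x))//.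
  apply/funext => x; congr (_ - _).
  rewrite -oscZ; last exact: cintegrable_truncate.
  by congr (osc s _ x); apply/funext => y; rewrite !truncateE mulrCA.
have [sF cF] := xgetPex (fun _ => 0) (ex_intro _ _ S0).
set F := xget _ _ in sF cF *.
have {}sF : sqint L3 F by apply/inL2P.
move/n2cvg_L2norm: cF => cF.
split; first exact: sqintZ.
move=> e e0; have c0 : 0 < sqc z^-1 + 1 by rewrite ltr_wpDl// sqc_ge0.
have [N hN] := cF ((sqc z^-1 + 1)^-1 * e) ltac:(by rewrite mulr_gt0// invr_gt0).
exists N => n /hN; rewrite AE => hn.
have -> : (fun x => osc s (truncate n h) x - z^-1 * F x) =
    (fun x => z^-1 * (z * osc s (truncate n h) x - F x)).
  by apply/funext => x; rewrite mulrBr mulrA mulVf// mul1r.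
rewrite n2Z; last first.
  apply: cmeasB; last by case: sF.
  apply: cmeasM; first exact: cmeas_cst.
  by apply: cmeas_osc; exact: cmeas_truncate (proj1 sh).
apply: (@le_trans _ _ ((sqc z^-1)%:E * ((sqc z^-1 + 1)^-1 * e)%R%:E)%E).
  by apply: lee_wpmul2l; rewrite ?lee_fin ?sqc_ge0.
rewrite -EFinM lee_fin mulrA ler_piMl ?(ltW e0)// ler_pdivrMr// mul1r lerDl.
exact: ler01.
Qed.

Lemma fourier_intE f : fourier_int f = osc (-1) f.
Proof. by apply/funext => xi; apply: eq_cintegral => x; rewrite mulN1r dot3C. Qed.

Lemma inv_fourier_intE f : inv_fourier_int f = (fun x => (P3^-1)%:C * osc 1 f x).
Proof.
by apply/funext => x; rewrite /inv_fourier_int /osc; congr (_ * _);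
  apply: eq_cintegral => y; rewrite mul1r.
Qed.

Lemma P3C_neq0 : P3%:C != 0.
Proof. by rewrite (fmorph_eq0 (real_complex R)) gt_eqF// pi3_gt0. Qed.

Lemma osc2_fourier f : sqint L3 f -> osc2 (-1) f (fourier f).
Proof.
move=> sf.
have := osc2_L2_ext (A := @fourier_int R) (z := 1) signN1 (oner_neq0 _) _ sf.
rewrite invr1; under [X in osc2 _ _ X]eq_fun do rewrite mul1r.
by apply => g; rewrite fourier_intE; apply/funext => x; rewrite mul1r.
Qed.

Lemma osc2_inv_fourier f : sqint L3 f -> osc2 1 f (fun x => P3%:C * inv_fourier f x).
Proof.
move=> sf.
have P0 : (P3^-1)%:C != 0 :> R[i].
  by rewrite (fmorph_eq0 (real_complex R)) invr_eq0 gt_eqF// pi3_gt0.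
have := osc2_L2_ext (A := @inv_fourier_int R) sign1 P0 inv_fourier_intE sf.
by rewrite (fmorphV (real_complex R)) invrK.
Qed.

Lemma sqint_fourier f : sqint L3 f -> sqint L3 (fourier f).
Proof. by move=> /osc2_fourier []. Qed.

Lemma sqint_inv_fourier f : sqint L3 f -> sqint L3 (inv_fourier f).
Proof.
move=> /osc2_inv_fourier [/(sqintZ (P3%:C)^-1) h _]; move: h.
by under [X in sqint _ X -> _]eq_fun do rewrite mulrA mulVf ?P3C_neq0// mul1r.
Qed.

Lemma fourier_inv_fourier h : sqint L3 h ->
  {ae L3, forall x, fourier (inv_fourier h) x = h x}.
Proof.
move=> sh; have si := sqint_inv_fourier sh.
have := osc2_inv sh (osc2_inv_fourier sh) (osc2Z P3%:C si (osc2_fourier si)).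
by apply: ae_mono => x /(mulfI P3C_neq0).
Qed.

Lemma inv_fourier_L1 h : cintegrable L3 h -> inv_fourier h = inv_fourier_int h.
Proof. by move=> Ih; rewrite /inv_fourier /L2_ext; case: asboolP. Qed.

Lemma fourier_L1 h : cintegrable L3 h -> fourier h = fourier_int h.
Proof. by move=> Ih; rewrite /fourier /L2_ext; case: asboolP. Qed.

(** The reverse of [plancherel_le]: the opposite transform recovers [P3%:C * h] from [osc 1 h] and
    is bounded by [osc2_norm]. *)
Lemma n2_le_osc h : cintegrable L3 h -> sqint L3 h ->
  (n2 L3 h <= (2 / P3)%:E * n2 L3 (osc 1 h))%E.
Proof.
move=> Ih sh; have p0 := pi3_gt0.
have o1 := osc2_L1 sign1 Ih sh.
have [F2 o2] := osc2_exists signN1 (proj1 o1).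
have F2E := osc2_inv sh o1 o2.
have := osc2_norm signN1 (proj1 o1) o2.
rewrite (n2_ae (mu := L3) (proj1 (proj1 o2)) (proj1 (sqintZ P3%:C sh)) F2E).
rewrite (n2Z L3 _ (proj1 sh)) sqc_real => H.
have -> : n2 L3 h = ((P3 ^- 2)%:E * ((P3 ^+ 2)%:E * n2 L3 h))%E.
  by rewrite muleA -EFinM mulVf ?mul1e// expf_neq0// gt_eqF.
have -> : ((2 / P3)%:E * n2 L3 (osc 1 h) = (P3 ^- 2)%:E * ((2 * P3)%:E * n2 L3 (osc 1 h)))%E.
  by rewrite muleA -EFinM; congr (_%:E * _)%E; field; rewrite gt_eqF.
by apply: lee_wpmul2l => //; rewrite lee_fin invr_ge0 exprn_ge0// ltW.
Qed.

(** The identity of [parseval_box] for general [b], available now that inversion is known; it yields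
    the convolution theorem. *)
Lemma parseval_osc a b : cintegrable L3 a -> sqint L3 a -> cintegrable L3 b -> sqint L3 b ->
  cintegral L3 (fun x => osc 1 a x * osc (-1) b x) =
  P3%:C * cintegral L3 (fun x => a x * b x).
Proof.
move=> Ia sa Ib sb.
have o1 := osc2_L1 sign1 Ia sa; have so1 := proj1 o1.
have [F2 o2] := osc2_exists signN1 so1.
rewrite -(osc2_pairing signN1 so1 o2 Ib sb) -cintegralZ; last exact: cintegrable_mul.
apply: ae_eq_cintegral.
- by apply: cmeasM; [exact: (proj1 (proj1 o2))|exact: (proj1 sb)].
- apply: cmeasM; first exact: cmeas_cst.
  by apply: cmeasM; [exact: (proj1 sa)|exact: (proj1 sb)].
- by apply: ae_mono (osc2_inv sa o1 o2) => x ->; rewrite mulrA.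
Qed.
End FourierL2.

(** * Radial functions *)

Section Radial.
Context {R : realType}.
Local Notation L3 := (@leb3 R).
Implicit Types (f h F : R3 R -> R[i]) (x xi : R3 R) (s : R).

Lemma preserves3_ae (phi : R3 R -> R3 R) (P : R3 R -> Prop) : preserves3 phi ->
  {ae L3, forall x, P x} -> {ae L3, forall x, P (phi x)}.
Proof.
move=> [mphi pphi] [A [mA A0 sA]].
have mB : measurable (phi @^-1` A) by rewrite -[X in measurable X]setTI; exact: mphi.
exists (phi @^-1` A); split => //; last by move=> x nx; exact: sA.
rewrite -[LHS](mul1e) -integral_cst// integral_mkcond.
have E0 : (\int[L3]_x (\1_A x)%:E = 0)%E.
  by rewrite integral_indic// setIT; exact: A0.
have <- : (\int[L3]_x (\1_A (phi x))%:E = 0)%E.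
  have mI : measurable_fun setT (fun x : R3 R => (\1_A x)%:E : \bar R).
    by apply/measurable_EFinP; exact: measurable_indic.
  have pI (x : R3 R) : (0 <= (\1_A x)%:E :> \bar R)%E by rewrite lee_fin indicE.
  by rewrite (pphi _ mI pI).
apply: eq_integral => x _; rewrite patchE indicE.
have -> : (x \in phi @^-1` A) = (phi x \in A) by apply/idP/idP; rewrite !inE.
by case: (_ \in _).
Qed.

Lemma preserves3_integral (phi : R3 R -> R3 R) (r : R3 R -> R) : preserves3 phi ->
  measurable_fun setT r -> \int[L3]_x r (phi x) = \int[L3]_x r x.
Proof.
move=> [mphi pphi] mr; have mE : measurable_fun setT (EFin \o r) by exact/measurable_EFinP.
have pp := pphi _ (measurable_funepos mE) (fun x => funepos_ge0 _ x).
have pn := pphi _ (measurable_funeneg mE) (fun x => funeneg_ge0 _ x).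
transitivity (fine (\int[L3]_x (EFin \o r)^\+ (phi x) - \int[L3]_x (EFin \o r)^\- (phi x))%E).
  rewrite /Rintegral [in LHS]integralE; congr fine.
  have -> : (\int[L3]_x (EFin \o r)^\+ (phi x) =
      \int[L3]_x (fun x => (r (phi x))%:E)^\+ x)%E.
    by apply: eq_integral => x _; rewrite !funeposE.
  have -> // : (\int[L3]_x (EFin \o r)^\- (phi x) =
      \int[L3]_x (fun x => (r (phi x))%:E)^\- x)%E.
  by apply: eq_integral => x _; rewrite !funenegE.
by rewrite pp pn /Rintegral [in RHS]integralE.
Qed.

Lemma preserves3_cintegral (phi : R3 R -> R3 R) h : preserves3 phi ->
  cmeasurable h -> cintegral L3 (fun x => h (phi x)) = cintegral L3 h.
Proof.
move=> pphi [m1 m2]; apply: eq_complexP => /=.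
  exact: (preserves3_integral pphi m1).
exact: (preserves3_integral pphi m2).
Qed.

(** Rotating the variable of integration shows this at every [xi]: the null set where [f] fails to
    be radial is invisible to an integral. *)
Lemma osc_radial s f xi : cmeasurable f -> radial f -> osc s f xi = osc s f ((0, 0, enorm3 xi) : R3 R).
Proof.
move=> mf [phi fphi].
have [rho [prho rhoN rhoxi]] := rotate_to_axis xi.
have m0 y : cmeasurable (fun x => cis (s * dot3 y x) * f x).
  by apply: cmeasM => //; exact: cmeas_phase1.
rewrite /osc -(preserves3_cintegral prho (m0 xi)).
apply: ae_eq_cintegral; [|exact: m0|].
  exact: (cmeas_comp (proj1 prho) (m0 xi)).
apply: (ae_mono2 _ fphi (preserves3_ae prho fphi)) => x e1 e2.
rewrite e1 e2 /enorm3 rhoN; congr (cis (s * _) * _).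
transitivity (enorm3 xi * x.2); first by rewrite dot3C.
by rewrite [RHS]/dot3 /= !mul0r !add0r.
Qed.

Lemma radial_truncate (n : nat) (f : R3 R -> R[i]) : radial f -> radial (truncate n f).
Proof.
move=> [phi fphi]; exists (fun r => if r <= n%:R then phi r else 0).
by apply: ae_mono fphi => x fx; rewrite /truncate fx.
Qed.

(** [F] is only an L2 limit, but a subsequence of the transforms of truncations, each radial at
    every point, converges to it almost everywhere. The profile is the limit along a ray, as a
    function of the squared length used in bipolar coordinates. *)
Lemma radial_profile s f F : s ^+ 2 = 1 -> sqint L3 f -> radial f -> osc2 s f F ->
  exists (F' : R3 R -> R[i]) (A : R -> R), [/\ cmeasurable F', measurable_fun setT A,
    forall q, 0 <= A q, {ae L3, forall x, F x = F' x} &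
    forall x, sqc (F' x) = A (dot3 x x)].
Proof.
move=> s2 sf rf [[mF nF] cF].
pose G n := osc s (truncate n f).
have mG n : cmeasurable (G n) by apply: cmeas_osc; exact: cmeas_truncate (proj1 sf).
have [sub hsub] := n2cvg_ae_subsequence (mu := L3) mG mF cF.
pose p (q : R) : R3 R := (0, 0, Num.sqrt q).
have mp : measurable_fun setT p.
  apply: measurable_fun_pair; first exact: measurable_cst.
  by apply: continuous_measurable_fun; exact: sqrt_continuous.
(* The upper limit exists for every [q]; [fine] and the absolute value make the profile finite and
   nonnegative even where the subsequence diverges. *)
pose A q := `|fine (limn_esup (fun j => (sqc (G (sub j) (p q)))%:E))|.
have mA : measurable_fun setT A.
  apply: (measurableT_comp (@normr_measurable R setT)).
  apply: measurableT_comp => //; apply: measurable_fun_limn_esup => j.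
  by apply: (measurableT_comp (meas_sqcE (mG (sub j))) mp).
have md : measurable_fun setT (fun x : R3 R => dot3 x x) by exact: measurable_dot3.
have mAd : measurable_fun setT (fun x : R3 R => A (dot3 x x)) by exact: (measurableT_comp mA md).
have FA : {ae L3, forall x, sqc (F x) = A (dot3 x x)}.
  apply: ae_mono hsub => x /ccvg_sqc.
  have E j : G (sub j) x = G (sub j) (p (dot3 x x)).
    apply: osc_radial; first exact: cmeas_truncate (proj1 sf).
    exact: radial_truncate.
  under eq_fun do rewrite E.
  by move=> H; rewrite /A (cvg_limn_einf_sup H).2 /= ger0_norm// sqc_ge0.
(* On the exceptional null set the value of [F] is replaced by a real number with the prescribed
   modulus. *)
exists (fun x => if sqc (F x) == A (dot3 x x) then F x else (Num.sqrt (A (dot3 x x)))%:C), A.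
split => //.
- apply: cmeas_if => //; first by apply: measurable_fun_eqr => //; exact: meas_sqc.
  apply: cmeas_real; apply: (measurableT_comp _ mAd).
  by apply: continuous_measurable_fun; exact: sqrt_continuous.
- by move=> q; exact: normr_ge0.
- by apply: ae_mono FA => x ->; rewrite eqxx.
- move=> x; case: eqP => // _.
  by rewrite sqc_real sqr_sqrtr// normr_ge0.
Qed.
End Radial.

(** * The space-time estimate at a fixed frequency *)

Section TimeEstimate.
Context {R : realType}.
Local Notation leb := (@lebesgue_measure R).
Local Notation L3 := (@leb3 R).

(** The hypotheses bear on the interval only, because real powers are differentiated at positive
    points only. *)
Lemma ftc_itv_in (f F : R -> R) (a b : R) : a <= b ->
  (forall x, a <= x <= b -> is_derive x (1 : R) F (f x) /\ {for x, continuous f}) ->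
  (\int[leb]_(x in `[a, b]) (f x)%:E = (F b - F a)%:E)%E.
Proof.
move=> ab dF.
have cF x : a <= x <= b -> {for x, continuous F}.
  move=> /dF[d _]; apply: differentiable_continuous; apply/derivable1_diffP.
  exact: ex_derive.
move: ab; rewrite le_eqVlt => /predU1P[ab|ab].
  by rewrite ab set_itv1 integral_set1 subrr.
rewrite (@continuous_FTC2 _ f F)//.
- apply: continuous_in_subspaceT => x; rewrite inE/= in_itv/= => xab.
  by have [] := dF _ xab.
- split.
  + move=> x; rewrite in_itv/= => /andP[ax xb].
    have [d _] : is_derive x (1 : R) F (f x) /\ {for x, continuous f}.
      by apply: dF; rewrite !ltW.
    exact: ex_derive.
  + by apply: cvg_at_right_filter; apply: cF; rewrite lexx ltW.
  + by apply: cvg_at_left_filter; apply: cF; rewrite lexx ltW.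
- move=> x; rewrite in_itv/= => /andP[ax xb]; rewrite derive1E.
  have [d _] : is_derive x (1 : R) F (f x) /\ {for x, continuous f}.
    by apply: dF; rewrite !ltW.
  exact: derive_val.
Qed.

Lemma continuous_powR (a x : R) : 0 < x -> {for x, continuous (fun t : R => t `^ a)}.
Proof.
move=> x0; apply: differentiable_continuous; apply/derivable1_diffP.
by have [] := is_derive1_powR a x0.
Qed.

(** Since [a <= 1], the derivative a q^(a-1) is at least its value [m] at the right end. Inserting
    the derivative divided by [m] makes the integrand exact, and its primitive varies by at most 2
    pi, uniformly in [e] and [c]. *)
Lemma integral_poisson_powR (a e c u v : R) : 0 < e -> 0 < a -> a <= 1 -> 0 < u -> u <= v ->
  (\int[leb]_q (if (u <= q <= v)%R then (poisson e (q `^ a - c))%:E else 0) <=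
   (2 * pi / (a * v `^ (a - 1)))%:E)%E.
Proof.
move=> e0 a0 a1 u0 uv; have v0 := lt_le_trans u0 uv.
pose m := a * v `^ (a - 1).
have m0 : 0 < m by rewrite mulr_gt0// powR_gt0.
pose f (q : R) := poisson e (q `^ a - c) * (a * q `^ (a - 1)).
pose F (q : R) := 2 * atan ((q `^ a - c) / e).
have dF x : u <= x <= v -> is_derive x (1 : R) F (f x) /\ {for x, continuous f}.
  move=> /andP[ux _]; have x0 := lt_le_trans u0 ux.
  have cx (b : R) : {for x, continuous (fun t : R => t `^ b)} by exact: continuous_powR.
  split.
    have d1 := is_derive1_powR a x0.
    have d2 := is_derive_poisson c (x `^ a) e0.
    have := is_derive1_comp (g := fun t : R => t `^ a) d2 d1.
    exact.
  apply: cvgM; last by apply: cvgM; [exact: cvg_cst|exact: cx].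
  apply: (@continuous_comp _ _ _ (fun q : R => q `^ a - c) (poisson e)).
    by apply: cvgB; [exact: cx|exact: cvg_cst].
  exact: continuous_poisson.
have mP : measurable_fun setT (fun q : R => (poisson e (q `^ a - c))%:E).
  apply/measurable_EFinP; apply: (measurableT_comp (measurable_poisson e0)).
  by apply: measurable_funB; [exact: measurable_powR|exact: measurable_cst].
have mf : measurable_fun setT (fun q => (f q)%:E).
  apply/measurable_EFinP; apply: measurable_funM; first exact/measurable_EFinP.
  by apply: measurable_funM; [exact: measurable_cst|exact: measurable_powR].
have -> : (\int[leb]_q (if (u <= q <= v)%R then (poisson e (q `^ a - c))%:E else 0) =
    \int[leb]_(q in `[u, v]) (poisson e (q `^ a - c))%:E)%E.
  rewrite [RHS]integral_mkcond; apply: eq_integral_leb => q.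
  by rewrite patchE mem_setE in_itv.
apply: (@le_trans _ _ (\int[leb]_(q in `[u, v]) ((m^-1)%:E * (f q)%:E))%E).
  apply: ge0_le_integral => //.
  - by move=> q _; rewrite lee_fin poisson_ge0// ltW.
  - exact: measurable_funTS.
  - by apply: measurable_funTS; apply: emeasurable_funM => //; exact: measurable_cst.
  - move=> q; rewrite /= in_itv/= => /andP[uq qv].
    have q0 := lt_le_trans u0 uq.
    rewrite -EFinM lee_fin /f mulrCA ler_peMr ?poisson_ge0 ?(ltW e0)//.
    rewrite mulrC ler_pdivlMr// mul1r /m ler_pM2l//.
    rewrite -[a - 1]opprB !powRN lef_pV2 ?posrE ?powR_gt0//.
    by apply: ge0_ler_powR; rewrite ?nnegrE ?subr_ge0// ltW.
rewrite ge0_integralZl//; last 3 first.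
- exact: measurable_funTS.
- move=> q; rewrite /= in_itv/= => /andP[uq qv].
  rewrite lee_fin /f; apply: mulr_ge0; first exact: poisson_ge0 (ltW e0).
  by apply: mulr_ge0; [exact: ltW|exact: powR_ge0].
- by rewrite lee_fin invr_ge0 ltW.
rewrite (ftc_itv_in uv dF) -EFinM lee_fin mulrC ler_pM2r ?invr_gt0//.
have := normr_atan_gap (u `^ a) (v `^ a) e c.
by rewrite /atan_gap /F; apply: le_trans; exact: ler_norm.
Qed.

(** A condition on the squared length [q], satisfied wherever the multiplier [chi] at scale [l] is
    nonzero. *)
Definition annulus (l q : R) : bool := ((l / 2) ^+ 2 <= q <= (2 * l) ^+ 2)%R.

Lemma measurable_annulus d (T : measurableType d) l (f : T -> R) : measurable_fun setT f ->
  measurable_fun setT (fun t => (annulus l (f t))%:R : R).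
Proof.
move=> mf.
have mb : measurable_fun setT (fun t => annulus l (f t)).
  by apply: measurable_and; apply: measurable_fun_ler => //; exact: measurable_cst.
rewrite (_ : (fun t => _) = (fun t => if annulus l (f t) then 1 else 0 : R)); last first.
  by apply/funext => t; case: annulus.
by apply: measurable_fun_ifT => //; exact: measurable_cst.
Qed.

(** On the support the length is at least [l / 2], the radius given to [ge0_integral_radial_ge]. *)
Lemma annulus_mass (A : R -> R) (l : R) : 0 < l -> measurable_fun setT A ->
  (forall q, 0 <= A q) -> (forall q, ~~ annulus l q -> A q = 0) ->
  ((disc_area * (l / 2))%:E * \int[leb]_q (A q)%:E <= \int[L3]_x (A (dot3 x x))%:E)%E.
Proof.
move=> l0 mA A0 As; have l20 : 0 < l / 2 by rewrite divr_gt0.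
have := ge0_integral_radial_ge l20 (proj2 (measurable_EFinP _ _) mA) (fun q => _ : 0 <= (A q)%:E)%E.
move=> /(_ (fun q => A0 q)); apply: le_trans.
apply: lee_wpmul2l; first by rewrite lee_fin mulr_ge0 ?ltW// disc_area_gt0.
rewrite le_eqVlt; apply/orP; left; apply/eqP; apply: eq_integral_leb => q /=.
case: ifP => // /negbT h; rewrite As// /annulus.
by rewrite (negbTE h).
Qed.

Lemma outer_bound (A : R -> R) (l : R) (xi : R3 R) : 0 < l -> 0 < enorm3 xi ->
  measurable_fun setT A -> (forall q, 0 <= A q) ->
  (\int[L3]_y (A (dot3 y y) * (annulus l (dot3 (sub3 xi y) (sub3 xi y)))%:R)%:E <=
   (4 * disc_area * l)%:E * \int[leb]_q (A q)%:E)%E.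
Proof.
move=> l0 k0 mA A0; set k := enorm3 xi in k0 *.
pose G (z : R * R) := (A z.1 * (annulus l z.2)%:R)%:E.
have mG : measurable_fun setT G.
  apply/measurable_EFinP; apply: measurable_funM; first exact: (measurableT_comp mA).
  exact: measurable_annulus.
have G0 z : (0 <= G z)%E by rewrite lee_fin mulr_ge0.
rewrite (ge0_integral_bipolar k0 mG G0).
have d0 := @disc_area_gt0 R.
have c0 : 0 <= disc_area / (2 * k) :> R by rewrite divr_ge0// ?mulr_ge0 ?ltW.
have mAE : measurable_fun setT (fun q => (A q)%:E) by exact/measurable_EFinP.
have kl0 : 0 <= 8 * k * l by rewrite !mulr_ge0 ?ltW.
apply: (@le_trans _ _ ((disc_area / (2 * k))%:E * ((8 * k * l)%:E * \int[leb]_q (A q)%:E))%E).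
  apply: lee_wpmul2l; first by rewrite lee_fin.
  rewrite -ge0_integralZlT//.
  have mtri : measurable_fun setT (fun z : R * R => if triangle k z.1 z.2 then G z else 0%E).
    apply: measurable_if0 => //; apply: measurable_fun_ltr.
      apply: measurable_funX; apply: measurable_funB => //.
      by apply: measurable_funD => //; exact: measurable_cst.
    by apply: measurable_funM => //; exact: measurable_cst.
  have tri0 z : (0 <= if triangle k z.1 z.2 then G z else 0)%E by case: ifP.
  apply: le_integralT.
  - exact: (meas_eparam1 leb mtri tri0).
  - by apply: emeasurable_funM => //; exact: measurable_cst.
  - by move=> q; apply: integral_ge0 => p _; exact: (tri0 (q, p)).
  move=> q.
  (* By the symmetry of [triangle], |p + k^2 - q| < 2 k sqrt(p) <= 4 k l on the annulus. The length
     8kl cancels the 1/(2k) of the bipolar coordinates. *)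
  pose I := `[(q - k ^+ 2 - 4 * k * l)%R, (q - k ^+ 2 + 4 * k * l)%R]%classic : set R.
  have LI : leb I = (8 * k * l)%:E.
    rewrite lebesgue_measure_itv/= lte_fin ifT; first by rewrite -EFinB; congr EFin; ring.
    by rewrite ltrD2l gtrN// !mulr_gt0.
  have mI : measurable I by exact: measurable_itv.
  apply: (@le_trans _ _ (\int[leb]_p ((A q)%:E * (\1_I p)%:E))%E).
    apply: le_integralT.
    - exact: (measurableT_comp mtri (pair1_measurable q)).
    - by apply: emeasurable_funM => //; apply/measurable_EFinP; exact: measurable_indic.
    - by move=> p; exact: (tri0 (q, p)).
    move=> p /=; rewrite -EFinM; case: ifP => [tri|_]; last by rewrite lee_fin mulr_ge0// indicE.
    rewrite /G/= lee_fin; apply: ler_wpM2l => //.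
    case: (boolP (annulus l p)) => [/andP[_ pl]|_]; last by rewrite indicE.
    rewrite indicE mem_setE /I in_itv/= ler1n.
    move: tri; rewrite triangle_sym /triangle => tri.
    have : `|p + k ^+ 2 - q| < 4 * k * l.
      rewrite -(@ltr_pXn2r _ 2) ?nnegrE// ?mulr_ge0 ?ltW// real_normK ?num_real//.
      apply: lt_le_trans tri _.
      rewrite (_ : (4 * k * l) ^+ 2 = 4 * k ^+ 2 * (2 * l) ^+ 2); last by ring.
      by apply: ler_wpM2l => //; rewrite mulr_ge0// exprn_ge0// ltW.
    rewrite ltr_norml => /andP[h1 h2]; rewrite lt0b; apply/andP; split; lra.
  rewrite ge0_integralZlT//; last by apply/measurable_EFinP; exact: measurable_indic.
  have -> : (\int[leb]_p (\1_I p)%:E = (8 * k * l)%:E)%E.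
    by rewrite integral_indic// setIT; exact: LI.
  by rewrite muleC.
rewrite muleA -EFinM le_eqVlt; apply/orP; left; apply/eqP; congr (_%:E * _)%E.
by field; rewrite gt_eqF.
Qed.

(** The triangle condition is dropped. For fixed p the quantity c + p^a is a mere translation in the
    Poisson kernel, so [integral_poisson_powR] bounds the q-integral uniformly in p. *)
Lemma inner_bound (B : R -> R) (a e c l : R) (xi : R3 R) :
  0 < e -> 0 < a -> a <= 1 -> 0 < l -> 0 < enorm3 xi ->
  measurable_fun setT B -> (forall q, 0 <= B q) ->
  (\int[L3]_z (B (dot3 (sub3 xi z) (sub3 xi z)) * (annulus l (dot3 z z))%:R *
      poisson e (c - (dot3 z z `^ a - dot3 (sub3 xi z) (sub3 xi z) `^ a)))%:E <=
   (disc_area / (2 * enorm3 xi) * (2 * pi / (a * ((2 * l) ^+ 2) `^ (a - 1))))%:E *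
     \int[leb]_q (B q)%:E)%E.
Proof.
move=> e0 a0 a1 l0 k0 mB B0; set k := enorm3 xi in k0 *.
pose G (z : R * R) := (B z.2 * (annulus l z.1)%:R * poisson e (c - (z.1 `^ a - z.2 `^ a)))%:E.
have mpw (p : R * R -> R) : measurable_fun setT p -> measurable_fun setT (fun z => p z `^ a).
  by move=> mp; exact: (measurableT_comp (measurable_powR a)).
have P0 t : 0 <= poisson e t by exact: poisson_ge0 (ltW e0).
have mG : measurable_fun setT G.
  apply/measurable_EFinP; apply: measurable_funM.
    apply: measurable_funM; first exact: (measurableT_comp mB).
    exact: measurable_annulus.
  apply: (measurableT_comp (measurable_poisson e0)); apply: measurable_funB => //.
  by apply: measurable_funB; exact: mpw.
have G0 z : (0 <= G z)%E by rewrite lee_fin; apply: mulr_ge0 => //; exact: mulr_ge0.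
rewrite (ge0_integral_bipolar k0 mG G0) -/k [in leRHS]EFinM -[leRHS]muleA.
have d0 := @disc_area_gt0 R.
apply: lee_wpmul2l; first by rewrite lee_fin divr_ge0// ?mulr_ge0 ?ltW.
set M := 2 * pi / _.
have mBE : measurable_fun setT (fun q => (B q)%:E) by exact/measurable_EFinP.
have mtri : measurable_fun setT (fun z : R * R => if triangle k z.1 z.2 then G z else 0%E).
  apply: measurable_if0 => //; apply: measurable_fun_ltr.
    apply: measurable_funX; apply: measurable_funB => //.
    by apply: measurable_funD => //; exact: measurable_cst.
  by apply: measurable_funM => //; exact: measurable_cst.
have tri0 z : (0 <= if triangle k z.1 z.2 then G z else 0)%E by case: ifP.
apply: (@le_trans _ _ (\int[leb]_q \int[leb]_p G (q, p))%E).
  apply: le_integralT.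
  - exact: (meas_eparam1 leb mtri tri0).
  - exact: (meas_eparam1 leb mG G0).
  - by move=> q; apply: integral_ge0 => p _; exact: (tri0 (q, p)).
  move=> q; apply: le_integralT.
  - exact: (measurableT_comp mtri (pair1_measurable q)).
  - exact: (measurableT_comp mG (pair1_measurable q)).
  - by move=> p; exact: (tri0 (q, p)).
  - by move=> p /=; case: ifP.
rewrite (fubini_tonelli (m1 := leb) (m2 := leb) G mG G0).
have M0 : 0 <= M.
  rewrite /M divr_ge0 ?mulr_ge0 ?pi_ge0 ?powR_ge0//; exact: ltW.
rewrite -ge0_integralZlT//.
apply: le_integralT.
- exact: (meas_eparam2 leb mG G0).
- by apply: emeasurable_funM => //; exact: measurable_cst.
- by move=> p; apply: integral_ge0 => q _; exact: G0.
move=> p.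
have u0 : 0 < (l / 2) ^+ 2 by rewrite exprn_gt0// divr_gt0.
have uv : (l / 2) ^+ 2 <= (2 * l) ^+ 2.
  by apply: lerXn2r; rewrite ?nnegrE ?divr_ge0 ?mulr_ge0 ?ltW//; lra.
have IM := integral_poisson_powR (c + p `^ a) e0 a0 a1 u0 uv.
have -> : (\int[leb]_q G (q, p) = (B p)%:E * \int[leb]_q
    (if ((l / 2) ^+ 2 <= q <= (2 * l) ^+ 2)%R then (poisson e (q `^ a - (c + p `^ a)))%:E else 0))%E.
  rewrite -ge0_integralZlT//.
  - apply: eq_integral_leb => q; rewrite /G /= -/(annulus l q).
    case: annulus; last by rewrite mulr0 mul0r mule0.
    by rewrite mulr1 -EFinM; congr (_ * _)%:E; rewrite -poissonN; congr poisson; ring.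
  - apply: measurable_if0.
      by apply: measurable_and; apply: measurable_fun_ler => //; exact: measurable_cst.
    apply/measurable_EFinP; apply: (measurableT_comp (measurable_poisson e0)).
    by apply: measurable_funB; [exact: measurable_powR|exact: measurable_cst].
  - by move=> q; case: ifP => _ //; rewrite lee_fin.
by rewrite muleC; apply: lee_wpmul2r; rewrite ?lee_fin.
Qed.

(** The left side is a constant times l1^(1-2a), nonincreasing in l1 since 2a >= 1. The 8 collects
    the given 2, the bound 2 for 2^(2-2a), and the bound 2 for 1/a. *)
Lemma powR_constant (a l1 l2 : R) : 1 / 2 <= a -> a <= 1 -> 0 < l2 -> l2 <= l1 ->
  2 * pi / (a * ((2 * l1) ^+ 2) `^ (a - 1)) / l1 <= 8 * pi * l2 `^ (1 - 2 * a).
Proof.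
move=> a12 a1 l20 l21; have l10 := lt_le_trans l20 l21.
have a0 : 0 < a by lra.
have p0 := pi_gt0 R.
have -> : ((2 * l1) ^+ 2) `^ (a - 1) = ((2 * l1) `^ (2 - 2 * a))^-1.
  rewrite -powR_mulrn ?mulr_ge0 ?ltW// -powRrM -powRN; congr (_ `^ _); ring.
have E : l1 `^ (2 - 2 * a) = l1 * l1 `^ (1 - 2 * a).
  rewrite (_ : 2 - 2 * a = 1 + (1 - 2 * a)); last by ring.
  by rewrite powRD ?powRr1 ?ltW// (gt_eqF l10) implybT.
rewrite powRM; [|by []|exact: ltW]; rewrite E.
have h2 : (2 : R) `^ (2 - 2 * a) <= 2.
  by rewrite -[leRHS]powRr1// ler_powR ?ler1n//; lra.
have hl : l1 `^ (1 - 2 * a) <= l2 `^ (1 - 2 * a).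
  rewrite (_ : 1 - 2 * a = - (2 * a - 1)); last by ring.
  rewrite !powRN lef_pV2 ?posrE ?powR_gt0//.
  by apply: ge0_ler_powR; rewrite ?nnegrE; [lra|exact: ltW|exact: ltW|].
have t0 : 0 < (2 : R) `^ (2 - 2 * a) by rewrite powR_gt0.
have q0 : 0 < l1 `^ (1 - 2 * a) by rewrite powR_gt0.
set t := 2 `^ _ in h2 t0 *; set q := l1 `^ _ in hl q0 *; set q2 := l2 `^ _ in hl *.
rewrite (_ : _ / _ / l1 = 2 * pi * (t * q) / a); last first.
  by field; rewrite !gt_eqF// ?mulr_gt0// mulr_gt0.
rewrite ler_pdivrMr//.
apply: (@le_trans _ _ (2 * pi * (2 * q2))).
  apply: ler_wpM2l; first by rewrite mulr_ge0// ltW.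
  by apply: ler_pM => //; exact: ltW.
have q20 : 0 < q2 by exact: lt_le_trans hl.
rewrite -subr_ge0 (_ : _ - _ = 8 * pi * q2 * (a - 1 / 2)); last by field.
by rewrite mulr_ge0 ?subr_ge0// !mulr_ge0// ltW.
Qed.

(** Powers are taken of squared lengths, so [a] will be [alpha / 2]; the second term of the phase
    has the sign of the backward wave. *)
Definition two_wave (a : R) (H K : R3 R -> R[i]) (xi : R3 R) (t : R) : R[i] :=
  cintegral L3 (fun y => cis (- (t * (dot3 y y `^ a - dot3 (sub3 xi y) (sub3 xi y) `^ a))) *
    (H y * K (sub3 xi y))).

Lemma sqint_reflect (K : R3 R -> R[i]) (xi : R3 R) : sqint L3 K ->
  sqint L3 (fun y => K (sub3 xi y)).
Proof.
move=> [mK nK]; have [ms ps] := preserves3_reflection xi; split.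
  exact: (cmeas_comp ms mK).
rewrite /n2; have := ps _ (meas_sqcE mK) (fun x => _ : 0 <= (sqc (K x))%:E)%E.
by move=> -> // x; rewrite lee_fin sqc_ge0.
Qed.

Lemma measurable_two_wave_phase (a : R) (xi : R3 R) :
  measurable_fun setT (fun y : R3 R => dot3 y y `^ a - dot3 (sub3 xi y) (sub3 xi y) `^ a).
Proof.
apply: measurable_funB; apply: (measurableT_comp (measurable_powR a)).
  exact: measurable_dot3.
by apply: measurable_dot3; exact: measurable_sub3.
Qed.

(* In Schur's test the cutoff to the annulus l2 is given to H and the cutoff to the
   annulus l1 to K: this is what bounds the two integrals of the test. *)
Lemma weighted_two_wave (a e l1 l2 : R) (H K : R3 R -> R[i]) (A B : R -> R) (xi : R3 R) :
  0 < e -> 0 < a -> a <= 1 -> 0 < l1 -> 0 < l2 -> 0 < enorm3 xi ->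
  sqint L3 H -> sqint L3 K -> measurable_fun setT A -> measurable_fun setT B ->
  (forall y, sqc (H y) = A (dot3 y y)) -> (forall y, sqc (K y) = B (dot3 y y)) ->
  (forall q, 0 <= A q) -> (forall q, 0 <= B q) ->
  (forall q, ~~ annulus l1 q -> A q = 0) -> (forall q, ~~ annulus l2 q -> B q = 0) ->
  (\int[leb]_t (expdecay e t * sqc (two_wave a H K xi t))%:E <=
   (disc_area / (2 * enorm3 xi) * (2 * pi / (a * ((2 * l1) ^+ 2) `^ (a - 1))))%:E *
     \int[leb]_q (B q)%:E * ((4 * disc_area * l2)%:E * \int[leb]_q (A q)%:E))%E.
Proof.
move=> e0 a0 a1 l10 l20 k0 sH sK mA mB HA KB A0 B0 As Bs.
pose ps (y : R3 R) := dot3 y y `^ a - dot3 (sub3 xi y) (sub3 xi y) `^ a.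
have mps : measurable_fun setT ps by exact: measurable_two_wave_phase.
pose a1' (y : R3 R) : R[i] := H y * ((annulus l2 (dot3 (sub3 xi y) (sub3 xi y)))%:R)%:C.
pose a2' (y : R3 R) : R[i] := K (sub3 xi y) * ((annulus l1 (dot3 y y))%:R)%:C.
have mr := measurable_sub3 xi.
have md : measurable_fun setT (fun y : R3 R => dot3 y y) by exact: measurable_dot3.
have mdr : measurable_fun setT (fun y : R3 R => dot3 (sub3 xi y) (sub3 xi y)).
  by apply: measurable_dot3.
have sKr := sqint_reflect xi sK.
have ma1 : cmeasurable a1'.
  by apply: cmeasM; [exact: (proj1 sH)|apply: cmeas_real; exact: measurable_annulus].
have ma2 : cmeasurable a2'.
  by apply: cmeasM; [exact: (proj1 sKr)|apply: cmeas_real; exact: measurable_annulus].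
(* The cutoffs do not change the product: where one of them is zero, so is the squared modulus of
   [K] or [H], by [Bs] or [As]. *)
have prodE y : a1' y * a2' y = H y * K (sub3 xi y).
  rewrite /a1' /a2'.
  case: (boolP (annulus l2 _)) => [_|n2']; last first.
    have K0 : K (sub3 xi y) = 0 by apply: sqc_eq0; rewrite KB Bs.
    by rewrite K0 mul0r !mulr0.
  case: (boolP (annulus l1 _)) => [_|n1']; first by rewrite !mulr1.
  have H0 : H y = 0 by apply: sqc_eq0; rewrite HA As.
  by rewrite H0 !mul0r.
have Ia : cintegrable L3 (fun y => a1' y * a2' y).
  under eq_fun do rewrite prodE; exact: cintegrable_mul.
pose th (z : R * R3 R) : R := - (z.1 * ps z.2).
have mth : measurable_fun setT th.
  apply: measurableT_comp => //; apply: measurable_funM => //.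
  exact: (measurableT_comp mps).
pose kk (z : R3 R * R3 R) : R := poisson e (ps z.1 - ps z.2).
have mkk : measurable_fun setT kk.
  apply: (measurableT_comp (measurable_poisson e0)).
  by apply: measurable_funB; exact: (measurableT_comp mps).
have kk0 z : 0 <= kk z by exact: poisson_ge0 (ltW e0).
have kks y z : kk (y, z) = kk (z, y) by rewrite /kk /= -poissonN opprB.
have wk y z : normc (cintegral leb (fun t => cis (th (t, y) - th (t, z)) * (expdecay e t)%:C))
    <= kk (y, z).
  rewrite (_ : cintegral _ _ = (poisson e (ps z - ps y))%:C); last first.
    rewrite -(cintegral_expdecay (ps z - ps y) e0); apply: eq_cintegral => t.
    by congr (cis _ * _); rewrite /th /=; ring.
  rewrite normc_real ger0_norm ?poisson_ge0 ?(ltW e0)//.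
  by rewrite -poissonN opprB.
have := schur_osc (mX := leb) (mY := L3) (expdecay_ge0 e) (integrable_expdecay e0) mth mkk
  kk0 kks wk ma1 ma2 Ia.
rewrite (_ : (\int[_]_x _)%E =
  (\int[leb]_t (expdecay e t * sqc (two_wave a H K xi t))%:E)%E); last first.
  apply: eq_integral_leb => t; congr (_ * sqc _)%:E; apply: eq_cintegral => y.
  by rewrite prodE.
move=> /le_trans; apply.
set D := (_ / _ * _)%:E; set IB := (\int[leb]_q (B q)%:E)%E; set IA := (\int[leb]_q (A q)%:E)%E.
have s1 y : sqc (a1' y) = A (dot3 y y) * (annulus l2 (dot3 (sub3 xi y) (sub3 xi y)))%:R.
  by rewrite /a1' sqcM sqc_real HA; case: annulus; rewrite ?expr1n ?expr0n.
have s2 z : sqc (a2' z) = B (dot3 (sub3 xi z) (sub3 xi z)) * (annulus l1 (dot3 z z))%:R.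
  by rewrite /a2' sqcM sqc_real KB; case: annulus; rewrite ?expr1n ?expr0n.
have IB0 : (0 <= IB)%E by apply: integral_ge0 => q _; rewrite lee_fin.
have D0 : (0 <= D)%E.
  rewrite lee_fin mulr_ge0// ?divr_ge0 ?mulr_ge0 ?powR_ge0 ?pi_ge0 ?ltW//.
  exact: disc_area_gt0.
have ms1 := meas_sqcE ma1; have ms2 := meas_sqcE ma2.
apply: (@le_trans _ _ (\int[L3]_y ((D * IB) * (sqc (a1' y))%:E))%E).
  apply: le_integralT.
  - apply: (meas_eparam1 L3 (f := fun z => (sqc (a1' z.1) * sqc (a2' z.2) * kk z)%:E)).
      apply/measurable_EFinP; apply: measurable_funM => //; apply: measurable_funM.
        exact: (measurableT_comp (meas_sqc ma1)).
      exact: (measurableT_comp (meas_sqc ma2)).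
    by move=> z; rewrite lee_fin mulr_ge0// mulr_ge0// sqc_ge0.
  - by apply: emeasurable_funM => //; exact: measurable_cst.
  - move=> y; apply: integral_ge0 => z _.
    by rewrite lee_fin mulr_ge0// mulr_ge0// sqc_ge0.
  move=> y.
  (* The bound does not depend on the translation [ps y]; what remains is the integral of
     [sqc (a1' y)], handled by [outer_bound]. *)
  have IBd := inner_bound (ps y) e0 a0 a1 l10 k0 mB B0.
  rewrite -[X in (_ * X)%E]/((sqc (a1' y))%:E) muleC.
  apply: (@le_trans _ _ ((sqc (a1' y))%:E * \int[L3]_z
      (B (dot3 (sub3 xi z) (sub3 xi z)) * (annulus l1 (dot3 z z))%:R *
      poisson e (ps y - (dot3 z z `^ a - dot3 (sub3 xi z) (sub3 xi z) `^ a)))%:E)%E); last first.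
    by apply: lee_wpmul2l; rewrite ?lee_fin ?sqc_ge0.
  rewrite -ge0_integralZlT ?sqc_ge0//.
  - rewrite le_eqVlt; apply/orP; left; apply/eqP; apply: eq_integral => z _.
    by rewrite -EFinM s2; apply: f_equal; rewrite -mulrA.
  - apply/measurable_EFinP; apply: measurable_funM.
      by apply: measurable_funM; [exact: (measurableT_comp mB)|exact: measurable_annulus].
    apply: (measurableT_comp (measurable_poisson e0)).
    by apply: measurable_funB; [exact: measurable_cst|exact: mps].
  - move=> z; rewrite lee_fin; apply: mulr_ge0; first by apply: mulr_ge0.
    exact: poisson_ge0 (ltW e0).
rewrite ge0_integralZl//; last 2 first.
- by move=> y _; rewrite lee_fin sqc_ge0.
- exact: mule_ge0.
apply: lee_wpmul2l; first exact: mule_ge0.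
under eq_integral do rewrite s1.
exact: outer_bound.
Qed.

Lemma two_wave_time (a l1 l2 : R) (H K : R3 R -> R[i]) (A B : R -> R) (xi : R3 R) :
  1 / 2 <= a -> a <= 1 -> 0 < l2 -> l2 <= l1 -> 0 < enorm3 xi ->
  sqint L3 H -> sqint L3 K -> measurable_fun setT A -> measurable_fun setT B ->
  (forall y, sqc (H y) = A (dot3 y y)) -> (forall y, sqc (K y) = B (dot3 y y)) ->
  (forall q, 0 <= A q) -> (forall q, 0 <= B q) ->
  (forall q, ~~ annulus l1 q -> A q = 0) -> (forall q, ~~ annulus l2 q -> B q = 0) ->
  (\int[leb]_t (sqc (two_wave a H K xi t))%:E <=
   (64 * pi * l2 `^ (1 - 2 * a) / enorm3 xi)%:E * (n2 L3 H * n2 L3 K))%E.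
Proof.
move=> a12 a1 l20 l21 k0 sH sK mA mB HA KB A0 B0 As Bs.
have l10 := lt_le_trans l20 l21.
have a0 : 0 < a by lra.
have w0 := @disc_area_gt0 R.
(* Converts the one-dimensional masses of the profiles into norms, which brings the factors 1/l1 and
   1/l2. *)
have mass (l : R) (h : R3 R -> R[i]) (E : R -> R) : 0 < l -> measurable_fun setT E ->
    (forall y, sqc (h y) = E (dot3 y y)) -> (forall q, 0 <= E q) ->
    (forall q, ~~ annulus l q -> E q = 0) ->
    (\int[leb]_q (E q)%:E <= ((disc_area * (l / 2))^-1)%:E * n2 L3 h)%E.
  move=> l0 mE hE E0 Es.
  have c0 : 0 < disc_area * (l / 2) :> R by rewrite mulr_gt0// divr_gt0.
  have := annulus_mass l0 mE E0 Es.
  rewrite (_ : (\int[L3]_x (E (dot3 x x))%:E)%E = n2 L3 h); last first.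
    by apply: eq_integral => x _; rewrite hE.
  move=> /(lee_wpmul2l (x := (disc_area * (l / 2))^-1%:E) _) => /(_ _).
  rewrite muleA -EFinM mulVf ?gt_eqF// mul1e; apply.
  by rewrite lee_fin invr_ge0 ltW.
have IAb := mass l1 H A l10 mA HA A0 As.
have IBb := mass l2 K B l20 mB KB B0 Bs.
have mph := measurable_two_wave_phase a xi.
have mJ : cmeasurable (two_wave a H K xi).
  apply: (cmeas_kernel_int L3 (K := fun z : R * R3 R =>
    cis (- (z.1 * (dot3 z.2 z.2 `^ a - dot3 (sub3 xi z.2) (sub3 xi z.2) `^ a))))).
    apply: cmeas_cis; apply: measurableT_comp => //; apply: measurable_funM => //.
    exact: (measurableT_comp mph).
  by apply: cmeasM; [exact: (proj1 sH)|exact: (proj1 (sqint_reflect xi sK))].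
pose f (n : nat) (t : R) : R[i] :=
  (expdecay (2^-1 * n.+1%:R^-1) t)%:C * two_wave a H K xi t.
have mf n : cmeasurable (f n).
  by apply: cmeasM => //; apply: cmeas_real; exact: measurable_expdecay.
have Fat := @n2_fatou _ _ _ leb f (two_wave a H K xi)
  ((64 * pi * l2 `^ (1 - 2 * a) / enorm3 xi)%:E * (n2 L3 H * n2 L3 K))%E mf mJ.
apply: Fat.
  apply: aeW => t; rewrite -[X in ccvg _ X]mul1r.
  apply: ccvgM; last exact: ccvg_cst.
  apply: ccvg_real.
  (* The damping in time is the three-dimensional one at the point (t, 0, 0). *)
  have := @cvg_damp R 2^-1 (t, 0, 0); rewrite /damp /=.
  have e0 c : expdecay c 0 = 1 :> R by rewrite /expdecay normr0 mulr0 oppr0 expR0.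
  by under eq_fun do rewrite !e0 !mulr1.
apply: nearW => n.
have n0 : 0 < n.+1%:R^-1 :> R by rewrite invr_gt0.
have := weighted_two_wave n0 a0 a1 l10 l20 k0 sH sK mA mB HA KB A0 B0 As Bs.
rewrite (_ : (\int[_]_t _)%E = n2 leb (f n)); last first.
  apply: eq_integral_leb => t; rewrite /f sqcM sqc_real; congr (_ * _)%:E.
  rewrite /expdecay expr2 -expRD; congr expR; field.
  by rewrite gt_eqF// ltr_pwDl// ler0n.
move=> /le_trans; apply.
set D := _ / _ * _; set W := 4 * _ * _.
have D0 : 0 <= D.
  rewrite /D; apply: mulr_ge0; apply: divr_ge0; rewrite ?mulr_ge0 ?powR_ge0 ?pi_ge0//; exact: ltW.
have W0 : 0 <= W by rewrite /W !mulr_ge0// ltW.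
apply: (@le_trans _ _ ((D%:E * (((disc_area * (l2 / 2))^-1)%:E * n2 L3 K)) *
    (W%:E * (((disc_area * (l1 / 2))^-1)%:E * n2 L3 H)))%E).
  apply: lee_pmul.
  - by apply: mule_ge0; rewrite ?lee_fin//; apply: integral_ge0 => q _; rewrite lee_fin.
  - by apply: mule_ge0; rewrite ?lee_fin//; apply: integral_ge0 => q _; rewrite lee_fin.
  - by apply: lee_wpmul2l => //; rewrite lee_fin.
  - by apply: lee_wpmul2l => //; rewrite lee_fin.
rewrite (muleA D%:E) (muleA W%:E) -!EFinM muleACA -EFinM (muleC (n2 L3 K)).
apply: lee_wpmul2r; first by apply: mule_ge0; exact: n2_ge0.
rewrite lee_fin.
have PC := powR_constant a12 a1 l20 l21.
rewrite /D /W; set M := 2 * pi / _ in PC *; set q2 := l2 `^ _ in PC *.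
set k := enorm3 xi in k0 *.
(* [l2] and all areas cancel, while [l1] stays in the denominator, ready for [powR_constant]; the 64
   is this 8 times the 8 found there. *)
rewrite (_ : disc_area / (2 * k) * M / (disc_area * (l2 / 2)) *
  (4 * disc_area * l2 / (disc_area * (l1 / 2))) = 8 * (M / l1) / k); last first.
  by field; rewrite !gt_eqF.
rewrite ler_pM2r ?invr_gt0//.
rewrite (_ : 64 * pi * q2 = 8 * (8 * pi * q2)); last by ring.
by rewrite ler_pM2l.
Qed.
End TimeEstimate.

(** * Frequency localization *)

Section LittlewoodPaley.
Context {R : realType}.
Local Notation leb := (@lebesgue_measure R).
Local Notation L3 := (@leb3 R).
Variable (rho : R -> R).
Hypothesis hrho : is_cutoff rho.
Implicit Types (f h F : R3 R -> R[i]) (x xi : R3 R) (l q : R).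

Lemma cutoff_continuous : continuous rho.
Proof.
case: hrho => d _ _ _ _ s; apply: differentiable_continuous; apply/derivable1_diffP.
exact: (d 0%N s).
Qed.

Lemma cutoff_eq0 s : 2 <= `|s| -> rho s = 0.
Proof.
case: hrho => _ _ sub _ _ s2; apply/eqP/negPn/negP => ns.
have cs : closure [set s | rho s != 0] s by apply: (@subset_closure R) => /=.
have := sub s cs; rewrite /= in_itv/= -ltr_norml => h.
by move: s2; rewrite leNgt h.
Qed.

Lemma cutoff_eq1 s : `|s| <= 1 -> rho s = 1.
Proof. by case: hrho => _ _ _ _; apply. Qed.

Lemma cutoff_bounded : exists2 M : R, 0 < M & forall s, `|rho s| <= M.
Proof.
have cab : {within `[-2, 2 : R], continuous (fun s => `|rho s|)}.
  apply: continuous_subspaceT => s; apply: continuous_comp; first exact: cutoff_continuous.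
  exact: norm_continuous.
have l22 : -2 <= 2 :> R by lra.
have [c _ hc] := EVT_max l22 cab.
exists (`|rho c| + 1); first by rewrite ltr_wpDl.
move=> s; have [s2|s2] := leP 2 `|s|; first by rewrite cutoff_eq0// normr0 addr_ge0.
by rewrite (le_trans (hc s _)) ?lerDl// in_itv/= -ler_norml ltW.
Qed.

(** The multiplier as a function of the squared length, the variable of [annulus] and of the
    profiles. *)
Definition mult l q : R := rho (l^-1 * Num.sqrt q) - rho (2 * (l^-1 * Num.sqrt q)).

Lemma chi_mult l xi : 0 < l -> chi rho (scale3 l^-1 xi) = mult l (dot3 xi xi).
Proof.
move=> l0; rewrite /chi /mult (_ : enorm3 (scale3 l^-1 xi) = l^-1 * Num.sqrt (dot3 xi xi))//.
rewrite /enorm3 (_ : dot3 _ _ = l^-1 ^+ 2 * dot3 xi xi); last by rewrite /dot3 /scale3/=; ring.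
by rewrite sqrtrM ?sqr_ge0// sqrtr_sqr ger0_norm// invr_ge0 ltW.
Qed.

Lemma measurable_mult l : measurable_fun setT (mult l).
Proof.
have cr : continuous (fun q : R => l^-1 * Num.sqrt q).
  by move=> q; apply: cvgM; [exact: cvg_cst|exact: sqrt_continuous].
apply: continuous_measurable_fun => q; apply: cvgB.
  by apply: (continuous_comp (f := fun q : R => l^-1 * Num.sqrt q)); [exact: cr|exact: cutoff_continuous].
apply: (continuous_comp (f := fun q : R => 2 * (l^-1 * Num.sqrt q))); last exact: cutoff_continuous.
by apply: cvgM; [exact: cvg_cst|exact: cr].
Qed.

(** Below the annulus both values of the cutoff are 1 and cancel; above it both are 0. *)
Lemma mult_eq0 l q : 0 < l -> ~~ annulus l q -> mult l q = 0.
Proof.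
move=> l0; rewrite /annulus negb_and -!ltNge => /orP[h|h].
- have s : l^-1 * Num.sqrt q <= 1 / 2.
    rewrite ler_pdivrMl// (_ : l * (1 / 2) = l / 2); last by field.
    have l2 : 0 <= l / 2 by rewrite divr_ge0// ltW.
    by rewrite -(ger0_norm l2) -sqrtr_sqr; apply: ler_wsqrtr; exact: ltW.
  have s0 : 0 <= l^-1 * Num.sqrt q by rewrite mulr_ge0 ?invr_ge0 ?sqrtr_ge0// ltW.
  set z := l^-1 * Num.sqrt q in s s0 *.
  have h1 : `|z| <= 1 by rewrite ger0_norm//; lra.
  have h2 : `|2 * z| <= 1 by rewrite ger0_norm; lra.
  by rewrite /mult -/z !cutoff_eq1// subrr.
- have s : 2 <= l^-1 * Num.sqrt q.
    rewrite ler_pdivlMl// mulrC.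
    have l2 : 0 <= 2 * l by rewrite mulr_ge0// ltW.
    by rewrite -(ger0_norm l2) -sqrtr_sqr; apply: ler_wsqrtr; exact: ltW.
  set z := l^-1 * Num.sqrt q in s *.
  have h1 : 2 <= `|z| by rewrite ger0_norm; lra.
  have h2 : 2 <= `|2 * z| by rewrite ger0_norm; lra.
  by rewrite /mult -/z !cutoff_eq0// subrr.
Qed.

Lemma mult_bounded : exists2 M : R, 0 < M & forall l q, `|mult l q| <= M.
Proof.
have [M M0 hM] := cutoff_bounded; exists (M + M); first by rewrite addr_gt0.
by move=> l q; rewrite /mult (le_trans (ler_normB _ _))// lerD.
Qed.

Definition localize l F xi : R[i] := (mult l (dot3 xi xi))%:C * F xi.

Lemma cmeas_mult l : cmeasurable (fun xi : R3 R => (mult l (dot3 xi xi))%:C).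
Proof.
apply: cmeas_real; apply: (measurableT_comp (measurable_mult l)).
exact: measurable_dot3.
Qed.

Lemma cmeas_localize l F : cmeasurable F -> cmeasurable (localize l F).
Proof. by move=> mF; apply: cmeasM => //; exact: cmeas_mult. Qed.

Lemma sqc_localize l F xi : sqc (localize l F xi) = mult l (dot3 xi xi) ^+ 2 * sqc (F xi).
Proof. by rewrite /localize sqcM sqc_real. Qed.

Lemma sqint_localize l F : sqint L3 F -> sqint L3 (localize l F).
Proof.
move=> sF; have [M M0 hM] := mult_bounded.
apply: (sqint_le (mu := L3) (cmeas_localize l (proj1 sF)) (sqintZ M%:C sF)) => xi.
rewrite sqc_localize sqcM sqc_real; apply: ler_wpM2r; first exact: sqc_ge0.
rewrite -(real_normK (num_real (mult _ _))).
by apply: lerXn2r; rewrite ?nnegrE// ltW.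
Qed.

Lemma annulus_ball l xi : 0 < l -> annulus l (dot3 xi xi) -> enorm3 xi <= 2 * l.
Proof.
move=> l0 /andP[_ h]; have l2 : 0 <= 2 * l by rewrite mulr_ge0// ltW.
by rewrite -(ger0_norm l2) -sqrtr_sqr; exact: ler_wsqrtr.
Qed.

Lemma cintegrable_localize l F : 0 < l -> sqint L3 F -> cintegrable L3 (localize l F).
Proof.
move=> l0 sF.
have := cintegrable_mul (sqint_ball_indic (2 * l)) (sqint_localize l sF).
rewrite (_ : (fun x => _) = localize l F)//; apply/funext => xi; rewrite /ball_indic.
case: (boolP (annulus l (dot3 xi xi))) => h; first by rewrite annulus_ball// mul1r.
by rewrite /localize mult_eq0// mul0r mulr0.
Qed.

Local Notation P3 := ((2 * pi) ^+ 3 : R).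

(* The multiplier makes the symbol integrable, so that LP is given by an absolutely
   convergent integral, which only depends on the class of the Fourier transform. *)
Lemma LP_osc l F F' : 0 < l -> sqint L3 F -> cmeasurable F' ->
  {ae L3, forall xi, fourier F xi = F' xi} ->
  LP rho l F = (fun x => (P3^-1)%:C * osc 1 (localize l F') x).
Proof.
move=> l0 sF mF' FF'; have sf := sqint_fourier sF.
have E : (fun xi => (chi rho (scale3 l^-1 xi))%:C * fourier F xi) = localize l (fourier F).
  by apply/funext => xi; rewrite chi_mult.
rewrite /LP E inv_fourier_L1; last exact: cintegrable_localize.
rewrite inv_fourier_intE; apply/funext => x; congr (_ * _).
apply: ae_eq_cintegral.
- by apply: cmeasM; [exact: cmeas_phase1|exact: cmeas_localize (proj1 sf)].
- by apply: cmeasM; [exact: cmeas_phase1|exact: cmeas_localize].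
- by apply: ae_mono FF' => xi h; rewrite /localize h.
Qed.

Definition wave (alpha t : R) F xi : R[i] := cis (- (t * enorm3 xi `^ alpha)) * F xi.

Lemma cmeas_wave_symbol alpha t : cmeasurable (fun xi : R3 R => cis (- (t * enorm3 xi `^ alpha))).
Proof.
apply: cmeas_cis; apply: measurableT_comp => //.
apply: measurable_funM; first exact: measurable_cst.
exact: (measurableT_comp (measurable_powR alpha) measurable_enorm3).
Qed.

Lemma cmeas_wave alpha t F : cmeasurable F -> cmeasurable (wave alpha t F).
Proof. by move=> mF; apply: cmeasM => //; exact: cmeas_wave_symbol. Qed.

Lemma sqint_wave alpha t F : sqint L3 F -> sqint L3 (wave alpha t F).
Proof.
move=> sF; apply: (sqint_le (mu := L3) (cmeas_wave alpha t (proj1 sF)) sF) => xi.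
by rewrite /wave sqcM sqc_cis mul1r.
Qed.

Lemma cintegrable_wave alpha t F : cintegrable L3 F -> cintegrable L3 (wave alpha t F).
Proof.
move=> IF; apply: (cintegrableM (M := 1) IF (cmeas_wave_symbol alpha t)) => xi.
by rewrite normc_cis.
Qed.

(** The Fourier transform of the propagated function is identified only almost everywhere, with an
    exceptional set depending on t; inside the integral that defines the localization this is
    harmless, and the formula holds at every point. *)
Lemma LP_propagator l alpha t f f' : 0 < l -> sqint L3 f -> cmeasurable f' ->
  {ae L3, forall xi, fourier f xi = f' xi} ->
  LP rho l (propagator alpha t f) =
  (fun x => (P3^-1)%:C * osc 1 (wave alpha t (localize l f')) x).
Proof.
move=> l0 sf mf' ff'; have sw := sqint_wave alpha t (sqint_fourier sf).
have -> := LP_osc l0 (sqint_inv_fourier sw) (cmeas_wave alpha t mf').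
  apply/funext => x; congr (_ * osc 1 _ x); apply/funext => xi.
  by rewrite /localize /wave mulrCA.
apply: (ae_mono2 _ (fourier_inv_fourier sw) ff') => xi h1 h2.
by rewrite h1 /wave h2.
Qed.
End LittlewoodPaley.

(** * Products of localized waves and convolutions *)

Section Bilinear.
Context {R : realType}.
Local Notation leb := (@lebesgue_measure R).
Local Notation L3 := (@leb3 R).
Local Notation P3 := ((2 * pi) ^+ 3 : R).
Implicit Types (h F : R3 R -> R[i]) (x xi : R3 R).

Lemma sub3K xi x : sub3 xi (sub3 xi x) = x.
Proof. by case: x => [[x y] z]; rewrite /sub3/=; congr (_, _, _); ring. Qed.

Lemma cintegrable_reflect h xi : cintegrable L3 h -> cintegrable L3 (fun y => h (sub3 xi y)).
Proof.
move=> /cintegrableP[mh ih]; have [ms ps] := preserves3_reflection xi.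
apply/cintegrableP; split; first exact: (cmeas_comp ms mh).
rewrite (ps (fun x => (normc (h x))%:E))//; last by move=> x; rewrite lee_fin normc_ge0.
by apply/measurable_EFinP; exact: meas_normc.
Qed.

(** Multiplying [osc 1 h2] by the phase exp(-i x.xi) gives [osc (-1)] of y -> h2(xi - y), so
    Parseval's identity applies to [h1] and this reflected function. *)
Lemma osc_mul_convolution h1 h2 xi :
  cintegrable L3 h1 -> sqint L3 h1 -> cintegrable L3 h2 -> sqint L3 h2 ->
  osc (-1) (fun x => osc 1 h1 x * osc 1 h2 x) xi =
  P3%:C * cintegral L3 (fun y => h1 y * h2 (sub3 xi y)).
Proof.
move=> I1 s1 I2 s2.
rewrite -(parseval_osc I1 s1 (cintegrable_reflect xi I2) (sqint_reflect xi s2)).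
apply: eq_cintegral => x; rewrite mulrCA; congr (_ * _).
have m2 : cmeasurable (fun y => cis (-1 * dot3 x (sub3 xi y)) * h2 y).
  apply: cmeasM; last by case: s2.
  apply: cmeas_cis; apply: measurable_funM; first exact: measurable_cst.
  by apply: measurable_dot3; [exact: measurable_cst|exact: measurable_sub3].
transitivity (cintegral L3 (fun y => cis (-1 * dot3 x (sub3 xi y)) * h2 y)).
  rewrite /osc -cintegralZ; last exact: cintegrable_phase.
  apply: eq_cintegral => y; rewrite mulrA -cisD; congr (cis _ * _).
  by rewrite /dot3 /sub3/=; ring.
transitivity (cintegral L3 (fun y => cis (-1 * dot3 x (sub3 xi (sub3 xi y))) * h2 (sub3 xi y))).
  exact: esym (preserves3_cintegral (preserves3_reflection xi : preserves3 (sub3 xi)) m2).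
by apply: eq_cintegral => y; rewrite sub3K.
Qed.

Lemma wave_mul_two_wave (alpha t : R) H K xi y :
  wave alpha t H y * wave alpha (- t) K (sub3 xi y) =
  cis (- (t * (dot3 y y `^ (alpha / 2) - dot3 (sub3 xi y) (sub3 xi y) `^ (alpha / 2)))) *
    (H y * K (sub3 xi y)).
Proof.
have E z : enorm3 z `^ alpha = dot3 z z `^ (alpha / 2) :> R.
  have d0 : 0 <= dot3 z z :> R by rewrite -enorm3_sq sqr_ge0.
  by rewrite /enorm3 -powR12_sqrt// -powRrM; congr (_ `^ _); field.
by rewrite /wave !E mulrACA -cisD; congr (cis _ * _); ring.
Qed.

Lemma integral_box u v : le3 u v ->
  (\int[L3]_x (box u v x)%:E = ((v.1.1 - u.1.1) * (v.1.2 - u.1.2) * (v.2 - u.2))%:E)%E.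
Proof.
move=> /and3P[h1 h2 h3].
rewrite leb3_zyx; last 2 first.
- by apply/measurable_EFinP; exact: measurable_box.
- by move=> x; rewrite lee_fin box_ge0.
have tot (m p q : R) : 0 <= m -> p <= q ->
    (\int[leb]_t (m%:E * (slab p q t)%:E) = (m * (q - p))%:E)%E.
  move=> m0 pq; rewrite ge0_integralZlT//; last 2 first.
  - by apply/measurable_EFinP; exact: measurable_slab.
  - by move=> t; rewrite lee_fin slab_ge0.
  rewrite integral_indic//= setIT -[X in (_ * X)%E]/(leb `]p, q]%classic).
  by rewrite leb_ocitv.
have d1 : 0 <= v.1.1 - u.1.1 by rewrite subr_ge0.
have d2 : 0 <= v.1.2 - u.1.2 by rewrite subr_ge0.
transitivity (\int[leb]_z (((v.1.1 - u.1.1) * (v.1.2 - u.1.2))%:E * (slab u.2 v.2 z)%:E))%E.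
  apply: eq_integral_leb => z.
  transitivity (\int[leb]_t (((v.1.1 - u.1.1) * slab u.2 v.2 z)%:E * (slab u.1.2 v.1.2 t)%:E))%E.
    apply: eq_integral_leb => t.
    transitivity (\int[leb]_s ((slab u.1.2 v.1.2 t * slab u.2 v.2 z)%:E * (slab u.1.1 v.1.1 s)%:E))%E.
      by apply: eq_integral_leb => s; rewrite -EFinM /box /=; congr EFin; ring.
    by rewrite tot ?mulr_ge0 ?slab_ge0// -EFinM; congr EFin; ring.
  by rewrite tot ?mulr_ge0 ?slab_ge0// -EFinM; congr EFin; ring.
by rewrite tot ?mulr_ge0.
Qed.

Lemma cmeas_two_wave (a : R) H K : cmeasurable H -> cmeasurable K ->
  cmeasurable (fun z : R * R3 R => two_wave a H K z.2 z.1).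
Proof.
move=> mH mK.
pose F (z : (R * R3 R) * R3 R) : R[i] :=
  cis (- (z.1.1 * (dot3 z.2 z.2 `^ a - dot3 (sub3 z.1.2 z.2) (sub3 z.1.2 z.2) `^ a))) *
    (H z.2 * K (sub3 z.1.2 z.2)).
have ms : measurable_fun setT (fun z : (R * R3 R) * R3 R => sub3 z.1.2 z.2).
  apply: measurable_fun_sub3 => //.
  exact: (measurableT_comp measurable_snd measurable_fst).
have mF : cmeasurable F.
  apply: cmeasM.
    apply: cmeas_cis; apply: measurableT_comp => //; apply: measurable_funM.
      exact: (measurableT_comp measurable_fst measurable_fst).
    by apply: measurable_funB; apply: (measurableT_comp (measurable_powR a));
      apply: measurable_dot3.
  by apply: cmeasM; [exact: (cmeas_comp measurable_snd mH)|exact: (cmeas_comp ms mK)].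
exact: (cmeas_param L3 mF).
Qed.

(** The first factor is bounded, being the transform of an integrable function, and the second is
    square-integrable. *)
Lemma sqint_osc_mul h1 h2 : cintegrable L3 h1 -> cintegrable L3 h2 -> sqint L3 h2 ->
  sqint L3 (fun x => osc 1 h1 x * osc 1 h2 x).
Proof.
move=> I1 I2 s2; have so2 := sqint_osc (@sign1 R) I2 s2.
pose M := \int[L3]_y normc (h1 y).
have M0 : 0 <= M by exact: Rintegral_normc_ge0.
apply: (sqint_le (mu := L3) _ (sqintZ M%:C so2)).
  by apply: cmeasM; apply: cmeas_osc; [exact: (cintegrable_meas I1)|exact: (cintegrable_meas I2)].
move=> x; rewrite !sqcM sqc_real; apply: ler_wpM2r; first exact: sqc_ge0.
rewrite -normc_sq; apply: lerXn2r; rewrite ?nnegrE ?normc_ge0//.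
exact: osc_bounded.
Qed.
End Bilinear.

(** * The bilinear estimate for squared norms *)

Section Assembly.
Context {R : realType}.
Local Notation leb := (@lebesgue_measure R).
Local Notation L3 := (@leb3 R).
Local Notation P3 := ((2 * pi) ^+ 3 : R).
Variables (rho : R -> R) (alpha : R).
Hypotheses (hrho : is_cutoff rho) (halpha : 1 <= alpha <= 2).
Implicit Types (f g H K : R3 R -> R[i]) (x xi : R3 R).

Let a : R := alpha / 2.

Lemma localized_profile f (l : R) : 0 < l -> sqint L3 f -> radial f ->
  exists (f' : R3 R -> R[i]) (A : R -> R),
  [/\ sqint L3 f', {ae L3, forall xi, fourier f xi = f' xi}, measurable_fun setT A,
      forall q, 0 <= A q &
      (forall y, sqc (localize rho l f' y) = A (dot3 y y)) /\
      (forall q, ~~ annulus l q -> A q = 0)].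
Proof.
move=> l0 sf rf; have sF := sqint_fourier sf.
have [f' [A [mf' mA A0 ff' fA]]] := radial_profile (@signN1 R) sf rf (osc2_fourier sf).
exists f', (fun q => mult rho l q ^+ 2 * A q); split => //.
- split => //; rewrite -(n2_ae (mu := L3) (proj1 sF) mf' ff').
  by case: sF.
- apply: measurable_funM => //; apply: measurable_funX; exact: measurable_mult.
- by move=> q; rewrite mulr_ge0// sqr_ge0.
- split=> [y|q nq]; first by rewrite sqc_localize fA.
  by rewrite mult_eq0// expr0n mul0r.
Qed.

(** Returns from the Fourier side to the norms on the right of the theorem; this is the use of the
    reverse Plancherel inequality. *)
Lemma n2_localize_LP f f' (l : R) : 0 < l -> sqint L3 f -> sqint L3 f' ->
  {ae L3, forall xi, fourier f xi = f' xi} ->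
  (n2 L3 (localize rho l f') <= (2 * P3)%:E * n2 L3 (LP rho l f))%E.
Proof.
move=> l0 sf sf' ff'; have p0 := @pi3_gt0 R.
have Ih := cintegrable_localize hrho l0 sf'; have sh := sqint_localize hrho l sf'.
rewrite (LP_osc hrho l0 sf (proj1 sf') ff').
rewrite (n2Z L3 _ (cmeas_osc 1 (proj1 sh))) sqc_real muleA -EFinM.
apply: le_trans (n2_le_osc Ih sh) _.
rewrite le_eqVlt; apply/orP; left; apply/eqP; congr (_%:E * _)%E.
have E (P : R) : 0 < P -> 2 / P = 2 * P * P^-1 ^+ 2.
  by move=> P0; field; rewrite gt_eqF.
exact: E p0.
Qed.

(** A cube, whose volume is explicit, replaces the annulus in the last integral. Taking 3m instead
    of 2m keeps the annulus off the missing faces. *)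
Lemma annulus_box (m : R) xi : 0 < m -> annulus m (dot3 xi xi) ->
  box (- (3 * m), - (3 * m), - (3 * m)) (3 * m, 3 * m, 3 * m) xi = 1.
Proof.
move=> m0 h; have := annulus_ball m0 h => xm.
have [x1 x2 x3] := enorm3_coords xi.
have sl (t : R) : `|t| <= enorm3 xi -> slab (- (3 * m)) (3 * m) t = 1.
  move=> tx; rewrite /slab indicE mem_setE in_itv/=.
  have : `|t| < 3 * m by rewrite (le_lt_trans tx)// (le_lt_trans xm)// ltr_pM2r// ltr_nat.
  by rewrite ltr_norml => /andP[-> /ltW ->].
by rewrite /box/= !sl// !mulr1.
Qed.

Lemma annulus_enorm3_ge (m : R) xi : 0 < m -> annulus m (dot3 xi xi) -> m / 2 <= enorm3 xi.
Proof.
move=> m0 /andP[h _]; have m2 : 0 <= m / 2 by rewrite divr_ge0// ltW.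
by rewrite -(ger0_norm m2) -sqrtr_sqr; exact: ler_wsqrtr.
Qed.

Lemma n2_leb13 (F : R * R3 R -> R[i]) : cmeasurable F ->
  n2 (@leb13 R) F = (\int[leb]_t n2 L3 (fun x => F (t, x)))%E.
Proof.
move=> mF.
have F0 z : (0 <= (sqc (F z))%:E)%E by rewrite lee_fin sqc_ge0.
exact: (fubini_tonelli1 (m1 := leb) (m2 := L3) _ (meas_sqcE mF) F0).
Qed.

Lemma bilinear_n2 : exists2 C : R, 0 <= C & forall f g (mu l1 l2 : R),
  sqint L3 f -> sqint L3 g -> radial f -> radial g ->
  0 < mu -> 0 < l2 -> l2 <= l1 ->
  (n2 (@leb13 R) (fun tx : R * R3 R => LP rho mu
      (fun x => (LP rho l1 (propagator alpha tx.1 f) x *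
                 LP rho l2 (propagator alpha (- tx.1) g) x)%R) tx.2)
   <= (C * mu ^+ 2 * l2 `^ (1 - alpha))%:E * (n2 L3 (LP rho l1 f) * n2 L3 (LP rho l2 g)))%E.
Proof.
have p0 := @pi3_gt0 R; have pi0 := @pi_gt0 R.
have a12 : 1 / 2 <= a by rewrite /a; case/andP: halpha => h _; lra.
have a1 : a <= 1 by rewrite /a; case/andP: halpha => _ h; lra.
have [M M0 hM] := mult_bounded hrho.
have cube (m : R) : 0 < m ->
    0 <= (3 * m - - (3 * m)) * (3 * m - - (3 * m)) * (3 * m - - (3 * m)).
  move=> m0; have h : 0 <= 3 * m - - (3 * m) by lra.
  exact: mulr_ge0 (mulr_ge0 h h) h.
have cube3 (m : R) : 0 < m -> le3 (- (3 * m), - (3 * m), - (3 * m)) (3 * m, 3 * m, 3 * m).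
  move=> m0; have h : - (3 * m) <= 3 * m by lra.
  by rewrite /le3 /= h.
(* The cancellations are stated for a variable [P] standing for (2 pi)^3, so that [field] does not
   expand the power. *)
have cancel1 (P m s : R) : 0 < P ->
    P^-1 ^+ 2 * P * (m * (P^-1 ^+ 2 * s)) = P^-1 ^+ 3 * (m * s).
  by move=> P0; field; rewrite gt_eqF.
have cancel2 (P p m q : R) : 0 < P -> 0 < m ->
    P^-1 ^+ 3 * (M ^+ 2 * (64 * p * q / (m / 2))) *
      ((3 * m - - (3 * m)) * (3 * m - - (3 * m)) * (3 * m - - (3 * m))) * (2 * P * (2 * P)) =
    P^-1 ^+ 3 * M ^+ 2 * (64 * p * (2 * 6 ^+ 3)) * (4 * P ^+ 2) * m ^+ 2 * q.
  by move=> P0 m0; field; rewrite !gt_eqF.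
(* In order: normalizations of the transforms, bound of the multiplier, constant of [two_wave_time]
   with 2 from 1/|xi| <= 2/mu and 6^3 from the cube, and two applications of [n2_localize_LP]. *)
exists (P3^-1 ^+ 3 * M ^+ 2 * (64 * pi * (2 * 6 ^+ 3)) * (4 * P3 ^+ 2)).
  by rewrite !mulr_ge0 ?exprn_ge0 ?invr_ge0 ?ltW.
move=> f g mu l1 l2 sf sg rf rg mu0 l20 l21.
have l10 := lt_le_trans l20 l21.
have [f' [A [sf' ff' mA A0 [HA As]]]] := localized_profile l10 sf rf.
have [g' [B [sg' gg' mB B0 [KB Bs]]]] := localized_profile l20 sg rg.
set H := localize rho l1 f' in HA; set K := localize rho l2 g' in KB.
have sH : sqint L3 H by exact: sqint_localize.
have sK : sqint L3 K by exact: sqint_localize.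
have IH : cintegrable L3 H by exact: cintegrable_localize.
have IK : cintegrable L3 K by exact: cintegrable_localize.
pose W (t : R) x := LP rho l1 (propagator alpha t f) x * LP rho l2 (propagator alpha (- t) g) x.
have WE t : W t = (fun x => ((P3^-1)%:C * (P3^-1)%:C) *
    (osc 1 (wave alpha t H) x * osc 1 (wave alpha (- t) K) x)).
  apply/funext => x; rewrite /W (LP_propagator hrho alpha t l10 sf (proj1 sf') ff').
  by rewrite (LP_propagator hrho alpha (- t) l20 sg (proj1 sg') gg') mulrACA.
have IHt t := cintegrable_wave alpha t IH.
have IKt t := cintegrable_wave alpha t IK.
have sHt t := sqint_wave alpha t sH.
have sKt t := sqint_wave alpha t sK.
have sW t : sqint L3 (W t).
  by rewrite WE; apply: sqintZ; apply: sqint_osc_mul.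
have IW t : cintegrable L3 (W t).
  rewrite WE; apply: cintegrableZ; apply: cintegrable_mul; apply: sqint_osc => //; exact: sign1.
(* [W t] is integrable, so its transform is the integral itself and the formula holds at every [xi]
   and [t]. *)
have FW t : fourier (W t) = (fun xi => (P3^-1)%:C * two_wave a H K xi t).
  rewrite fourier_L1// fourier_intE WE; apply/funext => xi.
  rewrite oscZ; last by apply: cintegrable_mul; apply: sqint_osc => //; exact: sign1.
  rewrite osc_mul_convolution// mulrA; congr (_ * _).
    rewrite -!rmorphM/=; congr (_%:C).
    by rewrite -mulrA mulVf ?mulr1// gt_eqF.
  by apply: eq_cintegral => y; rewrite wave_mul_two_wave.
have sJ t : sqint L3 (fun xi => (P3^-1)%:C * two_wave a H K xi t).
  by rewrite -FW; exact: sqint_fourier.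
pose Lo (t : R) := localize rho mu (fun xi => (P3^-1)%:C * two_wave a H K xi t).
have LPW t : LP rho mu (W t) = (fun x => (P3^-1)%:C * osc 1 (Lo t) x).
  apply: LP_osc => //; first by case: (sJ t).
  by apply: aeW => xi; rewrite FW.
have mJ : cmeasurable (fun z : R * R3 R => two_wave a H K z.2 z.1).
  by apply: cmeas_two_wave; [case: sH|case: sK].
have mLo : cmeasurable (fun z : R * R3 R => Lo z.1 z.2).
  apply: cmeasM; first exact: (cmeas_comp measurable_snd (cmeas_mult hrho mu)).
  by apply: cmeasM => //; exact: cmeas_cst.
(* Joint measurability in t and x, which Tonelli's theorem needs, is read off the explicit integral
   formula. *)
have mPhi : cmeasurable (fun z : R * R3 R => (P3^-1)%:C * osc 1 (Lo z.1) z.2).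
  apply: cmeasM; first exact: cmeas_cst.
  have mG : cmeasurable (fun z : (R * R3 R) * R3 R => cis (1 * dot3 z.1.2 z.2) * Lo z.1.1 z.2).
    have m12 := measurableT_comp (@measurable_snd _ _ R (R3 R)) (@measurable_fst _ _ (R * R3 R)%type (R3 R)).
    have m11 := measurableT_comp (@measurable_fst _ _ R (R3 R)) (@measurable_fst _ _ (R * R3 R)%type (R3 R)).
    apply: cmeasM.
      apply: cmeas_cis; apply: measurable_funM; first exact: measurable_cst.
      exact: measurable_dot3.
    have mp : measurable_fun setT (fun z : (R * R3 R) * R3 R => (z.1.1, z.2)).
      by apply: measurable_fun_pair.
    exact: (cmeas_comp mp mLo).
  exact: (cmeas_param L3 mG).
rewrite (_ : n2 _ _ = \int[leb]_t n2 L3 (LP rho mu (W t)))%E; last first.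
  rewrite (_ : (fun tx : R * R3 R => _) =
    (fun z : R * R3 R => (P3^-1)%:C * osc 1 (Lo z.1) z.2)); last first.
    by apply/funext => -[t x] /=; rewrite -/(W t) LPW.
  by rewrite (n2_leb13 mPhi); apply: eq_integral_leb => t; rewrite LPW.
(* Two inverse powers come from the outer inverse transform, two from [FW], and Plancherel's
   inequality gives one power back. *)
pose c0 : R := P3^-1 ^+ 3.
have c00 : 0 <= c0 by rewrite exprn_ge0// invr_ge0 ltW.
pose Psi (z : R * R3 R) : \bar R :=
  (c0 * (mult rho mu (dot3 z.2 z.2) ^+ 2 * sqc (two_wave a H K z.2 z.1)))%:E.
have mm2 : measurable_fun setT (fun xi : R3 R => mult rho mu (dot3 xi xi)).
  apply: (measurableT_comp (measurable_mult hrho mu)); exact: measurable_dot3.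
have mPsi : measurable_fun setT Psi.
  apply/measurable_EFinP; apply: measurable_funM; first exact: measurable_cst.
  apply: measurable_funM; last exact: (meas_sqc mJ).
  by apply: measurable_funX; exact: (measurableT_comp mm2 measurable_snd).
have Psi0 z : (0 <= Psi z)%E.
  by rewrite lee_fin mulr_ge0// mulr_ge0// ?sqr_ge0// sqc_ge0.
have step1 : (\int[leb]_t n2 L3 (LP rho mu (W t)) <= \int[leb]_t \int[L3]_xi Psi (t, xi))%E.
  apply: le_integralT.
  - rewrite (_ : (fun t => _) = (fun t => \int[L3]_x (sqc ((P3^-1)%:C * osc 1 (Lo t) x))%:E)%E).
      apply: (meas_eparam1 L3 (f := fun z => (sqc ((P3^-1)%:C * osc 1 (Lo z.1) z.2))%:E)).
        exact: meas_sqcE.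
      by move=> z; rewrite lee_fin sqc_ge0.
    by apply/funext => t; rewrite LPW.
  - exact: (meas_eparam1 L3 mPsi Psi0).
  - by move=> t; exact: n2_ge0.
  move=> t; have sL := sqint_localize hrho mu (sJ t).
  rewrite LPW (n2Z L3 _ (cmeas_osc 1 (proj1 sL))).
  apply: (@le_trans _ _ ((sqc (P3^-1)%:C)%:E * (P3%:E * n2 L3 (Lo t)))%E).
    apply: lee_wpmul2l; first by rewrite lee_fin sqc_ge0.
    exact: plancherel_le (@sign1 R) (cintegrable_localize hrho mu0 (sJ t)).
  rewrite muleA -EFinM /n2 -ge0_integralZlT; last 3 first.
  - by rewrite mulr_ge0 ?sqc_ge0// ltW.
  - by apply: meas_sqcE; case: sL.
  - by move=> xi; rewrite lee_fin sqc_ge0.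
  rewrite le_eqVlt; apply/orP; left; apply/eqP; apply: eq_integral => xi _.
  rewrite /Psi /Lo sqc_localize sqcM !sqc_real -EFinM /c0 /=; congr EFin.
  exact: cancel1.
apply: le_trans step1 _.
rewrite (fubini_tonelli (m1 := leb) (m2 := L3) Psi mPsi Psi0).
set q := l2 `^ (1 - alpha); have q0 : 0 <= q by exact: powR_ge0.
set N := (n2 L3 H * n2 L3 K)%E.
have N0 : (0 <= N)%E by apply: mule_ge0; exact: n2_ge0.
pose u0 : R3 R := (- (3 * mu), - (3 * mu), - (3 * mu)).
pose v0 : R3 R := (3 * mu, 3 * mu, 3 * mu).
pose D : R := c0 * (M ^+ 2 * (64 * pi * q / (mu / 2))).
have pq0 : 0 <= 64 * pi * q by rewrite mulr_ge0// mulr_ge0// ltW.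
have m20 : 0 < mu / 2 by rewrite divr_gt0.
have D0 : 0 <= D.
  exact: mulr_ge0 c00 (mulr_ge0 (sqr_ge0 M) (divr_ge0 pq0 (ltW m20))).
(* Off the annulus the multiplier is zero; on it [mu / 2 <= enorm3 xi], which bounds 1/|xi| in
   [two_wave_time]. *)
have step2 xi : (\int[leb]_t Psi (t, xi) <= (D%:E * N) * (box u0 v0 xi)%:E)%E.
  rewrite (_ : (\int[leb]_t _)%E = ((c0 * mult rho mu (dot3 xi xi) ^+ 2)%:E *
      \int[leb]_t (sqc (two_wave a H K xi t))%:E)%E); last first.
    rewrite -ge0_integralZlT.
    - by apply: eq_integral_leb => t; rewrite /Psi -EFinM mulrA.
    - by rewrite mulr_ge0// sqr_ge0.
    - apply/measurable_EFinP.
      exact: (measurableT_comp (meas_sqc mJ) (pair2_measurable xi)).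
    - by move=> t; rewrite lee_fin sqc_ge0.
  case: (boolP (annulus mu (dot3 xi xi))) => an; last first.
    rewrite mult_eq0// expr0n mulr0 mul0e mule_ge0// ?lee_fin ?box_ge0//.
    exact: mule_ge0.
  have xi_ge := annulus_enorm3_ge mu0 an.
  have xi0 := lt_le_trans m20 xi_ge.
  rewrite /u0 /v0 annulus_box// mule1.
  have TW := two_wave_time a12 a1 l20 l21 xi0 sH sK mA mB HA KB A0 B0 As Bs.
  have cm0 : 0 <= c0 * mult rho mu (dot3 xi xi) ^+ 2 by rewrite mulr_ge0// sqr_ge0.
  apply: le_trans (lee_wpmul2l _ TW) _; first by rewrite lee_fin.
  rewrite muleA -EFinM; apply: lee_wpmul2r => //; rewrite lee_fin /D -[leLHS]mulrA.
  rewrite (_ : 1 - 2 * a = 1 - alpha); last by rewrite /a; field.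
  apply: ler_wpM2l => //; apply: ler_pM.
  - exact: sqr_ge0.
  - exact: divr_ge0 pq0 (ltW xi0).
  - rewrite -(real_normK (num_real (mult _ _ _))).
    by apply: lerXn2r; rewrite ?nnegrE// ltW.
  - apply: ler_wpM2l; first exact: pq0.
    by rewrite lef_pV2.
apply: (@le_trans _ _ (\int[L3]_xi ((D%:E * N) * (box u0 v0 xi)%:E))%E).
  apply: le_integralT.
  - exact: (meas_eparam2 leb mPsi Psi0).
  - apply: emeasurable_funM; first exact: measurable_cst.
    by apply/measurable_EFinP; exact: measurable_box.
  - by move=> xi; apply: integral_ge0 => t _; exact: Psi0.
  - exact: step2.
rewrite ge0_integralZl//; last 3 first.
- by apply/measurable_EFinP; exact: measurable_box.
- by move=> xi _; rewrite lee_fin box_ge0.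
- exact: mule_ge0.
(* The volume (6 mu)^3, multiplied by 2/mu, supplies the factor mu^2. *)
rewrite (integral_box (cube3 mu mu0)).
have nH := n2_localize_LP l10 sf sf' ff'; have nK := n2_localize_LP l20 sg sg' gg'.
have NN : (N <= ((2 * P3)%:E * n2 L3 (LP rho l1 f)) * ((2 * P3)%:E * n2 L3 (LP rho l2 g)))%E.
  exact: lee_pmul (n2_ge0 L3 H) (n2_ge0 L3 K) nH nK.
rewrite muleAC -EFinM.
apply: le_trans (lee_wpmul2l _ NN) _.
  by rewrite lee_fin; exact: mulr_ge0 D0 (cube mu mu0).
rewrite muleACA -EFinM muleA -EFinM.
rewrite le_eqVlt; apply/orP; left; apply/eqP; congr (_%:E * _)%E.
exact: (cancel2 P3 pi mu q p0 mu0).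
Qed.
End Assembly.

Lemma dyadic_gt0 (R : realType) (l : R) : dyadic l -> 0 < l.
Proof. by move=> [k ->]; rewrite exprz_gt0. Qed.

Lemma L2norm_le_of_n2 d1 d2 (T1 : measurableType d1) (T2 : measurableType d2) (R : realType)
    (m1 : {measure set T1 -> \bar R}) (m2 : {measure set T2 -> \bar R})
    (F : T1 -> R[i]) (G H : T2 -> R[i]) (c : R) : 0 <= c ->
  (n2 m1 F <= c%:E * (n2 m2 G * n2 m2 H))%E ->
  (L2norm m1 F <= (c `^ 2^-1)%:E * L2norm m2 G * L2norm m2 H)%E.
Proof.
move=> c0 h; rewrite -muleA !L2norm_n2 -poweR_EFin.
have G0 : (0 <= n2 m2 G)%E := n2_ge0 m2 G.
have H0 : (0 <= n2 m2 H)%E := n2_ge0 m2 H.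
have GH0 : (0 <= n2 m2 G * n2 m2 H)%E by exact: mule_ge0.
have r0 : (0 : R) <= 2^-1 by rewrite invr_ge0.
rewrite -(poweRM _ G0 H0) -poweRM ?lee_fin//.
apply: (gt0_ler_poweR r0) => //; rewrite in_itv/= leey andbT; first exact: n2_ge0.
by rewrite mule_ge0.
Qed.

Theorem proposition2p3 (R : realType) (rho : R -> R) (hrho : is_cutoff rho)
    (alpha : R) (halpha : 1 <= alpha <= 2) :
  exists C : R,
  forall (f g : R3 R -> complex R),
    inL2 (@leb3 R) f -> inL2 (@leb3 R) g -> radial f -> radial g ->
  forall mu lambda1 lambda2 : R,
    dyadic mu -> dyadic lambda1 -> dyadic lambda2 -> lambda2 <= lambda1 ->
  let u (t : R) := propagator alpha t f in
  let v (t : R) := propagator alpha (- t) g in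
  (L2norm (@leb13 R)
     (fun tx : R * R3 R =>
        LP rho mu
          (fun x => (LP rho lambda1 (u tx.1) x * LP rho lambda2 (v tx.1) x)%R)
          tx.2)
   <= (C * mu * lambda2 `^ ((1 - alpha) / 2))%:E
      * L2norm (@leb3 R) (LP rho lambda1 f)
      * L2norm (@leb3 R) (LP rho lambda2 g))%E.
Proof.
have [C C0 hC] := bilinear_n2 hrho halpha.
exists (Num.sqrt C) => f g /inL2P sf /inL2P sg rf rg mu l1 l2.
move=> /dyadic_gt0 mu0 _ /dyadic_gt0 l20 l21; cbv zeta.
have c0 : 0 <= C * mu ^+ 2 * l2 `^ (1 - alpha).
  exact: mulr_ge0 (mulr_ge0 C0 (sqr_ge0 mu)) (powR_ge0 _ _).
have E : (C * mu ^+ 2 * l2 `^ (1 - alpha)) `^ 2^-1 =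
    Num.sqrt C * mu * l2 `^ ((1 - alpha) / 2).
  have e1 : (mu ^+ 2) `^ 2^-1 = mu.
    by rewrite powR12_sqrt ?sqr_ge0// sqrtr_sqr ger0_norm// ltW.
  rewrite (powRM _ (mulr_ge0 C0 (sqr_ge0 mu)) (powR_ge0 _ _)) (powRM _ C0 (sqr_ge0 mu)).
  by rewrite e1 (powR12_sqrt C0) -powRrM.
have h := L2norm_le_of_n2 c0 (hC f g mu l1 l2 sf sg rf rg mu0 l20 l21).
by rewrite E in h.
Qed.
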